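(* There exist an absolute constant $c$ and an algorithm using space polynomial in the input size such that, given a multigraph $G=(V,E)$ and a non-negative integer $k$, in time $k^{{\mathcal O}(1)}\cdot|V|$ it outputs either $k$ pairwise vertex-disjoint cycles of $G$ or a feedback vertex set of $G$ of size at most $ck\log k$.
   Context: Graphs are finite, undirected, and may have self-loops and parallel edges, with every edge of multiplicity at most 2; a self-loop is a cycle of length 1 and a double edge is a cycle of length 2. A feedback vertex set of $G$ is a set $F\subseteq V$ such that $G-F$ is a forest (has no cycles). Logarithms are base 2. Standing assumption: the input graph satisfies $|E|={\mathcal O}(k\log k\cdot|V|)$. *)

(* Defs.v *)
From Stdlib Require Import Reals.
From mathcomp Require Import all_boot.

Set Implicit Arguments.
Unset Strict Implicit.
Unset Printing Implicit Defensive.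

(* The pair [ends e] is to be read as unordered: everything below is invariant
   under swapping its components.  A self-loop has two equal components. *)
Record multigraph := MultiGraph {
  vertex : finType;
  edge : finType;
  ends : edge -> vertex * vertex
}.

Section Graphs.
Variable G : multigraph.

Definition joins (e : edge G) (u v : vertex G) : bool :=
  (ends e == (u, v)) || (ends e == (v, u)).

Definition multiplicity_le2 : bool :=
  [forall u : vertex G, forall v : vertex G, #|[set e | joins e u v]| <= 2].

(* The cycle v_0 e_0 v_1 e_1 ... v_(l-1) e_(l-1) v_0 is represented by the list
   of the pairs (v_i, e_i).  A self-loop is a list of length 1, and two parallel
   edges make a list of length 2. *)
Definition is_cycle (c : seq (vertex G * edge G)) : bool :=
  [&& c != [::], uniq (unzip1 c), uniq (unzip2 c) &
      cycle (fun x y : vertex G * edge G => joins x.2 x.1 y.1) c].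

Definition vertex_disjoint (c1 c2 : seq (vertex G * edge G)) : bool :=
  ~~ has (mem (unzip1 c1)) (unzip1 c2).

Section Deletion.
Variable F : {set vertex G}.

Definition kept_vertex := {v : vertex G | v \notin F}.
Definition kept_edge :=
  {e : edge G | ((ends e).1 \notin F) && ((ends e).2 \notin F)}.

Definition kept_ends (e : kept_edge) : kept_vertex * kept_vertex :=
  (exist _ (ends (val e)).1 (proj1 (andP (valP e))),
   exist _ (ends (val e)).2 (proj2 (andP (valP e)))).

Definition delete_vertices : multigraph := MultiGraph kept_ends.
End Deletion.

End Graphs.

Definition forest (G : multigraph) : Prop :=
  forall c : seq (vertex G * edge G), ~~ is_cycle c.

Definition feedback_vertex_set (G : multigraph) (F : {set vertex G}) : Prop :=
  forest (delete_vertices F).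

(* The machine is a word RAM programmed in a structured language.  Its memory
   is a fixed finite number of arrays, named by numerals in the program (a
   scalar variable is an array used at index 0 only); this is a plain RAM with
   the arrays interleaved, up to a constant factor. *)

Inductive binop := Plus | Minus | Times | Over | Equal | Less.

Inductive expr :=
| Const of nat
| Get of nat & expr                  (* array name, index *)
| Op of binop & expr & expr.

Inductive cmd :=
| Skip
| Put of nat & expr & expr           (* array name, index, new value *)
| Out of expr                        (* append to the write-only output tape *)
| Seq of cmd & cmd
| If of expr & cmd & cmd
| While of expr & cmd.

Definition memory := nat -> nat -> nat.

Definition update (M : memory) (a i x : nat) : memory :=
  fun b j => if (b == a) && (j == i) then x else M b j.

(* [Minus] is truncated, and [Over] gives 0 when dividing by 0. *)
Definition apply_op (o : binop) (x y : nat) : nat :=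
  match o with
  | Plus => x + y
  | Minus => x - y
  | Times => x * y
  | Over => x %/ y
  | Equal => x == y
  | Less => x < y
  end.

Section Semantics.
(* [w] is the word length in bits and [S] the number of cells of each array.
   Execution is stuck as soon as a value does not fit in a word or an index
   exceeds the available memory. *)
Variables w S : nat.

Definition word (x : nat) : option nat := if x < 2 ^ w then Some x else None.

Fixpoint eval (M : memory) (e : expr) : option nat :=
  match e with
  | Const x => word x
  | Get a i =>
      if eval M i is Some j then (if j < S then word (M a j) else None)
      else None
  | Op o e1 e2 =>
      match eval M e1, eval M e2 with
      | Some x, Some y => word (apply_op o x y)
      | _, _ => None
      end
  end.

Fixpoint cost (e : expr) : nat :=
  match e with
  | Const _ => 1
  | Get _ i => (cost i).+1
  | Op _ e1 e2 => (cost e1 + cost e2).+1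
  end.

Definition state := (memory * seq nat)%type.

(* [exec P s t s']: from [s], the program [P] halts in [s'] after exactly [t]
   unit-cost steps. *)
Inductive exec : cmd -> state -> nat -> state -> Prop :=
| exec_skip s : exec Skip s 1 s
| exec_put a ei ex M o i x of
    eval M ei = Some i & i < S & eval M ex = Some x :
    exec (Put a ei ex) (M, o) (cost ei + cost ex).+1 (update M a i x, o)
| exec_out e M o x of eval M e = Some x :
    exec (Out e) (M, o) (cost e).+1 (M, rcons o x)
| exec_seq c1 c2 s1 s2 s3 t1 t2 of exec c1 s1 t1 s2 & exec c2 s2 t2 s3 :
    exec (Seq c1 c2) s1 (t1 + t2) s3
| exec_if e c1 c2 s s' t x of
    eval s.1 e = Some x & exec (if x != 0 then c1 else c2) s t s' :
    exec (If e c1 c2) s (cost e + t).+1 s'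
| exec_while_stop e c s of eval s.1 e = Some 0 :
    exec (While e c) s (cost e).+1 s
| exec_while_step e c s1 s2 s3 t1 t2 x of
    eval s1.1 e = Some x & x != 0 & exec c s1 t1 s2 &
    exec (While e c) s2 t2 s3 :
    exec (While e c) s1 (cost e + t1 + t2).+1 s3.

End Semantics.

Fixpoint expr_arrays (e : expr) : seq nat :=
  match e with
  | Const _ => [::]
  | Get a i => a :: expr_arrays i
  | Op _ e1 e2 => expr_arrays e1 ++ expr_arrays e2
  end.

Fixpoint arrays (P : cmd) : seq nat :=
  match P with
  | Skip => [::]
  | Put a ei ex => a :: expr_arrays ei ++ expr_arrays ex
  | Out e => expr_arrays e
  | Seq c1 c2 => arrays c1 ++ arrays c2
  | If e c1 c2 => expr_arrays e ++ arrays c1 ++ arrays c2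
  | While e c => expr_arrays e ++ arrays c
  end.

(* Memory, in bits, of the machine that runs [P] with parameters [w] and [S]. *)
Definition space (P : cmd) (w S : nat) : nat :=
  size (undup (arrays P)) * S * w.

Definition bit_length (x : nat) : nat := (trunc_log 2 x).+1.

Section Encoding.
Variables n m : nat.
Variable ed : 'I_m -> 'I_n * 'I_n.

Definition graph_of : multigraph := MultiGraph ed.

(* Array 0 holds n, m and k; arrays 1 and 2 hold the first and second ends of
   the edges, listed in an arbitrary order and with arbitrary orientations.
   The rest of the memory is initially zero. *)
Definition input_memory (k : nat) : memory := fun a i =>
  match a with
  | 0 => nth 0 [:: n; m; k] i
  | 1 => nth 0 [seq nat_of_ord (ed e).1 | e <- enum 'I_m] i
  | 2 => nth 0 [seq nat_of_ord (ed e).2 | e <- enum 'I_m] i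
  | _ => 0
  end.

(* Vertices and edges count for one each, and k is written in binary; this is
   polynomially related to the number of bits of the input. *)
Definition input_size (k : nat) : nat := n + m + bit_length k.

Inductive answer :=
| Cycles of seq (seq ('I_n * 'I_m))
| FeedbackSet of seq 'I_n.

(* Each cycle is preceded by its length. *)
Definition encode_answer (ans : answer) : seq nat :=
  match ans with
  | FeedbackSet F => 0 :: [seq nat_of_ord v | v <- F]
  | Cycles cs =>
      1 :: flatten
        [seq size c :: flatten [seq [:: nat_of_ord x.1; nat_of_ord x.2] | x <- c]
        | c <- cs]
  end.

End Encoding.

Section RealBounds.
Local Open Scope R_scope.

Definition Rlog2 (x : R) : R := ln x / ln 2.

(* At k = 0 the value is 0, since Stdlib has ln 0 = 0. *)
Definition klogk (k : nat) : R := INR k * Rlog2 (INR k).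

(* The summand 1 matters only for k <= 1, where k log k vanishes: without it,
   the only graphs allowed there would be edgeless. *)
Definition few_edges (d : R) (n m k : nat) : Prop :=
  INR m <= d * (klogk k + 1) * INR n.

Definition at_most_klogk (c : R) (k r : nat) : Prop := INR r <= c * klogk k.

End RealBounds.

Definition correct_answer (c : R) (n m : nat) (ed : 'I_m -> 'I_n * 'I_n)
    (k : nat) (ans : answer n m) : Prop :=
  match ans with
  | Cycles cs =>
      [/\ size cs = k,
          all (@is_cycle (graph_of ed)) cs &
          pairwise (@vertex_disjoint (graph_of ed)) cs]
  | FeedbackSet F =>
      [/\ uniq F,
          @feedback_vertex_set (graph_of ed) [set v in F] &
          at_most_klogk c k (size F)]
  end.

(* Main.v *)
Require Import Defs.
From Stdlib Require Import Reals Lra.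
From mathcomp Require Import all_boot.
From mathcomp Require Import zify.

(* Following Simonovits, grow a subgraph H by ears: a path through new vertices
   between two vertices of degree 2 of H, a cycle through new vertices and one
   vertex of degree 2 of H, or a cycle disjoint from H.  An ear is found by a
   linear-time search, and its ends become blocked.  If no ear exists after r
   rounds, the at most 2r blocked vertices meet all cycles.  Otherwise stop after
   (k - 1)(8D + 5) + 1 ears, where D = O(log k): every ear raises the excess
   2|E(H)| - 2|V(H)| + (number of components) by at least 1.  Then, k times, trim
   the leaves of H and search it without going beyond the D-th branch vertex of a
   tree path.  If this search closed no cycle, its tree would have at least 2^D
   leaves up to weights, more than there are branch vertices.  So it closes a
   cycle with at most 2D + 1 branch vertices, and deleting that cycle lowers the
   excess by at most 8D + 5. *)

Set Implicit Arguments.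
Unset Strict Implicit.
Unset Printing Implicit Defensive.

(** The excess is weighted so that both kinds of growth count. A disjoint cycle leaves the
    difference of edges and vertices unchanged but adds a component; an attached ear raises the
    doubled difference by 2 and merges at most two components. Since H has maximum degree 4, a cycle
    with few branch vertices meets few edges outside it, which bounds the loss at a deletion. One
    search serves both phases. For ears its roots are the unblocked vertices of H and no vertex
    counts as depth; for cycles there are no initial roots and the depth counts branch vertices. An
    edge between two different trees is welcome in the first phase and must not occur in the second,
    so the search tracks the root of each vertex. Absence of cycles is certified by a rank of the
    vertices under which at most one edge goes down from each; visiting order and position on an ear
    provide such ranks. A round costs O(n + m), there are at most O(k^2) rounds, and m = O(k^2 n) as
    log k = O(k); hence the factor k^4. *)

Fixpoint writes (c : cmd) : seq nat :=
  match c with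
  | Put a _ _ => [:: a]
  | Seq c1 c2 | If _ c1 c2 => writes c1 ++ writes c2
  | While _ c1 => writes c1
  | _ => [::]
  end.

Fixpoint outputs (c : cmd) : bool :=
  match c with
  | Out _ => true
  | Seq c1 c2 | If _ c1 c2 => outputs c1 || outputs c2
  | While _ c1 => outputs c1
  | _ => false
  end.

(** Each piece of code is specified only on the arrays that it writes; the frame, read off the
    syntax, carries all other facts across it. Memories are compared pointwise. *)
Definition frame (c : cmd) (s s' : state) : Prop :=
  (forall a, a \notin writes c -> s'.1 a =1 s.1 a) /\
  (~~ outputs c -> s'.2 = s.2).

(** The value of an expression with the limits on words and cells ignored; [safe] below gives
    conditions under which [eval] agrees with it. *)
Fixpoint den (M : memory) (e : expr) : nat :=
  match e with
  | Const x => x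
  | Get a i => M a (den M i)
  | Op o e1 e2 => apply_op o (den M e1) (den M e2)
  end.

(** * Total correctness with running times, for executions that do not get stuck *)

Section Hoare.
Variables w S : nat.
Hypothesis w_ge : 128 < 2 ^ w.

Definition bounded (M : memory) := forall a i, M a i < 2 ^ w.

Lemma eval_lt M e x : eval w S M e = Some x -> x < 2 ^ w.
Proof.
have W y z : word w y = Some z -> z < 2 ^ w by rewrite /word; case: ifP => // + [<-].
case: e => [c|a i|o e1 e2] /=; first exact: W.
  by case: eval => // j; case: ifP => // _; exact: W.
by case: eval => // y; case: eval => // z; exact: W.
Qed.

Lemma update_bounded M a i x : bounded M -> x < 2 ^ w -> bounded (update M a i x).
Proof. by move=> bM lx b j; rewrite /update; case: ifP. Qed.

Lemma exec_bounded c s t s' : exec w S c s t s' -> bounded s.1 -> bounded s'.1.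
Proof.
elim=> //=; first by move=> a ei ex M o i x _ _ /eval_lt lx bM; exact: update_bounded.
- by move=> c1 c2 s1 s2 s3 t1 t2 _ I1 _ I2 /I1 /I2.
- by move=> e c0 s1 s2 s3 t1 t2 x _ _ _ I1 _ I2 /I1 /I2.
Qed.

Lemma frame_trans c s1 s2 s3 : frame c s1 s2 -> frame c s2 s3 -> frame c s1 s3.
Proof.
move=> [f1 o1] [f2 o2]; split=> [a na j|no]; last by rewrite o2 ?o1.
by rewrite f2 ?f1.
Qed.

Lemma frame_sub c c' s s' : {subset writes c' <= writes c} ->
  (outputs c' -> outputs c) -> frame c' s s' -> frame c s s'.
Proof.
move=> sw so [f o]; split=> [a na|no]; first by apply: f; apply: contra na; exact: sw.
by apply: o; apply: contra no.
Qed.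

Lemma exec_frame c s t s' : exec w S c s t s' -> frame c s s'.
Proof.
elim=> //=.
- move=> a ei ex M o i x _ _ _; split=> // b /=; rewrite inE => nb j.
  by rewrite /update (negbTE nb).
- move=> c1 c2 x y z t1 t2 _ I1 _ I2; apply: (@frame_trans _ x y z).
    by apply: frame_sub I1 => [a aw|ow] /=; rewrite ?mem_cat ?aw ?ow.
  by apply: frame_sub I2 => [a aw|ow] /=; rewrite ?mem_cat ?aw ?ow ?orbT.
- move=> e c1 c2 s1 s2 t1 x _ _; case: (x != 0) => I1;
  by apply: frame_sub I1 => [a aw|ow] /=; rewrite ?mem_cat ?aw ?ow ?orbT.
- by move=> e c1 s1 s2 s3 t1 t2 x _ _ _ I1 _; apply: frame_trans.
Qed.

(* In a bounded memory only constants, sums and products can overflow. *)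
Fixpoint safe (M : memory) (e : expr) : Prop :=
  match e with
  | Const x => x <= 128
  | Get a i => safe M i /\ den M i < S
  | Op o e1 e2 => safe M e1 /\ safe M e2 /\
     match o with
     | Plus | Times => apply_op o (den M e1) (den M e2) < 2 ^ w
     | _ => True
     end
  end.

Lemma safe_eval M e : bounded M -> safe M e -> eval w S M e = Some (den M e).
Proof.
move=> bM; elim: e => [x|a i IHi|o e1 IH1 e2 IH2] /=.
- by move=> lx; rewrite /word (leq_ltn_trans lx).
- by move=> [/IHi-> ->]; rewrite /word bM.
move=> [s1 [s2 h]]; rewrite (IH1 s1) (IH2 s2) /word.
suff -> : apply_op o (den M e1) (den M e2) < 2 ^ w by [].
have l1 := eval_lt (IH1 s1); have l2 := eval_lt (IH2 s2).
case: o h => //= _.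
- by apply: leq_ltn_trans l1; rewrite leq_subr.
- by apply: leq_ltn_trans l1; rewrite leq_div.
- by apply: leq_ltn_trans (leq_b1 _) (ltn_trans _ w_ge).
- by apply: leq_ltn_trans (leq_b1 _) (ltn_trans _ w_ge).
Qed.

Definition runs (c : cmd) (s : state) (T : nat) (Q : state -> Prop) : Prop :=
  exists t s', [/\ exec w S c s t s', t <= T & Q s'].

(** Only loop-free code is treated by computation. Loops go through [runs_while] and [runs_for], so
    [While] gets the precondition [False]. *)
Fixpoint wp (c : cmd) (Q : state -> Prop) (s : state) : Prop :=
  match c with
  | Skip => Q s
  | Put a ei ex => safe s.1 ei /\ den s.1 ei < S /\ safe s.1 ex /\
      Q (update s.1 a (den s.1 ei) (den s.1 ex), s.2)
  | Out e => safe s.1 e /\ Q (s.1, rcons s.2 (den s.1 e))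
  | Seq c1 c2 => wp c1 (wp c2 Q) s
  | If e c1 c2 => safe s.1 e /\ (if den s.1 e != 0 then wp c1 Q s else wp c2 Q s)
  | While _ _ => False
  end.

(** The two branches of a conditional are added up, a simple upper bound. The value 0 for loops is
    harmless, as [wp] excludes them. *)
Fixpoint time (c : cmd) : nat :=
  match c with
  | Skip => 1
  | Put _ ei ex => (cost ei + cost ex).+1
  | Out e => (cost e).+1
  | Seq c1 c2 => time c1 + time c2
  | If e c1 c2 => (cost e + (time c1 + time c2)).+1
  | While _ _ => 0
  end.

Lemma runs_wp c s Q : bounded s.1 -> wp c Q s -> runs c s (time c) Q.
Proof.
elim: c s Q => [|a ei ex|e|c1 IH1 c2 IH2|e c1 IH1 c2 IH2|e c1 _] s Q bs /=.
- by move=> Qs; exists 1, s; split=> //; constructor.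
- case: s bs => M o /= bM [s1 [li [s2 Qs]]].
  exists (cost ei + cost ex).+1, (update M a (den M ei) (den M ex), o); split=> //.
  by constructor=> //; apply: safe_eval.
- case: s bs => M o /= bM [s1 Qs].
  exists (cost e).+1, (M, rcons o (den M e)); split=> //.
  by constructor; apply: safe_eval.
- move=> /(IH1 _ _ bs) [t1 [s1 [x1 l1]]] /(IH2 _ _ (exec_bounded x1 bs)).
  move=> [t2 [s2 [x2 l2 Qs]]]; exists (t1 + t2), s2; split=> //; last exact: leq_add.
  exact: exec_seq x1 x2.
- move=> [se h]; have ev := safe_eval bs se.
  suff [t [s' [x l Qs]]]: runs (if den s.1 e != 0 then c1 else c2) s (time c1 + time c2) Q.
    by exists (cost e + t).+1, s'; split=> //; [exact: exec_if ev x | rewrite ltnS leq_add2l].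
  case: (den s.1 e != 0) h => [/(IH1 _ _ bs)|/(IH2 _ _ bs)] [t [s' [x l Qs]]];
    by exists t, s'; split=> //; apply: leq_trans l _; rewrite ?leq_addr ?leq_addl.
- by [].
Qed.

Lemma runs_sub c s T T' (Q Q' : state -> Prop) : bounded s.1 ->
  runs c s T Q -> T <= T' ->
  (forall s', bounded s'.1 -> frame c s s' -> Q s' -> Q' s') -> runs c s T' Q'.
Proof.
move=> bs [t [s' [x l Qs]]] lT QQ; exists t, s'; split=> //; first exact: leq_trans lT.
by apply: QQ => //; [exact: exec_bounded x bs | exact: exec_frame x].
Qed.

Lemma runs_block c s T (Q : state -> Prop) : bounded s.1 -> time c <= T ->
  wp c Q s -> runs c s T Q.
Proof. by move=> bs lT h; exact: runs_sub bs (runs_wp bs h) lT (fun _ _ _ q => q). Qed.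

Lemma runs_seq c1 c2 s T1 T2 T (Q1 Q : state -> Prop) : bounded s.1 ->
  runs c1 s T1 Q1 -> T1 + T2 <= T ->
  (forall s', bounded s'.1 -> frame c1 s s' -> Q1 s' -> runs c2 s' T2 Q) ->
  runs (Seq c1 c2) s T Q.
Proof.
move=> bs [t1 [s1 [x1 l1 Q1s]]] lT h.
have [t2 [s2 [x2 l2 Qs]]] := h s1 (exec_bounded x1 bs) (exec_frame x1) Q1s.
exists (t1 + t2), s2; split=> //; first exact: exec_seq x1 x2.
by apply: leq_trans lT; apply: leq_add.
Qed.

Lemma runs_if e c1 c2 s T T' (Q : state -> Prop) : bounded s.1 -> safe s.1 e ->
  (den s.1 e != 0 -> runs c1 s T Q) -> (den s.1 e == 0 -> runs c2 s T Q) ->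
  (cost e + T).+1 <= T' -> runs (If e c1 c2) s T' Q.
Proof.
move=> bs se h1 h2 lT; have ev := safe_eval bs se.
have [t [s' [x l Qs]]]: runs (if den s.1 e != 0 then c1 else c2) s T Q.
  by case: (den s.1 e == 0) h1 h2 => /= h1 h2; [exact: h2 | exact: h1].
exists (cost e + t).+1, s'; split=> //; first exact: exec_if ev x.
by apply: leq_trans lT; rewrite ltnS leq_add2l.
Qed.

(* The invariant carries a bound [v] on the number of remaining iterations. *)
Lemma runs_while e c s K v T (I : nat -> state -> Prop) (Q : state -> Prop) :
  bounded s.1 -> I v s ->
  (forall v' s', bounded s'.1 -> frame c s s' -> I v' s' ->
     safe s'.1 e /\
     if den s'.1 e == 0 then Q s'
     else runs c s' K (fun s'' => exists2 v'', v'' < v' & I v'' s'')) ->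
  v.+1 * (cost e + K).+1 <= T ->
  runs (While e c) s T Q.
Proof.
move=> bs Is h lT.
suff [t [s' [x l Qs]]]: runs (While e c) s (v.+1 * (cost e + K).+1) Q.
  by exists t, s'; split=> //; apply: leq_trans lT.
suff gen v0 s0 : I v0 s0 -> bounded s0.1 -> frame c s s0 ->
    runs (While e c) s0 (v0.+1 * (cost e + K).+1) Q by exact: gen.
elim/ltn_ind: v0 s0 => {lT Is bs T} {}v IH s0 Is bs fs.
have [se] := h _ _ bs fs Is; have ev := safe_eval bs se.
case: (den s0.1 e =P 0) => [ez Qs|/eqP enz].
  exists (cost e).+1, s0; split=> //; first by constructor; rewrite ev ez.
  by rewrite mulSn; lia.
move=> [t1 [s1 [x1 l1 [v1 lv I1]]]].
have [t2 [s2 [x2 l2 Qs]]] := IH _ lv s1 I1 (exec_bounded x1 bs)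
   (frame_trans fs (exec_frame x1)).
exists (cost e + t1 + t2).+1, s2; split=> //; first exact: exec_while_step ev enz x1 x2.
have : v1.+1 * (cost e + K).+1 <= v * (cost e + K).+1 by rewrite leq_mul2r lv orbT.
rewrite [_.+1 * _ in X in _ -> X]mulSn; lia.
Qed.

End Hoare.

Definition for_loop (i : nat) (e : expr) (c : cmd) : cmd :=
  Seq (Put i (Const 0) (Const 0))
    (While (Op Less (Get i (Const 0)) e)
      (Seq c (Put i (Const 0) (Op Plus (Get i (Const 0)) (Const 1))))).

Section For.
Variables w S : nat.
Hypothesis w_ge : 128 < 2 ^ w.
Hypothesis S_gt0 : 0 < S.

(** The bound [e] is evaluated again at each test, so it must have the value [n] in every memory
    within the frame. The overhead of 10 per iteration is the test and the increment of the counter,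
    and 3 is its initialisation. *)
Lemma runs_for i e c s n K T (I : nat -> state -> Prop) (Q : state -> Prop) :
  bounded w s.1 -> i \notin writes c ->
  (forall s', frame (for_loop i e c) s s' -> safe w S s'.1 e /\ den s'.1 e = n) ->
  n < 2 ^ w ->
  I 0 (update s.1 i 0 0, s.2) ->
  (forall j s', j < n -> bounded w s'.1 -> frame (for_loop i e c) s s' -> s'.1 i 0 = j ->
     I j s' -> runs w S c s' K (fun s'' => I j.+1 (update s''.1 i 0 j.+1, s''.2))) ->
  (forall s', bounded w s'.1 -> frame (for_loop i e c) s s' -> I n s' -> Q s') ->
  n.+1 * (K + cost e + 10) + 3 <= T ->
  runs w S (for_loop i e c) s T Q.
Proof.
move=> bs ni he ln I0 step fin lT.
pose s1 : state := (update s.1 i 0 0, s.2).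
have f1 : frame (for_loop i e c) s s1.
  split=> // a; rewrite /= inE negb_or => /andP[na _] j.
  by rewrite /update (negbTE na).
have b1 : bounded w s1.1 by apply: update_bounded => //; lia.
apply: (@runs_seq _ _ _ _ _ 3 (n.+1 * (K + cost e + 10)) _ (fun s' => s' = s1)) => //.
- by apply: runs_wp.
- by rewrite addnC.
move=> _ _ _ ->.
apply: (@runs_while _ _ w_ge _ _ _ (K + 6) n _
  (fun v s' => exists2 j, (v = n - j) /\ j <= n & (s'.1 i 0 = j) /\ I j s')) => //.
- by exists 0; rewrite ?subn0 // /= /update !eqxx.
- move=> v s' b' f' [j [-> lj] [ej Ij]].
  have f2 : frame (for_loop i e c) s s'.
    apply: frame_trans f1 _; apply: frame_sub f' => [a|]; rewrite /= ?orbF //.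
    by rewrite !inE !mem_cat !inE => /orP[->|/eqP->]; rewrite ?eqxx ?orbT.
  have [se de] := he _ f2.
  split; first by rewrite /= S_gt0.
  rewrite /= de ej; case: ltnP => ljn /=; last first.
    by have e_j : j = n by [lia]; rewrite e_j in Ij; exact: fin.
  apply: (@runs_seq _ _ _ _ _ K 6) (step _ _ ljn b' f2 ej Ij) _ _ => //.
  move=> s'' b'' f'' Is''.
  have e'' : s''.1 i 0 = j by case: f'' => -> //.
  apply: runs_wp => //=; rewrite e'' S_gt0 addn1; do !split=> //; first lia.
  by exists (n - j.+1); first lia; exists j.+1; rewrite /= /update ?eqxx //; split.
rewrite leq_mul2l /=; lia.
Qed.

End For.

(** * Multigraphs, degrees and walks *)

Section Graph.
Variables (V E : finType) (ed : E -> V * V).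

Definition jn (e : E) (u v : V) : bool := (ed e == (u, v)) || (ed e == (v, u)).

Lemma jn_sym e u v : jn e u v = jn e v u. Proof. by rewrite /jn orbC. Qed.

(** A self-loop counts twice, so a vertex of degree 1 carries no loop. *)
Definition ends_at (e : E) (v : V) : nat := ((ed e).1 == v) + ((ed e).2 == v).

Definition deg (A : {set E}) (v : V) : nat := \sum_(e in A) ends_at e v.

Lemma ends_atE e v : ends_at e v = ((ed e).1 == v) + ((ed e).2 == v).
Proof. by []. Qed.

Lemma degE (A : {set E}) v : deg A v = \sum_(e in A) ends_at e v.
Proof. by []. Qed.

Lemma jn_ends_at e a b v : jn e a b -> ends_at e v = (a == v) + (b == v).
Proof. by case/orP=> /eqP ee; rewrite /ends_at ee //= addnC. Qed.

Lemma jn_ends e : jn e (ed e).1 (ed e).2.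
Proof. by rewrite /jn -surjective_pairing eqxx. Qed.

Lemma jn_ends_atl e a b : jn e a b -> 0 < ends_at e a.
Proof. by move=> /jn_ends_at ->; rewrite eqxx. Qed.

Lemma jn_ends_atr e a b : jn e a b -> 0 < ends_at e b.
Proof. by rewrite jn_sym; apply: jn_ends_atl. Qed.

Lemma ends_at_jn e v : 0 < ends_at e v -> exists u, jn e v u.
Proof.
rewrite /ends_at addn_gt0 !lt0b => /orP[]/eqP <-; first by exists (ed e).2; exact: jn_ends.
by exists (ed e).1; rewrite jn_sym jn_ends.
Qed.

Lemma jn_inj e a b c : jn e a b -> jn e a c -> b = c.
Proof.
move=> /orP[]/eqP ee /orP[]/eqP; rewrite ee; case=> //; by move=> <- -> || move=> -> <-.
Qed.

Lemma jn_cases e a b c d : jn e a b -> jn e c d -> (a = c /\ b = d) \/ (a = d /\ b = c).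
Proof. by move=> /orP[]/eqP ee /orP[]/eqP; rewrite ee => -[-> ->]; auto. Qed.

Lemma ends_at_jnP e a b v : jn e a b -> 0 < ends_at e v -> v = a \/ v = b.
Proof.
by move=> /jn_ends_at ->; rewrite addn_gt0 !lt0b => /orP[]/eqP; auto.
Qed.

Lemma deg0 v : deg set0 v = 0. Proof. by rewrite /deg big_set0. Qed.

Lemma deg_gt0 (A : {set E}) e v : e \in A -> 0 < ends_at e v -> 0 < deg A v.
Proof. by move=> eA lv; rewrite /deg (bigD1 e) //= addn_gt0 lv. Qed.

Lemma degU (A B : {set E}) v : [disjoint A & B] -> deg (A :|: B) v = deg A v + deg B v.
Proof. by by move=> dAB; rewrite /deg -bigU //=; apply: eq_bigl => e; rewrite inE. Qed.

Lemma degD1 (A : {set E}) e v : e \in A -> deg A v = ends_at e v + deg (A :\ e) v.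
Proof. by move=> eA; rewrite /deg (big_setD1 e). Qed.

Lemma deg_sub (A B : {set E}) v : A \subset B -> deg A v <= deg B v.
Proof.
move=> sAB; rewrite /deg [X in _ <= X](big_setID A) /=.
by have /setIidPr -> := sAB; rewrite leq_addr.
Qed.

(** * Walks *)

(** Each vertex is paired with the edge that leaves it, and the last vertex [z] is kept apart; paths
    and cycles thus have one type, and a walk is closed when [z] is its head. *)
Fixpoint walk (c : seq (V * E)) (z : V) : bool :=
  if c is p :: c' then jn p.2 p.1 (head z (unzip1 c')) && walk c' z else true.

Lemma walk_path p c z e :
  walk (p :: c) z = path (fun x y : V * E => jn x.2 x.1 y.1) p (rcons c (z, e)).
Proof.
elim: c p => [|q c IH] p; first by rewrite /= andbT.
by rewrite [walk _ _]/= -/(walk (q :: c) z) IH.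
Qed.

Lemma walk_cat c1 c2 z : walk (c1 ++ c2) z = walk c1 (head z (unzip1 c2)) && walk c2 z.
Proof.
elim: c1 => //= p c1 IH; rewrite IH andbA; congr (jn _ _ _ && _ && _).
by case: c1 {IH}.
Qed.

Definition trace (c : seq (V * E)) (z : V) : seq V := rcons (unzip1 c) z.

(** An edge has one end at the vertex that it leaves and one at the vertex that it enters; the
    latter form the trace without its first vertex. *)
Lemma walk_deg c z v : walk c z -> uniq (unzip2 c) ->
  deg [set e in unzip2 c] v = count_mem v (unzip1 c) + count_mem v (behead (trace c z)).
Proof.
elim: c => [|[a e] c IH] /=; first by move=> _ _; rewrite (_ : [set _ in _] = set0) ?deg0 //; apply/setP=> x; rewrite !inE.
move=> /andP[je wc] /andP[ne uc]; rewrite (@degD1 _ e) ?inE ?eqxx //.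
rewrite (_ : _ :\ e = [set x in unzip2 c]); last first.
  apply/setP=> x; rewrite !inE; case: eqP => //= ->; exact/esym/negbTE.
rewrite IH // (jn_ends_at v je) /trace.
case: c {IH wc uc ne} je => [|p c] /= _; first by rewrite !addn0 [a == v]eq_sym [z == v]eq_sym.
rewrite ![_ == v]eq_sym; lia.
Qed.

Lemma walk_ends c z e : walk c z -> e \in unzip2 c ->
  exists2 p, p.1 \in unzip1 c & p.2 \in behead (trace c z) /\ jn e p.1 p.2.
Proof.
elim: c => //= p c IH /andP[jp wc]; rewrite inE => /orP[/eqP->|/(IH wc) [q q1 [q2 jq]]].
  exists (p.1, head z (unzip1 c)); rewrite /= ?inE ?eqxx // jp; split=> //.
  by rewrite /trace; case: c {IH wc jp} => [|q c] /=; rewrite !inE eqxx.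
exists q; first by rewrite inE q1 orbT.
by split=> //; exact: mem_behead.
Qed.

Lemma walk_incident c z e v : walk c z -> e \in unzip2 c -> 0 < ends_at e v -> v \in trace c z.
Proof.
move=> wc ec lv; have [p p1 [p2 jp]] := walk_ends wc ec.
have [->|->] := ends_at_jnP jp lv; first by rewrite mem_rcons inE p1 orbT.
exact: mem_behead.
Qed.

(** * Acyclic orders *)

Definition simple_cycle (c : seq (V * E)) : bool :=
  [&& c != [::], uniq (unzip1 c), uniq (unzip2 c) &
      cycle (fun x y : V * E => jn x.2 x.1 y.1) c].

Lemma walk_simple_cycle p c : uniq (unzip1 (p :: c)) -> uniq (unzip2 (p :: c)) ->
  walk (p :: c) p.1 -> simple_cycle (p :: c).
Proof.
move=> u1 u2; rewrite (@walk_path _ _ _ p.2) -surjective_pairing => wc.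
by apply/and4P; split.
Qed.

(* The vertex of largest rank in a cycle has two edges to vertices of at most
   that rank. *)
Lemma order_acyclic (rank : V -> nat) (P : pred V) (c : seq (V * E)) :
  (forall v e1 e2 u1 u2, P v -> P u1 -> P u2 -> jn e1 v u1 -> jn e2 v u2 ->
     rank u1 <= rank v -> rank u2 <= rank v -> e1 = e2) ->
  (forall v e, P v -> ~~ jn e v v) ->
  all P (unzip1 c) -> ~~ simple_cycle c.
Proof.
move=> ord nloop Pc; apply/and4P=> -[cn0 uv ue cc].
have [x xc xmax]: exists2 x, x \in c & {in c, forall y, rank y.1 <= rank x.1}.
  case: c cn0 {uv ue cc Pc} => // p c _; elim: c p => [|q c IH] p.
    by exists p; rewrite ?mem_head // => y; rewrite inE => /eqP->.
  have [x xc xm] := IH q; case: (leqP (rank x.1) (rank p.1)) => l.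
    exists p; rewrite ?inE ?eqxx // => y; rewrite inE => /orP[/eqP->//|/xm h].
    exact: leq_trans l.
  exists x; rewrite ?(inE, xc) ?orbT // => y; rewrite inE => /orP[/eqP->|/xm//]; exact: ltnW.
have [i s rs] := rot_to xc.
have mem_s y : y \in x :: s -> y \in c by rewrite -rs mem_rot.
have Ps y : y \in x :: s -> P y.1.
  by move=> /mem_s yc; apply: (allP Pc); apply: map_f.
have: uniq (unzip2 (x :: s)) by rewrite -rs /unzip2 map_rot rot_uniq.
have: cycle (fun x y : V * E => jn x.2 x.1 y.1) (x :: s) by rewrite -rs rot_cycle.
case: s {rs} mem_s Ps => [|y s] mem_s Ps /=.
  by rewrite andbT => jx _; have := nloop x.1 x.2 (Ps _ (mem_head _ _)); rewrite jx.
move=> /andP[jx]; rewrite rcons_path => /andP[_ jl]; set l := last y s in jl.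
have ls : l \in y :: s := mem_last y s.
case/andP=> nx _; case/negP: nx.
have -> : x.2 = l.2.
  apply: (ord x.1 x.2 l.2 y.1 l.1) => //; try apply: Ps; try (apply: xmax; apply: mem_s);
    rewrite ?ls ?mem_head //= ?[_ \in x :: _]in_cons ?ls ?mem_head ?orbT //.
  by rewrite jn_sym.
exact: (map_f snd ls).
Qed.

End Graph.

(** * Ears *)

Section Ear.
Variables (V E : finType) (ed : E -> V * V).
Local Notation jn := (jn ed).
Local Notation deg := (deg ed).
Local Notation ends_at := (ends_at ed).
Local Notation walk := (walk ed).

Definition present (st : V -> nat) : {set V} := [set v | st v != 0].

(* The status [st v] is 0 outside H, 2 if v is blocked, and 1 otherwise.  The
   value [f v] of [ear_label] is a representative of the component of [v] in H. *)
Record ear_inv (H : {set E}) (st : V -> nat) (r : nat) : Prop := EarInv {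
  ear_absent : forall v, st v = 0 -> deg H v = 0;
  ear_plain : forall v, st v = 1 -> deg H v <= 2;
  ear_deg4 : forall v, deg H v <= 4;
  ear_blocked : #|[set v | st v == 2]| <= 2 * r;
  ear_label : exists f : V -> V,
    [/\ forall v, st v != 0 -> st (f v) != 0,
        forall e, e \in H -> f (ed e).1 = f (ed e).2 &
        r + 2 * #|present st| <= 2 * #|H| + #|f @: present st|];
  ear_rank : exists rank : V -> nat,
    (forall v e1 e2 u1 u2, st v = 1 -> st u1 = 1 -> st u2 = 1 -> e1 \in H -> e2 \in H ->
       jn e1 v u1 -> jn e2 v u2 -> rank u1 <= rank v -> rank u2 <= rank v -> e1 = e2) /\
    (forall v e, st v = 1 -> e \in H -> ~~ jn e v v) }.

(** [z] may coincide with the first vertex but with no later one, so that both simple paths and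
    simple cycles are covered. *)
Definition simple_walk (c : seq (V * E)) (z : V) : Prop :=
  [/\ c != [::], walk c z, uniq (unzip1 c), uniq (unzip2 c) &
      z \notin behead (unzip1 c)].

(** The first alternative of [ear_end] covers both closed kinds: status 0 at [z] means a cycle
    disjoint from H, status 1 a cycle hanging at a vertex of H. *)
Record is_ear (H : {set E}) (st : V -> nat) (c : seq (V * E)) (z : V) : Prop := IsEar {
  ear_walk : simple_walk c z;
  ear_new : forall e, e \in unzip2 c -> e \notin H;
  ear_inner : forall v, v \in behead (unzip1 c) -> st v = 0;
  ear_end : (z = head z (unzip1 c) /\ st z <= 1) \/
            [/\ z != head z (unzip1 c), st z = 1 & st (head z (unzip1 c)) = 1] }.

Definition add_ear (st : V -> nat) (c : seq (V * E)) (z : V) (v : V) : nat :=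
  if (v == head z (unzip1 c)) || (v == z) then 2
  else if v \in unzip1 c then 1 else st v.

Lemma ear_inv0 : ear_inv set0 (fun=> 0) 0.
Proof.
split=> //; try by move=> v; rewrite deg0.
- by rewrite (_ : [set _ | _] = set0) ?cards0 //; apply/setP=> v; rewrite !inE.
- exists id; split=> // [e|]; first by rewrite inE.
  by rewrite (_ : present _ = set0) ?cards0 //; apply/setP=> v; rewrite !inE.
- by exists (fun=> 0); split=> [v e1 e2 u1 u2|v e] //.
Qed.

Lemma present_edge H st r e v : ear_inv H st r -> e \in H -> 0 < ends_at e v -> st v != 0.
Proof.
by move=> inv eH lv; apply/eqP=> /(ear_absent inv) d0; have := deg_gt0 eH lv; rewrite d0.
Qed.

Lemma card_ear_vertices (st : V -> nat) (I : seq V) (B : {set V}) :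
  uniq I -> (forall v, v \in I -> v \notin B) -> #|B :|: [set v in I]| = #|B| + size I.
Proof.
move=> uI dI; rewrite cardsU (_ : _ :&: _ = set0) ?cards0 ?subn0; last first.
  by apply/setP=> v; rewrite !inE; apply/andP=> -[vB /dI]; rewrite vB.
by congr (_ + _); rewrite cardsE; apply/card_uniqP.
Qed.

Lemma walk_position c z e : walk c z -> e \in unzip2 c ->
  exists j, [/\ j < size c, e = nth e (unzip2 c) j &
     jn e (nth z (trace c z) j) (nth z (trace c z) j.+1)].
Proof.
elim: c => //= p c IH /andP[jp wc]; case: (p.2 =P e) => [<- _|ne].
  by exists 0; split=> //=; rewrite /trace; case: c {IH wc} jp => [|q c].
rewrite inE eq_sym; case: eqP => [/esym//|_] /(IH wc) [j [lj ej jj]].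
by exists j.+1; split.
Qed.

(** Degrees stay at most 4 because an ear adds at most 2, and only to vertices of status at most 1,
    which have degree at most 2. Its ends become blocked, so no edge joins its interior to the
    unblocked part of the old H, and the two can be ranked independently. *)
Lemma is_ear_step H st r c z : ear_inv H st r -> is_ear H st c z ->
  ear_inv (H :|: [set e in unzip2 c]) (add_ear st c z) r.+1.
Proof.
move=> inv [[cn0 wc u1 u2 zn] nH inner ends].
have dHc : [disjoint H & [set e in unzip2 c]].
  rewrite disjoint_sym disjoint_subset; apply/subsetP=> e; rewrite inE => /nH.
  by rewrite inE.
case: c cn0 wc u1 u2 zn nH inner ends dHc => // -[v0 e0] c _ wc u1 u2 zn nH inner ends dHc.
set c1 := (v0, e0) :: c in wc u2 nH dHc *.
have v0n : v0 \notin unzip1 c by case/andP: u1.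
have uI : uniq (unzip1 c) by case/andP: u1.
rewrite /= in zn inner ends.
set I := unzip1 c in v0n uI zn inner ends.
have stE v : add_ear st c1 z v = if (v == v0) || (v == z) then 2
    else if v \in I then 1 else st v.
  by rewrite /add_ear /= inE; case: (v == v0).
have degE v : deg (H :|: [set e in unzip2 c1]) v =
    deg H v + (count_mem v (v0 :: I) + count_mem v (rcons I z)).
  by rewrite degU // (walk_deg _ wc).
have cI v : count_mem v I = (v \in I) by apply: count_uniq_mem.
have cz v : count_mem v (rcons I z) = (v \in I) + (z == v).
  by rewrite -cats1 count_cat cI /= addn0.
have st_ends : st v0 <= 1 /\ st z <= 1.
  by case: ends => [[-> ?]|[_ -> ->]].
have dle v : deg (H :|: [set e in unzip2 c1]) v <= deg H v + 2.
  rewrite degE cz /= cI leq_add2l.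
  have := v0n; have := zn; case: (v0 =P v) => [->|_]; case: (z =P v) => [->|_] //;
    by case: (v \in I).
have sz : size c1 = (size I).+1 by rewrite /= size_map.
have cH : #|H :|: [set e in unzip2 c1]| = #|H| + (size I).+1.
  rewrite cardsU (_ : _ :&: _ = set0); last by apply/eqP; rewrite setI_eq0.
  rewrite cards0 subn0 cardsE -sz; congr (_ + _).
  by move/card_uniqP: u2 => ->; rewrite size_map.
have inE1 e : e \in H :|: [set x in unzip2 c1] -> e \notin H -> e \in unzip2 c1.
  by rewrite !inE => /orP[->|].
have traceE e v : e \in unzip2 c1 -> 0 < ends_at e v -> [|| v == v0, v \in I | v == z].
  move=> ec lv; have := walk_incident wc ec lv.
  by rewrite /trace mem_rcons !inE orbCA [_ || (v == z)]orbC.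
split.
- move=> v; rewrite stE; case: ifP => // /negbT; rewrite negb_or => /andP[nv0 nz].
  case: ifP => // vI /(ear_absent inv) d0.
  by rewrite degE d0 cz /= cI vI eq_sym (negbTE nv0) [z == v]eq_sym (negbTE nz).
- move=> v; rewrite stE; case: ifP => // /negbT; rewrite negb_or => /andP[nv0 nz].
  rewrite degE cz /= cI [v0 == v]eq_sym [z == v]eq_sym (negbTE nv0) (negbTE nz) addn0 add0n.
  by case: ifP => [vI _|_ /(ear_plain inv)]; rewrite ?(ear_absent inv (inner _ vI)) ?addn0.
- move=> v; case: (ltnP 1 (st v)) => lst; last first.
    apply: leq_trans (dle v) _; rewrite (leq_add2r 2 _ 2).
    case e: (st v) lst => [|[|//]] _; first by rewrite (ear_absent inv e).
    exact: ear_plain inv _ e.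
  rewrite degE cz /= cI; have := ear_deg4 inv v.
  case: st_ends => l0 lz.
  case: (v0 =P v) => [ev|_]; first by rewrite -ev ltnNge l0 in lst.
  case: (z =P v) => [ev|_]; first by rewrite -ev ltnNge lz in lst.
  by case vI: (v \in I); rewrite ?addn0 //; rewrite (inner _ vI) in lst.
- have: [set v | add_ear st c1 z v == 2] \subset [set v | st v == 2] :|: [set v0; z].
    apply/subsetP=> v; rewrite !inE stE; case: ifP => _; rewrite ?orbT ?orbF //.
    by case: ifP.
  move/subset_leq_card=> /leq_trans; apply.
  apply: leq_trans (leq_card_setU _ _) _.
  by rewrite mulnS addnC leq_add ?(ear_blocked inv) // cards2; case: (_ == _).
- have [f [fst fH fle]] := ear_label inv.
  have IY v : v \in I -> v \notin present st by move=> /inner; rewrite inE => ->.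
  have pE : present (add_ear st c1 z) = v0 |: (z |: (present st :|: [set v in I])).
    apply/setP=> v; rewrite !inE stE; do 2 (case: (v == _) => //=).
    by case: ifP; rewrite ?orbT ?orbF.
  have [newc|att] : (z = v0 /\ st v0 = 0) \/ (st z = 1 /\ st v0 = 1).
    case: ends => [[-> lz]|[_ -> ->]]; last by right.
    by case e: (st v0) lz => [|[|//]] _; [left|right].
  (* A disjoint cycle has as many edges as vertices and brings one label. The label [v0] is new
     because labels of present vertices are themselves present. *)
  + case: newc => ez s0; subst z.
    have v0Y : v0 \notin present st by rewrite inE s0.
    have {}pE : present (add_ear st c1 v0) = present st :|: [set v in v0 :: I].
      by rewrite pE; apply/setP=> v; rewrite !inE; case: (v == v0); rewrite ?orbT.
    pose f' v := if v \in v0 :: I then v0 else f v.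
    exists f'; split.
    * move=> v; rewrite /f'; case: ifP => [_ _|]; first by rewrite stE eqxx.
      rewrite inE => /norP[/negbTE a /negbTE b]; rewrite stE a b /= => /fst.
      by rewrite stE; do 2 case: ifP => //.
    * have fI e v : e \in unzip2 c1 -> 0 < ends_at e v -> f' v = v0.
        by move=> ec /(traceE _ _ ec) h; rewrite /f' inE; move: h; rewrite orbA orbAC orbb => ->.
      have je := jn_ends ed; move=> e; case eH: (e \in H); last first.
        by move=> eU; have ec := inE1 _ eU (negbT eH); rewrite (fI _ _ ec (jn_ends_atl (je e))) (fI _ _ ec (jn_ends_atr (je e))).
      move=> _; have fo v : 0 < ends_at e v -> f' v = f v.
        move=> lv; have := present_edge inv eH lv; rewrite /f' inE; case: (v =P v0) => [->|_]; first by rewrite s0.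
        by case: ifP => // vI; rewrite (inner _ vI).
      by rewrite (fo _ (jn_ends_atl (je e))) (fo _ (jn_ends_atr (je e))) fH.
    * have: v0 |: f @: present st \subset f' @: present (add_ear st c1 v0).
        apply/subsetP=> v; rewrite in_setU1 => /orP[/eqP->|/imsetP[u uY ->]].
          by apply/imsetP; exists v0; rewrite ?pE ?inE ?eqxx ?orbT // /f' inE eqxx.
        apply/imsetP; exists u; first by rewrite pE in_setU uY.
        rewrite /f' inE; case: eqP => [eu|_]; first by rewrite -eu uY in v0Y.
        by case: ifP => // /IY; rewrite uY.
      move/subset_leq_card; rewrite cardsU1 (_ : v0 \notin _); last first.
        apply/imsetP=> -[u]; rewrite inE => /fst su ev; by rewrite -ev s0 in su.
      rewrite pE card_ear_vertices //; last first.
        by move=> v; rewrite inE => /orP[/eqP->//|/IY].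
      by move: fle; rewrite cH /=; clear; lia.
  (* An attached ear has one edge more than new vertices, a gain of 2; merging the label of [z] into
     that of [v0] takes back at most 1. *)
  + case: att => sz1 s01.
    have {}pE : present (add_ear st c1 z) = present st :|: [set v in I].
      rewrite pE; apply/setP=> v; rewrite !inE; case: (v =P v0) => [->|_]; first by rewrite s01.
      by case: (v =P z) => [->|_]; first by rewrite sz1.
    pose f' v := if (v \in I) || (f v == f z) then f v0 else f v.
    have f'st v : st v != 0 -> f' v = if f v == f z then f v0 else f v.
      by move=> sv; rewrite /f'; case vI: (v \in I) => //; rewrite (inner _ vI) in sv.
    exists f'; split.
    * have st'0 v : st v != 0 -> add_ear st c1 z v != 0 by rewrite stE; do 2 case: ifP => //.
      have sf0 : st (f v0) != 0 by apply: fst; rewrite s01.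
      move=> v; rewrite /f'; case: ifP; first by move=> _ _; exact: st'0.
      move=> /norP[vI _]; rewrite stE (negbTE vI) => h; apply/st'0/fst.
      by case: ifP h => // /orP[/eqP->|/eqP->] _; rewrite ?s01 ?sz1.
    * have fI e v : e \in unzip2 c1 -> 0 < ends_at e v -> f' v = f v0.
        move=> ec /(traceE _ _ ec) /or3P[/eqP->|h|/eqP->]; rewrite /f' ?h ?eqxx ?orbT //.
        by case: ifP.
      have je := jn_ends ed; move=> e; case eH: (e \in H); last first.
        by move=> eU; have ec := inE1 _ eU (negbT eH); rewrite (fI _ _ ec (jn_ends_atl (je e))) (fI _ _ ec (jn_ends_atr (je e))).
      move=> _; rewrite !f'st ?fH //; apply: (present_edge inv eH).
        exact: jn_ends_atr (je e).
      exact: jn_ends_atl (je e).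
    * have: (f @: present st) :\ f z \subset f' @: present (add_ear st c1 z).
        apply/subsetP=> v; rewrite in_setD1 => /andP[nv /imsetP[u uY ev]].
        apply/imsetP; exists u; first by rewrite pE in_setU uY.
        by rewrite f'st -?ev ?(negbTE nv) //; rewrite inE in uY.
      move/subset_leq_card; rewrite pE card_ear_vertices // => h.
      have := cardsD1 (f z) (f @: present st).
      have := leq_b1 (f z \in f @: present st); rewrite cH. lia.
- have [rank [rk nl]] := ear_rank inv.
  (* Inside the ear the rank is the position, and the only edge going down from a vertex is the one
     through which the walk enters it. *)
  pose rank' v := if v \in I then index v I else rank v.
  have s1 v : add_ear st c1 z v = 1 -> (v \in I) \/ [/\ st v = 1, v \notin I, v != v0 & v != z].
    by rewrite stE; case: ifP => // /norP[a b]; case: ifP; [left|right].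
  have eold e v : e \in H :|: [set x in unzip2 c1] -> 0 < ends_at e v ->
      v \notin I -> v != v0 -> v != z -> e \in H.
    move=> eU lv vI vv0 vz; apply/negPn/negP=> /(inE1 _ eU) ec.
    by have := traceE _ _ ec lv; rewrite (negbTE vI) (negbTE vv0) (negbTE vz).
  have Inew e v : e \in H :|: [set x in unzip2 c1] -> 0 < ends_at e v -> v \in I -> e \in unzip2 c1.
    move=> eU lv vI; apply: inE1 => //; apply/negP=> eH.
    by have := present_edge inv eH lv; rewrite (inner _ vI).
  have pos v a : a <= (size I).+1 -> v \in I -> nth z (trace c1 z) a = v -> a = (index v I).+1.
    rewrite /trace /= -/I; case: a => [_ vI e|a]; first by rewrite -e (negbTE v0n) in vI.
    rewrite ltnS => la vI; rewrite [nth _ _ _]/= nth_rcons; case: ltngtP la => // la _ ev.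
      by rewrite -ev index_uniq.
    by rewrite -ev (negbTE zn) in vI.
  have back v u e : e \in unzip2 c1 -> jn e v u -> v \in I -> u \in I ->
      [/\ e = nth e0 (unzip2 c1) (index v I), index v I < size c1 & (index u I).+1 = index v I] \/
      (index v I).+1 = index u I.
    move=> ec jvu vI uI'; have [j [lj ej jj]] := walk_position wc ec.
    have lI : j <= size I by rewrite -ltnS -sz.
    have [[ev eu]|[ev eu]] := jn_cases jj jvu.
      right; have <- := pos _ _ (leqW lI) vI ev.
      by have [<-] : j.+1 = (index u I).+1 := pos _ _ (lI : j.+1 <= (size I).+1) uI' eu.
    left; have [jv] : j.+1 = (index v I).+1 := pos _ _ (lI : j.+1 <= (size I).+1) vI eu.
    have ju := pos _ _ (leqW lI) uI' ev.
    by rewrite -jv -ju; split=> //; rewrite ej; apply: set_nth_default; rewrite size_map.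
  have nbr v u e : add_ear st c1 z v = 1 -> add_ear st c1 z u = 1 ->
      e \in H :|: [set x in unzip2 c1] -> jn e v u ->
      [/\ v \in I, u \in I & e \in unzip2 c1] \/ [/\ st v = 1, st u = 1, e \in H, v \notin I & u \notin I].
    move=> /s1 hv /s1 hu eU je; have lv := jn_ends_atl je; have lu := jn_ends_atr je.
    case: hv => [vI|[sv vI vv0 vz]].
      left; have ec := Inew _ _ eU lv vI; split=> //.
      case: hu => // -[su uI' uv0 uz].
      by have := traceE _ _ ec lu; rewrite (negbTE uv0) (negbTE uz) orbF.
    have eH := eold _ _ eU lv vI vv0 vz; right; case: hu => [uI'|[su uI' _ _]] //.
    by have := present_edge inv eH lu; rewrite (inner _ uI').
  exists rank'; split=> [v e1 e2 u1' u2' sv su1 su2 eU1 eU2 j1 j2|v e sv eU].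
    have [[vI i1 ec1]|[sv1 su1' eH1 vI i1]] := nbr _ _ _ sv su1 eU1 j1;
    have [[vI' i2 ec2]|[sv2 su2' eH2 vI' i2]] := nbr _ _ _ sv su2 eU2 j2;
      rewrite /rank' ?vI ?i1 ?i2 //; try by rewrite vI in vI'.
    + move=> r1 r2; case: (back _ _ _ ec1 j1 vI i1) => [[-> _ _]|h1]; last by rewrite -h1 ltnn in r1.
      by case: (back _ _ _ ec2 j2 vI i2) => [[-> _ _]|h1]; last by rewrite -h1 ltnn in r2.
    + by rewrite (negbTE vI) in vI'.
    + rewrite (negbTE vI) (negbTE i1) (negbTE i2); exact: rk.
  apply/negP=> je; have [[vI _ ec]|[s1v _ eH _ _]] := nbr _ _ _ sv sv eU je.
    by case: (back _ _ _ ec je vI vI) => [[_ _]|] /esym/n_Sn.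
  by have := nl _ _ s1v eH; rewrite je.
Qed.

(** * Excess *)

(* [#|f @: Y|] stands for the number of components, so that the excess is about
   twice the cyclomatic number minus the number of components. *)
Definition excess (A : {set E}) (p : nat) : Prop :=
  exists (Y : {set V}) (f : V -> V),
    (forall e, e \in A -> [/\ (ed e).1 \in Y, (ed e).2 \in Y & f (ed e).1 = f (ed e).2]) /\
    p + 2 * #|Y| <= 2 * #|A| + #|f @: Y|.

Lemma ear_inv_excess H st r : ear_inv H st r -> excess H r.
Proof.
move=> inv; have [f [_ fH le]] := ear_label inv; exists (present st), f; split=> // e eH.
have je := jn_ends ed e; split; rewrite ?inE ?fH //; apply: (present_edge inv eH).
  exact: jn_ends_atl je.
exact: jn_ends_atr je.
Qed.

(** There are at most as many labels as vertices, too few for a positive excess without edges. In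
    the cycle phase this shows that an edge is left. *)
Lemma excess0 p : excess set0 p -> p = 0.
Proof.
move=> [Y [f [_]]]; rewrite cards0; have := leq_imset_card f Y; lia.
Qed.

Lemma excess_edge A p : excess A p.+1 -> exists e, e \in A.
Proof.
by case: (set_0Vmem A) => [-> /excess0//|[e eA] _]; exists e.
Qed.

Lemma excess_jn (A : {set E}) (Y : {set V}) (f : V -> V) e a b :
  (forall e, e \in A -> [/\ (ed e).1 \in Y, (ed e).2 \in Y & f (ed e).1 = f (ed e).2]) ->
  e \in A -> jn e a b -> [/\ a \in Y, b \in Y & f a = f b].
Proof. by move=> h /h [y1 y2 y3] /orP[]/eqP ee; rewrite ee in y1 y2 y3. Qed.

(** The leaf goes together with its edge, and no label is lost because its neighbour has the same
    one. *)
Lemma excess_trim A p e x : excess A p -> deg A x = 1 -> e \in A -> 0 < ends_at e x ->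
  excess (A :\ e) p.
Proof.
move=> [Y [f [fA le]]] d1 eA lx; have [y jxy] := ends_at_jn lx.
have [xY yY fxy] := excess_jn fA eA jxy.
have yx : y != x.
  apply/eqP=> exy; have := degD1 ed x eA; rewrite d1 (jn_ends_at x jxy) exy eqxx; lia.
have nx e' : e' \in A :\ e -> ends_at e' x = 0.
  have := degD1 ed x eA; rewrite d1 => h e'A; apply/eqP; rewrite -leqn0 -ltnS.
  have : 0 < ends_at e' x -> 0 < deg (A :\ e) x by apply: deg_gt0.
  by case: (ends_at e' x) => // n /(_ isT); lia.
exists (Y :\ x), f; split.
  move=> e' e'A; have e'A' : e' \in A by case/setD1P: e'A.
  have [y1 y2 y3] := fA _ e'A'; move: (nx _ e'A); rewrite !ends_atE !inE y1 y2.
  by do 2 case: eqP => //.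
have : f @: Y \subset f @: (Y :\ x).
  apply/subsetP=> v /imsetP[u uY ->]; case: (u =P x) => [->|/eqP ux].
    by rewrite fxy; apply: imset_f; rewrite in_setD1 yx.
  by apply: imset_f; rewrite in_setD1 ux.
move/subset_leq_card; have := cardsD1 x Y; have := cardsD1 e A; rewrite xY eA; lia.
Qed.

Definition avoid (A : {set E}) (C : {set V}) : {set E} :=
  [set e in A | ((ed e).1 \notin C) && ((ed e).2 \notin C)].

Lemma walk_same_label (f : V -> V) c z : walk c z ->
  (forall e a b, e \in unzip2 c -> jn e a b -> f a = f b) ->
  forall v, v \in unzip1 c -> f v = f z.
Proof.
elim: c => // p c IH /andP[jp wc] fe v.
have step e a b : e \in unzip2 c -> jn e a b -> f a = f b.
  by move=> ec; apply: fe; rewrite /= inE ec orbT.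
have {}IH := IH wc step.
rewrite inE => /orP[/eqP->|/IH//].
rewrite (fe p.2 p.1 _ _ jp) ?mem_head //.
by case: c IH {jp wc fe step} => //= q c; apply; rewrite mem_head.
Qed.

Lemma walk_subset c z e v : walk c z -> z \in unzip1 c ->
  e \in unzip2 c -> 0 < ends_at e v -> v \in unzip1 c.
Proof.
move=> wc zc ec lv; have := walk_incident wc ec lv.
by rewrite /trace mem_rcons inE => /orP[/eqP->|].
Qed.

(** On a cycle of length s the degrees add up to at most 2s + 2l. Each deleted edge has an end there
    and the s edges of the cycle have two, so at most s + 2l edges go along with s vertices. The
    doubled difference loses at most 4l, and the cycle, having a single label, costs at most 1
    more. *)
Lemma excess_cycle A p l c z : excess A (p + 4 * l + 1) -> c != [::] -> walk c z ->
  z = head z (unzip1 c) -> uniq (unzip1 c) -> uniq (unzip2 c) ->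
  (forall e, e \in unzip2 c -> e \in A) -> (forall v, deg A v <= 4) ->
  count (fun v => 2 < deg A v) (unzip1 c) <= l ->
  excess (avoid A [set v in unzip1 c]) p.
Proof.
move=> [Y [f [fA le]]] cn0 wc zh u1 u2 cA d4 br.
set C := [set v in unzip1 c].
have zc : z \in unzip1 c by rewrite zh; case: c cn0 {zh wc u1 u2 cA br C} => //= q c; rewrite mem_head.
have CY : C \subset Y.
  apply/subsetP=> v; rewrite inE => /mapP[q qc ->].
  have : exists2 u, q.2 \in unzip2 c & jn q.2 q.1 u.
    elim: c qc wc {cn0 zh u1 u2 cA br C zc} => // q' c IH; rewrite inE => /orP[/eqP->|qc] /=.
      by move=> /andP[j _]; exists (head z (unzip1 c)); rewrite ?mem_head.
    by move=> /andP[_ /(IH qc) [u uc ju]]; exists u; rewrite ?inE ?uc ?orbT.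
  by move=> [u /cA qA ju]; have [] := excess_jn fA qA ju.
have sC : #|C| = size c by rewrite cardsE -(size_map fst); apply/card_uniqP.
have cz0 : 0 < size c by case: c cn0 {zh wc u1 u2 cA br C zc CY sC}.
have degC : \sum_(v in C) deg A v <= 2 * size c + 2 * l.
  rewrite (eq_bigl (mem (unzip1 c))); last by move=> v; rewrite inE.
  rewrite -big_uniq //=.
  apply: (@leq_trans (\sum_(u <- unzip1 c) (2 + 2 * (2 < deg A u)))).
    by apply: leq_sum => u _; have := d4 u; case: (ltnP 2 (deg A u)).
  rewrite big_split /= -big_distrr /= -big_mkcond sum1_count big_const_seq.
  by rewrite iter_addn_0 count_predT size_map leq_add2l leq_mul2l br orbT.
have touch : size c + #|A :\: avoid A C| <= \sum_(v in C) deg A v.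
  rewrite exchange_big /=.
  have eg e : \sum_(v in C) ends_at e v = ((ed e).1 \in C) + ((ed e).2 \in C).
    have one u : \sum_(v in C) (u == v) = (u \in C).
      rewrite -big_mkcondr /= (eq_bigl (fun v => (v == u) && (u \in C))); last first.
        by move=> v; rewrite eq_sym andbC; case: eqP => // ->.
      case: (u \in C); first by rewrite (big_pred1 u) // => v; rewrite andbT.
      by rewrite big_pred0 // => v; rewrite andbF.
    by rewrite big_split /= !one.
  have sc : size c = \sum_(e in A) (e \in unzip2 c).
    rewrite -big_mkcondr /= sum1dep_card -(size_map snd) -(card_uniqP u2).
    by apply: eq_card => e; rewrite [in RHS]inE; case ec: (e \in unzip2 c); rewrite ?andbF // cA.
  have sav : #|A :\: avoid A C| = \sum_(e in A) (e \notin avoid A C).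
    by rewrite -big_mkcondr /= sum1dep_card; apply: eq_card => e; rewrite !inE andbC.
  rewrite sc sav -big_split /=; apply: leq_sum => e eA; rewrite eg !inE eA /=.
  case ec: (e \in unzip2 c); last by do 2 case: (_ \in _).
  have je := jn_ends ed e.
  by rewrite !(walk_subset wc zc ec) ?(jn_ends_atl je) ?(jn_ends_atr je).
exists (Y :\: C), f; split.
  move=> e; rewrite inE => /andP[eA /andP[n1 n2]]; have [y1 y2 y3] := fA _ eA.
  by rewrite !in_setD n1 n2.
have : (f @: Y) :\ f z \subset f @: (Y :\: C).
  apply/subsetP=> v; rewrite in_setD1 => /andP[nv /imsetP[u uY ev]].
  rewrite ev; apply: imset_f; rewrite in_setD uY andbT inE; apply: contra nv => uc.
  rewrite ev; apply/eqP; apply: (walk_same_label wc _ uc) => e a b /cA eA jab.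
  by have [] := excess_jn fA eA jab.
move/subset_leq_card; have := cardsD1 (f z) (f @: Y); have := leq_b1 (f z \in f @: Y).
have := cardsID C Y; have /setIidPr -> := CY; rewrite sC.
have sA : avoid A C \subset A by apply/subsetP=> e; rewrite inE => /andP[].
have := cardsID (avoid A C) A; have /setIidPr -> := sA.
move: le degC touch cz0; clear; lia.
Qed.

End Ear.

(** * Depth-bounded search *)

Definition upd (A : eqType) (B : Type) (f : A -> B) (x : A) (y : B) : A -> B :=
  fun v => if v == x then y else f v.

Lemma updE (A : eqType) B (f : A -> B) x y v : upd f x y v = if v == x then y else f v.
Proof. by []. Qed.

Section Search.
Variables (V E : finType) (ed : E -> V * V).
Local Notation jn := (jn ed).
Local Notation deg := (deg ed).
Local Notation ends_at := (ends_at ed).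
Local Notation walk := (walk ed).

(** The flag tells at which end the half-edge starts; a self-loop has two half-edges at its
    vertex. *)
Definition base (a : E * bool) : V := if a.2 then (ed a.1).2 else (ed a.1).1.
Definition tip (a : E * bool) : V := if a.2 then (ed a.1).1 else (ed a.1).2.

Lemma jn_half a : jn a.1 (base a) (tip a).
Proof. by case: a => e []; rewrite /base /tip /=; [rewrite jn_sym|]; exact: jn_ends. Qed.

Variables (J : {set E}) (W : {set V}) (D : nat) (inc : V -> nat).

(* A search of the edges [J] from the roots [W], followed by further roots once
   the component of [W] is exhausted.  Here [dp v] adds up [inc] along the tree
   path to [v], and [v] is expanded only if [dp v < D].  The stack [stk] grows to
   the right; [todo v] lists the half-edges at [v] that remain to be scanned, and
   [act] the edges that have not been traversed. *)
Record search := Search {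
  vis : seq V;
  par : V -> option (V * E);
  rt : V -> V;
  dp : V -> nat;
  act : {set E};
  todo : V -> seq (E * bool);
  stk : seq V }.

Definition live s v := exists2 e, e \in act s & 0 < ends_at e v.

(** The search stops at the first edge that closes a walk, so all traversed edges are tree edges
    ([si_used]), and parents precede their children in [vis]. By [si_root] the live visited vertices
    hang either all from [W] or all from one root; this makes a closing edge usable. *)
Record sinv (s : search) : Prop := Sinv {
  si_uniq : uniq (vis s);
  si_par : forall v u e, par s v = Some (u, e) ->
    [/\ v \in vis s, u \in vis s, index u (vis s) < index v (vis s) & v \notin W] /\
    [/\ e \in J, e \notin act s & jn e v u];
  si_W : {subset W <= vis s};
  si_used : forall e, e \in J -> e \notin act s -> exists v u, par s v = Some (u, e);
  si_inj : forall v u v' u' e, par s v = Some (u, e) -> par s v' = Some (u', e) -> v = v';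
  si_act : act s \subset J;
  si_todo : forall v e, dp s v < D -> e \in act s -> 0 < ends_at e v -> e \in unzip1 (todo s v);
  si_base : forall v a, a \in todo s v -> base a = v;
  si_stk : forall v, v \in vis s -> todo s v != [::] -> dp s v < D -> v \in stk s;
  si_stkvis : forall v, v \in stk s -> v \in vis s /\ dp s v < D;
  si_stkuniq : uniq (stk s);
  si_dp : forall v u e, par s v = Some (u, e) -> dp s v = dp s u + inc v /\ dp s u < D;
  si_dp0 : forall v, par s v = None -> dp s v = 0;
  si_dpD : forall v, v \in vis s -> dp s v <= D;
  si_rt : forall v u e, par s v = Some (u, e) -> rt s v = rt s u;
  si_rt0 : forall v, v \in vis s -> par s v = None -> rt s v = v;
  si_root : (forall v, v \in vis s -> live s v -> rt s v \in W) \/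
            (exists c, forall v, v \in vis s -> live s v -> rt s v = c) }.

Hypothesis D_gt0 : 0 < D.
Hypothesis inc_le1 : forall v, inc v <= 1.

Definition search0 (ws : seq V) (adj : V -> seq (E * bool)) : search :=
  Search ws (fun=> None) id (fun=> 0) J adj ws.

Lemma sinv0 ws adj : uniq ws -> ws =i W -> (forall v a, a \in adj v -> base a = v) ->
  (forall v e, e \in J -> 0 < ends_at e v -> e \in unzip1 (adj v)) -> sinv (search0 ws adj).
Proof.
move=> uws wsW adjb adje; split=> //=.
- by move=> v; rewrite wsW.
- by move=> e ->.
- by move=> v e _; apply: adje.
- by left=> v; rewrite wsW.
Qed.

Definition pop s st := Search (vis s) (par s) (rt s) (dp s) (act s) (todo s) st.
Definition skip s x l := Search (vis s) (par s) (rt s) (dp s) (act s) (upd (todo s) x l) (stk s).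
(** A vertex whose depth reaches [D] is visited but not pushed, and so remains a leaf of the
    tree. *)
Definition grow s x l e y :=
  Search (rcons (vis s) y) (upd (par s) y (Some (x, e))) (upd (rt s) y (rt s x))
    (upd (dp s) y (dp s x + inc y)) (act s :\ e) (upd (todo s) x l)
    (if dp s x + inc y < D then rcons (stk s) y else stk s).
Definition plant s v :=
  Search (rcons (vis s) v) (par s) (upd (rt s) v v) (dp s) (act s) (todo s) [:: v].

Lemma sinv_pop s st x : sinv s -> stk s = rcons st x -> todo s x = [::] -> sinv (pop s st).
Proof.
move=> inv es tx; case: (inv) => *; split=> //=.
- move=> v vv tv dv; have := si_stk inv vv tv dv; rewrite es mem_rcons inE => /orP[/eqP ev|//].
  by rewrite ev tx in tv.
- by move=> v vs; apply: (si_stkvis inv); rewrite es mem_rcons inE vs orbT.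
- by have := si_stkuniq inv; rewrite es rcons_uniq => /andP[].
Qed.

Lemma sinv_skip s x a l : sinv s -> x \in stk s -> todo s x = a :: l -> a.1 \notin act s ->
  sinv (skip s x l).
Proof.
move=> inv xs tx na; case: (inv) => *; split=> //=.
- move=> v e dv ea lv; rewrite updE; case: eqP => [ev|_]; last exact: (si_todo inv).
  have := si_todo inv dv ea lv; rewrite ev tx inE => /orP[/eqP ee|//].
  by rewrite ee (negbTE na) in ea.
- move=> v b; rewrite updE; case: eqP => [->|_]; last exact: (si_base inv).
  by move=> bl; apply: (si_base inv); rewrite tx inE bl orbT.
- by move=> v vv; rewrite updE; case: (v =P x) => [->|_] //; exact: (si_stk inv).
Qed.

Lemma index_rcons_lt (T : eqType) (s : seq T) (a b y : T) : b \in s -> index a s < index b s ->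
  index a (rcons s y) < index b (rcons s y).
Proof.
move=> bs lt; have as_ : a \in s by rewrite -index_mem (ltn_trans lt) // index_mem.
by rewrite -cats1 !index_cat as_ bs.
Qed.

Lemma par_vis s v : sinv s -> v \notin vis s -> par s v = None.
Proof.
move=> inv; case ep: (par s v) => [[u e]|//].
by have [[-> _ _ _] _] := si_par inv ep.
Qed.

Lemma sinv_grow s x a l y : sinv s -> x \in stk s -> todo s x = a :: l ->
  a.1 \in act s -> y = tip a -> y \notin vis s -> sinv (grow s x l a.1 y).
Proof.
move=> inv xs tx ea ey yv.
have bx : base a = x by apply: (si_base inv); rewrite tx mem_head.
have je : jn a.1 x y by rewrite -bx ey; apply: jn_half.
have [xv dx] := si_stkvis inv xs.
have nxy : x != y by apply: contraNneq yv => <-.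
have pV v u e : upd (par s) y (Some (x, a.1)) v = Some (u, e) ->
   [/\ v = y, u = x & e = a.1] \/ [/\ v != y, u != y & par s v = Some (u, e)].
  rewrite updE; case: eqP => [-> [<- <-]|/eqP nv pv]; [by left | right; split=> //].
  by apply: contraNneq yv => <-; have [[]] := si_par inv pv.
have used v u : par s v <> Some (u, a.1).
  by move=> pv; have [_ [_]] := si_par inv pv; rewrite ea.
have livE v : live (grow s x l a.1 y) v -> live s v.
  by move=> [e /=]; rewrite in_setD1 => /andP[_ ea'] lv; exists e.
have aJ : a.1 \in J := subsetP (si_act inv) _ ea.
have lx : live s x by exists a.1 => //; exact: jn_ends_atl je.
split=> /=.
- by rewrite rcons_uniq yv (si_uniq inv).
- move=> v u e /pV[[-> -> ->]|[nv nu pv]].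
    rewrite !mem_rcons !inE eqxx xv orbT eqxx; split; split=> //; last by rewrite jn_sym.
      by rewrite -cats1 !index_cat xv (negbTE yv) /= eqxx addn0 index_mem.
    by apply: contra yv; apply: (si_W inv).
  have [[h1 h2 h3 h4] [h5 h6 h7]] := si_par inv pv.
  rewrite !mem_rcons !inE h1 h2 !orbT (negbTE h6) andbF; split; split=> //.
  exact: index_rcons_lt.
- by move=> v vW; rewrite mem_rcons inE (si_W inv) ?orbT.
- move=> e eJ; rewrite in_setD1 negb_and negbK => /orP[/eqP->|na].
    by exists y, x; rewrite updE eqxx.
  have [v [u pv]] := si_used inv eJ na; exists v, u; rewrite updE.
  by case: eqP => // ev; rewrite ev (par_vis inv yv) in pv.
- move=> v u v' u' e /pV[[-> _ ->]|[nv nu pv]] /pV[[-> _ ee]|[nv' nu' pv']] //.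
  + by case: (used _ _ pv').
  + by rewrite ee in pv; case: (used _ _ pv).
  + exact: (si_inj inv) pv pv'.
- by apply: subset_trans (si_act inv); apply: subD1set.
- move=> v e; rewrite in_setD1 !updE => dv /andP[ne ea'] lv.
  have dv' : dp s v < D.
    by move: dv; case: eqP => [->|//] _; rewrite (si_dp0 inv) ?(par_vis inv).
  have := si_todo inv dv' ea' lv; case: eqP => [->|//]; rewrite tx inE.
  by rewrite (negbTE ne).
- move=> v b; rewrite updE; case: eqP => [->|_]; last exact: (si_base inv).
  by move=> bl; apply: (si_base inv); rewrite tx inE bl orbT.
- move=> v; rewrite mem_rcons inE !updE; case: (v =P y) => [->|_] /=.
    by move=> _ _ ->; rewrite mem_rcons mem_head.
  move=> vv; case: (v =P x) => [->|_] h dv; first by case: (_ < D); rewrite ?mem_rcons ?inE ?xs ?orbT.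
  by have := si_stk inv vv h dv; case: (_ < D) => // vs; rewrite mem_rcons inE vs orbT.
- move=> v; rewrite mem_rcons inE updE; case: (v =P y) => [->|nv] /=.
    by case: ifP => // _ /(si_stkvis inv) []; rewrite (negbTE yv).
  move=> vs; apply: (si_stkvis inv); move: vs; case: (_ < D) => //.
  by rewrite mem_rcons inE => /orP[/eqP|].
- have us := si_stkuniq inv; case: ifP => // _; rewrite rcons_uniq us andbT.
  by apply: contra yv => /(si_stkvis inv) [].
- move=> v u e /pV[[-> -> _]|[nv nu pv]]; rewrite !updE ?eqxx ?(negbTE nxy) //.
  by rewrite (negbTE nv) (negbTE nu); exact: (si_dp inv) pv.
- by move=> v; rewrite !updE; case: eqP => // _; apply: (si_dp0 inv).
- move=> v; rewrite mem_rcons inE updE; case: eqP => [_ _|_ /= /(si_dpD inv)//].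
  by have := inc_le1 y; lia.
- move=> v u e /pV[[-> -> _]|[nv nu pv]]; rewrite !updE ?eqxx ?(negbTE nxy) //.
  by rewrite (negbTE nv) (negbTE nu); exact: (si_rt inv) pv.
- move=> v; rewrite mem_rcons inE !updE; case: eqP => //= _; exact: (si_rt0 inv).
- case: (si_root inv) => [h|[c h]]; [left|right; exists c] => v; rewrite mem_rcons inE updE;
    case: eqP => [_ _ _|_ /= vv /livE lv]; by apply: h.
Qed.

(** With no live vertex among those visited so far, [si_root] starts afresh with [v] as the only
    root that matters. *)
Lemma sinv_root s v : sinv s -> stk s = [::] -> v \notin vis s ->
  (forall u, u \in vis s -> ~ live s u) -> sinv (plant s v).
Proof.
move=> inv es nv nl; have pv := par_vis inv nv; case: (inv) => *; split=> //=.
- by rewrite rcons_uniq nv.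
- move=> u u' e pu; have [[h1 h2 h3 h4] h] := si_par inv pu.
  by rewrite !mem_rcons !inE h1 h2 !orbT; split=> //; split=> //; exact: index_rcons_lt.
- by move=> u uW; rewrite mem_rcons inE (si_W inv) ?orbT.
- move=> u; rewrite mem_rcons !inE => /orP[->//|uv] tu du.
  by have := si_stk inv uv tu du; rewrite es.
- by move=> u; rewrite inE => /eqP->; rewrite mem_rcons mem_head (si_dp0 inv).
- move=> u; rewrite mem_rcons inE => /orP[/eqP->|/(si_dpD inv)//]; by rewrite (si_dp0 inv).
- move=> u u' e pu; have [[h1 h2 _ _] _] := si_par inv pu.
  by rewrite !updE; case: eqP h1 => [->|_ _]; [rewrite (negbTE nv)|];
    case: eqP h2 => [->|_ _]; rewrite ?(negbTE nv) //; exact: (si_rt inv) pu.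
- move=> u; rewrite mem_rcons inE updE; case: eqP => [->//|_] /=; exact: (si_rt0 inv).
- right; exists v => u; rewrite mem_rcons inE updE; case: eqP => //= _ uv lu.
  by case: (nl u uv); case: lu => e; exists e.
Qed.

(** The situation in which the search stops: an edge outside the tree joins two visited vertices.
    Equal roots yield a cycle, distinct roots in [W] a path between two vertices of [W]. *)
Record closing (s : search) (x y : V) (e : E) : Prop := Closing {
  cl_inv : sinv s;
  cl_x : x \in vis s;
  cl_y : y \in vis s;
  cl_J : e \in J;
  cl_new : forall v u, par s v <> Some (u, e);
  cl_jn : jn e x y;
  cl_rt : rt s x = rt s y \/ (rt s x \in W /\ rt s y \in W) }.

Lemma closing_step s x a l : sinv s -> x \in stk s -> todo s x = a :: l -> a.1 \in act s ->
  tip a \in vis s -> closing s x (tip a) a.1.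
Proof.
move=> inv xs tx ea yv.
have bx : base a = x by apply: (si_base inv); rewrite tx mem_head.
have je : jn a.1 x (tip a) by rewrite -bx; apply: jn_half.
have [xv _] := si_stkvis inv xs.
have lx : live s x by exists a.1 => //; exact: jn_ends_atl je.
have ly : live s (tip a) by exists a.1 => //; exact: jn_ends_atr je.
split=> //; first exact: subsetP (si_act inv) _ ea.
- by move=> v u pv; have [_ [_]] := si_par inv pv; rewrite ea.
- by case: (si_root inv) => [h|[c h]]; [right; rewrite !h | left; rewrite !h].
Qed.

Lemma stk0_notlive s v : sinv s -> stk s = [::] -> v \in vis s -> dp s v < D -> ~ live s v.
Proof.
move=> inv es vv dv [e ea lv]; have := si_todo inv dv ea lv.
have := si_stk inv vv; rewrite es; case: (todo s v) => // a l h.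
by have := h isT dv.
Qed.

Implicit Type s : search.

Definition linked s : {set V} := [set v | par s v != None].
Definition mother s v := if par s v is Some (u, _) then u else v.
Definition children s u : {set V} := [set v in linked s | mother s v == u].

Lemma linkedP s v : v \in linked s -> exists e, par s v = Some (mother s v, e).
Proof. by rewrite inE /mother; case: (par s v) => [[u e]|] // _; exists e. Qed.

(** With no active edge at [u], all edges at [u] are tree edges and lead to children or to the
    parent. *)
Lemma deg_children s u : sinv s -> (forall e, e \in act s -> ends_at e u = 0) ->
  deg J u <= #|children s u| + (u \in linked s).
Proof.
move=> inv na.
pose g v e := if par s v is Some (u', e') then (e' == e) * ((v == u) + (u' == u)) else 0.
apply: (@leq_trans (\sum_(e in J) \sum_v g v e)).
  apply: leq_sum => e eJ; case ea: (e \in act s); first by rewrite na.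
  have [v [u' pv]] := si_used inv eJ (negbT ea).
  rewrite (bigD1 v) //= /g pv eqxx mul1n; have [_ [_ _ je]] := si_par inv pv.
  by rewrite (jn_ends_at u je) leq_addr.
rewrite exchange_big /=.
apply: (@leq_trans (\sum_(v in linked s) ((v == u) + (mother s v == u)))).
  rewrite [X in _ <= X]big_mkcond /=; apply: leq_sum => v _; rewrite inE /mother /g.
  case pv: (par s v) => [[u' e]|] /=; last by rewrite big1.
  have [_ [eJ _ _]] := si_par inv pv.
  rewrite (bigD1 e) //= eqxx mul1n big1 ?addn0 // => e' /andP[_ ne].
  by rewrite eq_sym (negbTE ne).
rewrite big_split /= addnC; apply: leq_add.
  by rewrite -big_mkcondr /= sum1dep_card; apply: subset_leq_card; apply/subsetP=> v; rewrite !inE.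
case ul: (u \in linked s).
  rewrite (bigD1 u) //= eqxx big1 // => v /andP[_ nv]; by rewrite (negbTE nv).
by rewrite big1 // => v vl; case: eqP vl => // ->; rewrite ul.
Qed.

(* Weigh a vertex [v] of the search tree by [2 ^ (D - dp v + inc v)]: the
   children of an expanded vertex weigh at least as much as the vertex itself, so
   the weight of the unexpanded leaves is at least that of a root. *)
Lemma search_exhausted s : sinv s -> 0 < D -> stk s = [::] ->
  (forall v, inc v = (2 < deg J v)) -> (forall v, deg J v != 1) ->
  2 * #|[set v | 2 < deg J v]| < 2 ^ D -> forall v, par s v = None.
Proof.
move=> inv D0 es incE d1 few v0; case e0: (par s v0) => [[u0 e00]|] //; exfalso.
have lv0 : v0 \in linked s by rewrite inE e0.
pose phi v := 2 ^ (D - dp s v + inc v).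
pose N := linked s.
have inc1 v : inc v <= 1 by rewrite incE leq_b1.
have chw u : \sum_(v in children s u) phi v = #|children s u| * 2 ^ (D - dp s u).
  rewrite -sum_nat_const; apply: eq_bigr => v; rewrite inE => /andP[vN /eqP mv].
  have [e pv] := linkedP vN; rewrite mv in pv; have [dv du] := si_dp inv pv.
  have [[vv _ _ _] _] := si_par inv pv; have := si_dpD inv vv.
  rewrite /phi dv => h; congr (2 ^ _); move: h; clear; lia.
have tot : \sum_(v in N) phi v = \sum_u #|children s u| * 2 ^ (D - dp s u).
  rewrite (partition_big (mother s) predT) //=; apply: eq_bigr => u _; rewrite -chw.
  by apply: eq_bigl => v; rewrite !inE.
have expd u : u \in N -> dp s u < D -> phi u <= #|children s u| * 2 ^ (D - dp s u).
  move=> uN du; rewrite /phi addnC expnD leq_mul2r; apply/orP; right.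
  have [e pu] := linkedP uN; have [[uv _ _ _] [eJ _ je]] := si_par inv pu.
  have nl := stk0_notlive inv es uv du.
  have := deg_children inv (u := u); rewrite uN => /(_ _)/wrap[].
    move=> e' ea; apply/eqP; rewrite -leqn0 leqNgt; apply/negP=> h; apply: nl.
    by exists e'.
  have := d1 u; have := deg_gt0 eJ (jn_ends_atl je); rewrite incE; clear.
  by case: (ltnP 2 (deg J u)) => /=; lia.
(* An unexpanded vertex has depth at least [D] and its parent less, so it is itself a branch vertex.
   Its weight is 2, which explains the factor 2 in [few]. *)
have leaf u : u \in N -> ~~ (dp s u < D) -> phi u = 2 /\ 2 < deg J u.
  move=> uN du; have [e pu] := linkedP uN; have [h1 h2] := si_dp inv pu.
  have iu : inc u = 1 by move: (inc1 u) du h1 h2; clear; lia.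
  rewrite /phi iu; split; last by move: iu; rewrite incE; case: (2 < _).
  by rewrite (_ : D - dp s u = 0) //; move: du; clear; lia.
(* The mother of the earliest visited non-root is a root, and its children together weigh at least
   [2 ^ D]. *)
have root_child : exists2 r, r \notin N & 0 < #|children s r|.
  have [v vN vmin] : exists2 v, v \in N & forall u, u \in N -> index v (vis s) <= index u (vis s).
    by case: (arg_minnP (fun v => index v (vis s)) lv0) => v vN h; exists v.
  have [e pv] := linkedP vN; have [[_ _ lt _] _] := si_par inv pv.
  exists (mother s v); first by apply/negP=> /vmin; rewrite leqNgt lt.
  by rewrite card_gt0; apply/set0Pn; exists v; rewrite inE vN eqxx.
have: 2 ^ D <= \sum_(u in N | ~~ (dp s u < D)) phi u.
  have [r rN rc] := root_child.
  have := tot; rewrite (bigID (fun u => dp s u < D)) /=.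
  rewrite [X in _ = X](bigID (fun u => u \in N)) /=.
  rewrite [X in _ = _ + X](bigD1 r) //=.
  have : \sum_(u in N | dp s u < D) phi u <= \sum_(u in N) #|children s u| * 2 ^ (D - dp s u).
    rewrite [X in _ <= X](bigID (fun u => dp s u < D)) /=; apply: leq_trans (leq_addr _ _).
    by apply: leq_sum => u /andP[]; apply: expd.
  have : 2 ^ D <= #|children s r| * 2 ^ (D - dp s r).
    rewrite (si_dp0 inv) ?subn0 ?leq_pmull //.
    by move: rN; rewrite inE negbK => /eqP.
  clear; lia.
apply/negP; rewrite -ltnNge; apply: leq_ltn_trans few.
rewrite mulnC -sum_nat_const [X in _ <= X](bigID (fun u => u \in N)) /=.
apply: leq_trans (leq_addr _ _).
rewrite [X in X <= _]big_mkcond [X in _ <= X]big_mkcond /=; apply: leq_sum => u _.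
case: ifP => // /andP[uN du]; have [-> h] := leaf u uN du.
by rewrite inE h uN.
Qed.

(** Unblocked vertices of H keep their ranks, and vertices outside H come above them in visiting
    order. From a vertex outside H only the parent edge goes down. From an unblocked vertex of H
    only edges of H go down, since being an initial root it is nobody's child. *)
Lemma forest_order s (st : V -> nat) (H : {set E}) r : ear_inv ed H st r ->
  J = [set e | [&& e \notin H, st (ed e).1 < 2 & st (ed e).2 < 2]] ->
  W = [set v | st v == 1] -> sinv s ->
  (forall v, ~ live s v) ->
  forall c, all (fun v => st v < 2) (unzip1 c) -> ~~ simple_cycle ed c.
Proof.
move=> inv JE WE sv nl c; have [rk [rkP nol]] := ear_rank inv.
have Jused e : e \in J -> exists v u, par s v = Some (u, e).
  move=> eJ; apply: (si_used sv eJ); apply/negP=> ea; apply: (nl (ed e).1).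
  by exists e => //; exact: jn_ends_atl (jn_ends ed e).
have cls v u e : st v < 2 -> st u < 2 -> jn e v u -> (e \in H) || (e \in J).
  move=> sv1 su1 je; case eH: (e \in H) => //=; rewrite JE inE eH /=.
  by case/orP: je => /eqP->; rewrite sv1 su1.
have inH e v : e \in H -> 0 < ends_at e v -> st v != 0 by exact: (present_edge inv).
have nW v u e : par s v = Some (u, e) -> st v != 1.
  by move=> /(si_par sv) [[_ _ _]]; rewrite WE inE.
pose B := \max_v rk v.
pose rank' v := if st v == 1 then rk v else B.+1 + index v (vis s).
have rkB v : rk v <= B by apply: leq_bigmax.
have s01 v : st v < 2 -> st v != 1 -> st v = 0 by case: (st v) => [|[|]].
have down v u e : st v < 2 -> st u < 2 -> jn e v u -> rank' u <= rank' v ->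
    [/\ st v = 1, st u = 1, e \in H & rk u <= rk v] \/ (st v = 0 /\ exists u, par s v = Some (u, e)).
  move=> sv1 su1 je; rewrite /rank'; case: (st v =P 1) => [v1|/eqP v1].
    case: (st u =P 1) => [u1 h|/eqP u1 h]; last first.
      by have := leq_trans (leq_addr _ _) h; rewrite ltnNge rkB.
    left; split=> //; case/orP: (cls _ _ _ sv1 su1 je) => // /Jused [a [b pab]].
    have [_ [_ _ jab]] := si_par sv pab; have := nW _ _ _ pab.
    by case: (jn_cases jab je) => -[-> _]; rewrite ?v1 ?u1.
  have v0 := s01 _ sv1 v1; move=> h; right; split=> //.
  have eJ : e \in J.
    case/orP: (cls _ _ _ sv1 su1 je) => // eH.
    by have := inH _ _ eH (jn_ends_atl je); rewrite v0.
  have [a [b pab]] := Jused _ eJ; have [[_ _ lt _] [_ _ jab]] := si_par sv pab.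
  case: (jn_cases jab je) => -[ea eb]; first by exists b; rewrite -ea.
  have := nW _ _ _ pab; rewrite ea => u1; rewrite (negbTE u1) leq_add2l in h.
  by rewrite ea eb ltnNge h in lt.
apply: (order_acyclic (rank := rank')) => [v e1 e2 u1 u2 pv pu1 pu2 j1 j2 r1 r2|v e pv].
  case: (down _ _ _ pv pu1 j1 r1) => [[v1 s1 e1H k1]|[v0 [a1 p1]]];
  case: (down _ _ _ pv pu2 j2 r2) => [[v1' s2 e2H k2]|[v0' [a2 p2]]].
  + exact: rkP j1 j2 k1 k2.
  + by rewrite v1 in v0'.
  + by rewrite v1' in v0.
  + by rewrite p1 in p2; case: p2.
apply/negP=> je; case: (down _ _ _ pv pv je (leqnn _)) => [[v1 _ eH _]|[v0 [u pv']]].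
  by have := nol _ _ v1 eH; rewrite je.
have [[_ _ lt _] [_ _ j']] := si_par sv pv'.
by rewrite (jn_inj j' je) ltnn in lt.
Qed.

(** * Extracting a walk *)

Fixpoint up_chain s (l : seq (V * E)) (z : V) : Prop :=
  if l is p :: l' then par s p.1 = Some (head z (unzip1 l'), p.2) /\ up_chain s l' z else True.

Lemma up_chain_rcons s l z e u : up_chain s l z -> par s z = Some (u, e) ->
  up_chain s (rcons l (z, e)) u.
Proof.
elim: l => [|p l IH] //= [pp up] pz; split; last exact: IH.
by rewrite pp; case: l {IH up pp}.
Qed.

Lemma up_chain_take s l z i : up_chain s l z -> up_chain s (take i l) (nth z (trace l z) i).
Proof.
elim: l i => [|p l IH] [|i] //= [pp up]; split; last exact: IH.
by rewrite pp; case: l i {IH up pp} => [|q l] [|i] //=; rewrite nth_nil.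
Qed.

Section Chain.
Variable s : search.
Hypothesis inv : sinv s.

Lemma up_chain_par l z v : up_chain s l z -> v \in unzip1 l -> exists u e, par s v = Some (u, e).
Proof.
elim: l => //= p l IH [pp up]; rewrite inE => /orP[/eqP->|]; last exact: IH.
by exists (head z (unzip1 l)), p.2.
Qed.

Lemma up_chain_walk l z : up_chain s l z -> walk l z.
Proof.
by elim: l => //= p l IH [pp /IH->]; rewrite andbT; have [_ []] := si_par inv pp.
Qed.

Lemma up_chain_index l z v : up_chain s l z -> v \in trace l z ->
  index v (vis s) <= index (head z (unzip1 l)) (vis s).
Proof.
elim: l => /= [|p l IH]; first by rewrite inE => _ /eqP->.
move=> [pp up]; rewrite inE => /orP[/eqP->//|vl]; apply: leq_trans (IH up vl) _.
by have [[_ _ /ltnW]] := si_par inv pp.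
Qed.

Lemma up_chain_uniq l z : up_chain s l z -> uniq (trace l z).
Proof.
elim: l => //= p l IH [pp up]; rewrite IH // andbT; apply/negP=> h.
have := up_chain_index up h; have [[_ _ lt _] _] := si_par inv pp.
by rewrite leqNgt lt.
Qed.

Lemma up_chain_rt l z : up_chain s l z -> rt s (head z (unzip1 l)) = rt s z.
Proof. by elim: l => //= p l IH [pp up]; rewrite -IH // (si_rt inv pp). Qed.

Lemma up_chain_dp l z : up_chain s l z ->
  \sum_(v <- unzip1 l) inc v + dp s z = dp s (head z (unzip1 l)).
Proof.
elim: l => [|p l IH] /=; first by rewrite big_nil.
by move=> [pp up]; rewrite big_cons -addnA IH // addnC; have [] := si_dp inv pp.
Qed.

Lemma up_chain_edge l z e : up_chain s l z -> e \in unzip2 l ->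
  exists v u, v \in unzip1 l /\ par s v = Some (u, e).
Proof.
elim: l => //= p l IH [pp up]; rewrite inE => /orP[/eqP->|/(IH up) [v [u [vl pv]]]].
  by exists p.1, (head z (unzip1 l)); rewrite mem_head.
by exists v, u; rewrite inE vl orbT.
Qed.

Lemma up_chain_uniq_edges l z : up_chain s l z -> uniq (unzip2 l).
Proof.
move=> up; have := up_chain_uniq up; rewrite /trace rcons_uniq => /andP[_].
elim: l up => //= p l IH [pp up] /andP[np u]; rewrite IH // andbT.
apply/negP=> /(up_chain_edge up) [v [w [vl pv]]].
by rewrite (si_inj inv pp pv) vl in np.
Qed.

(** The path [l] reversed. Reversal shifts edges against vertices by one place, so [e] is supplied
    as the edge leaving the last vertex. *)
Definition down_walk (l : seq (V * E)) (z : V) (e : E) : seq (V * E) :=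
  zip (z :: rev (unzip1 l)) (rcons (rev (unzip2 l)) e).

Lemma down_walk1 l z e : unzip1 (down_walk l z e) = z :: rev (unzip1 l).
Proof. by rewrite /down_walk unzip1_zip //= size_rcons !size_rev !size_map. Qed.

Lemma down_walk2 l z e : unzip2 (down_walk l z e) = rcons (rev (unzip2 l)) e.
Proof. by rewrite /down_walk unzip2_zip //= size_rcons !size_rev !size_map. Qed.

Lemma down_walk_walk l z e x : up_chain s l z -> jn e (head z (unzip1 l)) x ->
  walk (down_walk l z e) x.
Proof.
elim: l e x => [|p l IH] e x /=; first by rewrite andbT.
move=> [pp up] je.
have -> : down_walk (p :: l) z e = rcons (down_walk l z p.2) (p.1, e).
  rewrite /down_walk /= !rev_cons -rcons_cons -zip_rcons //=.
  by rewrite size_rcons !size_rev !size_map.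
rewrite -cats1 walk_cat /= andbT je andbT; apply: IH => //.
by rewrite jn_sym; have [_ []] := si_par inv pp.
Qed.

(** The walk goes from [zy] down to [y], across [e] to [x], and up to position [i]. If the climb
    from [y] met the path from [x], it closes there; otherwise both climbs ended at roots, which
    differ and hence lie in [W]. Increments along a tree path telescope to a difference of depths,
    so each side contributes at most [D]; the top vertex [zy] is counted separately. *)
Lemma closing_walk x y e lx zx ly zy i : closing s x y e ->
  up_chain s lx zx -> head zx (unzip1 lx) = x -> par s zx = None ->
  up_chain s ly zy -> head zy (unzip1 ly) = y ->
  (forall v, v \in unzip1 ly -> v \notin trace lx zx) ->
  (if zy \in trace lx zx then i = index zy (trace lx zx) else
     i = size lx /\ par s zy = None) ->
  zx \in vis s -> zy \in vis s -> dp s x <= D -> dp s y <= D ->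
  let c := down_walk ly zy e ++ take i lx in
  let z := nth zx (trace lx zx) i in
  [/\ simple_walk ed c z, {subset unzip2 c <= J}, head z (unzip1 c) = zy /\
      (forall v, v \in behead (unzip1 c) -> v \in vis s /\ par s v != None),
      z = zy \/ [/\ z != zy, z \in W & zy \in W] &
      \sum_(v <- unzip1 c) inc v <= inc zy + (D + D)].
Proof.
move=> cl ux hx px uy hy dis hi zxv zyv dx dy c z.
have c1 : unzip1 c = zy :: (rev (unzip1 ly) ++ take i (unzip1 lx)).
  by rewrite /c /unzip1 map_cat -/unzip1 down_walk1 -map_take.
have c2 : unzip2 c = rcons (rev (unzip2 ly)) e ++ take i (unzip2 lx).
  by rewrite /c /unzip2 map_cat -/unzip2 down_walk2 -map_take.
have ut := up_chain_take i ux; rewrite -/z in ut.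
have hz : head z (unzip1 (take i lx)) = x.
  by rewrite /z -hx; case: (lx) (i) => [|p l] [|j] //=; rewrite nth_nil.
have i_le : i <= size lx.
  move: hi; case: ifP => [zin ->|_ [->]//]; rewrite -ltnS.
  by rewrite -(size_map fst lx) -(size_rcons _ zx) index_mem.
have utr : uniq (take i (unzip1 lx)) /\ z \notin take i (unzip1 lx).
  have := up_chain_uniq ut; rewrite /trace rcons_uniq /unzip1 map_take => /andP[-> ->] //.
have uyt := up_chain_uniq uy; rewrite /trace rcons_uniq in uyt.
case/andP: uyt => zyn uly.
have subt v : v \in take i (unzip1 lx) -> v \in trace lx zx.
  by move=> /mem_take vl; rewrite mem_rcons inE vl orbT.
have dis2 v : v \in unzip1 ly -> v \notin take i (unzip1 lx).
  by move=> /dis; apply: contra; exact: subt.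
have zcase : z = zy /\ zy \notin take i (unzip1 lx) \/
    [/\ zy \notin trace lx zx, z = zx, i = size lx & par s zy = None].
  move: hi; case: ifP => [zin ei|/negbT zin [ei pz]]; [left|right].
    by rewrite (_ : z = zy) /z ?ei ?nth_index // in utr *; case: utr.
  by split=> //; rewrite /z ei /trace nth_rcons size_map ltnn eqxx.
have zyt : zy \notin take i (unzip1 lx).
  by case: zcase => [[]//|[h _ _ _]]; apply: contra h; exact: subt.
have ztail : z \notin rev (unzip1 ly) ++ take i (unzip1 lx).
  rewrite mem_cat mem_rev negb_or (proj2 utr) andbT.
  case: zcase => [[->]//|[_ -> _ _]]; apply: contraTN isT => /dis.
  by rewrite mem_rcons mem_head.
split.
- split.
  + by rewrite -size_eq0 -(size_map fst) -/(unzip1 c) c1.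
  + rewrite /c walk_cat hz (up_chain_walk ut) andbT; apply: down_walk_walk => //.
    by rewrite hy jn_sym; exact: cl_jn cl.
  + rewrite c1 /= mem_cat mem_rev negb_or zyn zyt cat_uniq rev_uniq uly (proj1 utr) /= !andbT.
    by apply/hasPn=> v vt; rewrite mem_rev; apply/negP=> /dis2; rewrite vt.
  + rewrite c2 cat_uniq rcons_uniq mem_rev rev_uniq (up_chain_uniq_edges uy) andbT.
    have := up_chain_uniq_edges ut; rewrite /unzip2 map_take => ->; rewrite andbT.
    apply/andP; split.
      by apply/negP=> /(up_chain_edge uy) [v [u [_ /(cl_new cl)]]].
    apply/hasPn=> e' e't; rewrite mem_rcons inE mem_rev; apply/norP; split.
      apply/eqP=> ee; have [v [u [_ pv]]] := up_chain_edge ux (mem_take e't).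
      by rewrite ee in pv; case: (cl_new cl pv).
    rewrite -map_take in e't; have [v [u [vl pv]]] := up_chain_edge ut e't.
    apply/negP=> /(up_chain_edge uy) [v' [u' [vl' pv']]].
    have := dis2 _ vl'; rewrite -(si_inj inv pv pv') /unzip1 -map_take; by rewrite vl.
  + by rewrite c1.
- move=> e'; rewrite c2 mem_cat mem_rcons inE mem_rev => /orP[/orP[/eqP->|]|/mem_take].
  + exact: cl_J cl.
  + by move=> /(up_chain_edge uy) [v [u [_ /(si_par inv) [_ []]]]].
  + by move=> /(up_chain_edge ux) [v [u [_ /(si_par inv) [_ []]]]].
- rewrite c1; split=> // v /=; rewrite mem_cat mem_rev => /orP[/(up_chain_par uy)|/mem_take/(up_chain_par ux)];
  by move=> [u [e' pv]]; have [[vv _ _ _] _] := si_par inv pv; rewrite pv.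
- case: zcase => [[->]|[zn -> _ pz]]; [by left | right].
  have nzz : zx != zy by apply: contraNneq zn => <-; rewrite mem_rcons mem_head.
  have rx := up_chain_rt ux; have ry := up_chain_rt uy.
  rewrite hx (si_rt0 inv zxv px) in rx; rewrite hy (si_rt0 inv zyv pz) in ry.
  case: (cl_rt cl); rewrite rx ry; last by case.
  by move=> ee; rewrite ee eqxx in nzz.
rewrite c1 big_cons leq_add2l big_cat /= (perm_big _ (permEl (perm_rev _))) /=.
have := up_chain_dp uy; have := up_chain_dp ut; rewrite hz hy /unzip1 map_take.
move: dx dy; clear; lia.
Qed.

End Chain.

End Search.

(** * Symbolic execution of loop-free code *)

Section Rules.
Variables w S : nat.

Lemma wp_seq c1 c2 Q s : wp w S c1 (wp w S c2 Q) s -> wp w S (Seq c1 c2) Q s.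
Proof. by []. Qed.

(** The address [i] and the value [x] are supplied by the user, so that the updated memory is
    described by mathematical terms and not by unevaluated expressions. *)
Lemma wp_put a ei ex (Q : state -> Prop) M o i x : den M ei = i -> den M ex = x ->
  safe w S M ei -> i < S -> safe w S M ex -> Q (update M a i x, o) ->
  wp w S (Put a ei ex) Q (M, o).
Proof. by move=> <- <- h1 h2 h3 h4; exact: (conj h1 (conj h2 (conj h3 h4))). Qed.

Lemma wp_if e c1 c2 Q s : safe w S s.1 e ->
  (den s.1 e != 0 -> wp w S c1 Q s) -> (den s.1 e = 0 -> wp w S c2 Q s) ->
  wp w S (If e c1 c2) Q s.
Proof. by move=> /= se h1 h2; split=> //; case: eqP => /= h; [exact: h2 | exact/h1/eqP]. Qed.

Lemma wp_out e (Q : state -> Prop) M o x : den M e = x -> safe w S M e ->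
  Q (M, rcons o x) -> wp w S (Out e) Q (M, o).
Proof. by move=> <- h1 h2; exact: (conj h1 h2). Qed.

End Rules.

(** * The program *)

Declare Scope prog_scope.
Delimit Scope prog_scope with prog.
Notation "$ a" := (Get a (Const 0)) (at level 5, a at level 2, format "$ a") : prog_scope.
Notation "a <[ i ]>" := (Get a i) (at level 6, i at level 90, format "a <[ i ]>") : prog_scope.
Notation "a @[ i ] ::= e" := (Put a i e) (at level 75, i at level 90) : prog_scope.
Notation "a ::= e" := (Put a (Const 0) e) (at level 75) : prog_scope.
Notation "c ;; d" := (Seq c d) (at level 80, right associativity) : prog_scope.
Notation "# n" := (Const n) (at level 5, n at level 2, format "# n") : prog_scope.
Infix "+" := (Op Plus) : prog_scope.
Infix "-" := (Op Minus) : prog_scope.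
Infix "*" := (Op Times) : prog_scope.
Infix "/" := (Op Over) : prog_scope.
Infix "=?" := (Op Equal) (at level 70) : prog_scope.
Infix "<?" := (Op Less) (at level 70) : prog_scope.

Notation aSRC := 1 (only parsing).
Notation aDST := 2 (only parsing).
Notation aHEAD := 3 (only parsing).
Notation aNEXT := 4 (only parsing).
Notation aSTAT := 5 (only parsing).
Notation aINH := 6 (only parsing).
Notation aVIS := 7 (only parsing).
Notation aPAR := 8 (only parsing).
Notation aPE := 9 (only parsing).
Notation aDEP := 10 (only parsing).
Notation aDEG := 11 (only parsing).
Notation aSUM := 12 (only parsing).
Notation aPTR := 13 (only parsing).
Notation aSTK := 14 (only parsing).
Notation aMARK := 15 (only parsing).
Notation aPV := 16 (only parsing).
Notation aPW := 17 (only parsing).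
Notation aACT := 18 (only parsing).
Notation xI := 20 (only parsing).
Notation xSP := 21 (only parsing).
Notation xR := 22 (only parsing).
Notation xFOUND := 23 (only parsing).
Notation xX := 24 (only parsing).
Notation xH := 25 (only parsing).
Notation xE := 26 (only parsing).
Notation xY := 27 (only parsing).
Notation xCUR := 28 (only parsing).
Notation xTOP := 29 (only parsing).
Notation xLO := 30 (only parsing).
Notation xHI := 31 (only parsing).
Notation xD := 32 (only parsing).
Notation xT := 33 (only parsing).
Notation xCNT := 34 (only parsing).
Notation xSTUCK := 35 (only parsing).
Notation xL := 36 (only parsing).
Notation xV := 37 (only parsing).
Notation xJ := 38 (only parsing).

Notation eN := (Get 0 (Const 0)) (only parsing).
Notation eM := (Get 0 (Const 1)) (only parsing).
Notation eK := (Get 0 (Const 2)) (only parsing).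

Section Programs.
Local Open Scope prog_scope.

(* The adjacency lists are linked lists of half-edges: edge e is coded as 2e + 1 at
   its first end and as 2e + 2 at its second end, and 0 ends a list. *)
Definition build_adjacency : cmd :=
  for_loop xI eM
    (aNEXT@[#2 * $xI + #1] ::= aHEAD<[aSRC<[$xI]>]> ;;
     aHEAD@[aSRC<[$xI]>] ::= #2 * $xI + #1 ;;
     aNEXT@[#2 * $xI + #2] ::= aHEAD<[aDST<[$xI]>]> ;;
     aHEAD@[aDST<[$xI]>] ::= #2 * $xI + #2).

(* [aPAR] holds 1 + the parent, and 0 at the roots. *)
Definition reset : cmd :=
  (xSP ::= #0 ;; xR ::= #0 ;; xFOUND ::= #0) ;;
  for_loop xI eN
    (aVIS@[$xI] ::= (aSTAT<[$xI]> =? #1) ;;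
     aPAR@[$xI] ::= #0 ;;
     aPTR@[$xI] ::= aHEAD<[$xI]> ;;
     aDEP@[$xI] ::= #0 ;;
     aDEG@[$xI] ::= #0 ;;
     aSUM@[$xI] ::= #0 ;;
     aMARK@[$xI] ::= #0 ;;
     If (aSTAT<[$xI]> =? #1) (aSTK@[$xSP] ::= $xI ;; xSP ::= $xSP + #1) Skip).

Definition select_new : cmd :=
  for_loop xI eM
    (aACT@[$xI] ::= (aINH<[$xI]> =? #0) *
       ((aSTAT<[aSRC<[$xI]>]> <? #2) * (aSTAT<[aDST<[$xI]>]> <? #2))).

(* When the cycles are being extracted, status 2 marks the vertices of those
   already output. *)
Definition delete_dead : cmd :=
  for_loop xI eM
    (aINH@[$xI] ::= aINH<[$xI]> *
       ((aSTAT<[aSRC<[$xI]>]> <? #2) * (aSTAT<[aDST<[$xI]>]> <? #2)) ;;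
     aDEG@[aSRC<[$xI]>] ::= aDEG<[aSRC<[$xI]>]> + aINH<[$xI]> ;;
     aSUM@[aSRC<[$xI]>] ::= aSUM<[aSRC<[$xI]>]> + aINH<[$xI]> * $xI ;;
     aDEG@[aDST<[$xI]>] ::= aDEG<[aDST<[$xI]>]> + aINH<[$xI]> ;;
     aSUM@[aDST<[$xI]>] ::= aSUM<[aDST<[$xI]>]> + aINH<[$xI]> * $xI).

(* At a vertex of degree 1, the sum [aSUM] of the incident edges is the last edge;
   its other end is obtained as the sum of the ends minus the vertex. *)
Definition trim : cmd :=
  (xV ::= #0 ;; xX ::= #0) ;;
  While ($xV <? eN)
    (If (aDEG<[$xX]> =? #1)
       (xE ::= aSUM<[$xX]> ;;
        aDEG@[$xX] ::= #0 ;;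
        aINH@[$xE] ::= #0 ;;
        xY ::= aSRC<[$xE]> + aDST<[$xE]> - $xX ;;
        aDEG@[$xY] ::= aDEG<[$xY]> - #1 ;;
        aSUM@[$xY] ::= aSUM<[$xY]> - $xE ;;
        xX ::= $xY)
       (xV ::= $xV + #1 ;; xX ::= $xV)).

Definition copy_edges : cmd :=
  for_loop xI eM (aACT@[$xI] ::= aINH<[$xI]>).

Definition clear_status : cmd :=
  for_loop xI eN (aSTAT@[$xI] ::= #0).

(** The edge is retired before its other end is examined, so a child does not meet its parent edge
    again, whereas a self-loop or a parallel edge closes a cycle. *)
Definition scan : cmd :=
  xX ::= aSTK<[$xSP - #1]> ;;
  xH ::= aPTR<[$xX]> ;;
  If ($xH =? #0)
    (xSP ::= $xSP - #1)
    (aPTR@[$xX] ::= aNEXT<[$xH]> ;;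
     xE ::= ($xH - #1) / #2 ;;
     If (aACT<[$xE]>)
       (aACT@[$xE] ::= #0 ;;
        xY ::= aSRC<[$xE]> + aDST<[$xE]> - $xX ;;
        If (aVIS<[$xY]>)
          (xFOUND ::= #1)
          (aVIS@[$xY] ::= #1 ;;
           aPAR@[$xY] ::= $xX + #1 ;;
           aPE@[$xY] ::= $xE ;;
           aDEP@[$xY] ::= aDEP<[$xX]> + (#2 <? aDEG<[$xY]>) ;;
           If (aDEP<[$xY]> <? $xD)
             (aSTK@[$xSP] ::= $xY ;; xSP ::= $xSP + #1)
             Skip))
       Skip).

(** [xR] only moves forward, so all attempts at finding a root take linear time together. *)
Definition new_root : cmd :=
  If (aVIS<[$xR]>) Skip
    (aVIS@[$xR] ::= #1 ;; aSTK@[#0] ::= $xR ;; xSP ::= #1) ;;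
  xR ::= $xR + #1.

Definition explore : cmd :=
  While (($xFOUND =? #0) * (#0 <? $xSP + ($xR <? eN)))
    (If $xSP scan new_root).

(* The walk closed by the edge [xE] from [xX] to [xY] is laid out in [aPV] (vertices)
   and [aPW] (edges) from [xLO] to [xHI]: the tree path from [xX] goes to the right
   from position n, and the one from [xY] to the left from position n - 1, until it
   meets the former.  [aMARK] holds positions in [aPV], which are nonzero. *)
Definition climb_x : cmd :=
  (xTOP ::= eN ;; xCUR ::= $xX ;;
   aPV@[$xTOP] ::= $xCUR ;; aMARK@[$xCUR] ::= $xTOP) ;;
  While (aPAR<[$xCUR]>)
    (aPW@[$xTOP] ::= aPE<[$xCUR]> ;;
     xCUR ::= aPAR<[$xCUR]> - #1 ;;
     xTOP ::= $xTOP + #1 ;;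
     aPV@[$xTOP] ::= $xCUR ;;
     aMARK@[$xCUR] ::= $xTOP).

Definition climb_y : cmd :=
  (xLO ::= eN - #1 ;; xCUR ::= $xY ;;
   aPV@[$xLO] ::= $xCUR ;; aPW@[$xLO] ::= $xE) ;;
  While ((aMARK<[$xCUR]> =? #0) * (#0 <? aPAR<[$xCUR]>))
    (xLO ::= $xLO - #1 ;;
     aPW@[$xLO] ::= aPE<[$xCUR]> ;;
     xCUR ::= aPAR<[$xCUR]> - #1 ;;
     aPV@[$xLO] ::= $xCUR) ;;
  If (aMARK<[$xCUR]>) (xHI ::= aMARK<[$xCUR]>) (xHI ::= $xTOP).

Definition attach_ear : cmd :=
  for_loop xI ($xHI - $xLO)
    (aINH@[aPW<[$xLO + $xI]>] ::= #1 ;;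
     aSTAT@[aPV<[$xLO + $xI]>] ::= #1) ;;
  (aSTAT@[aPV<[$xLO]>] ::= #2 ;;
   aSTAT@[aPV<[$xHI]>] ::= #2).

Definition output_cycle : cmd :=
  Out ($xHI - $xLO) ;;
  for_loop xI ($xHI - $xLO)
    (Out (aPV<[$xLO + $xI]>) ;;
     Out (aPW<[$xLO + $xI]>) ;;
     aSTAT@[aPV<[$xLO + $xI]>] ::= #2).

Definition find_ears : cmd :=
  (xCNT ::= #0 ;; xSTUCK ::= #0) ;;
  While (($xSTUCK =? #0) * ($xCNT <? $xT))
    (reset ;; select_new ;; explore ;;
     If ($xFOUND)
       (climb_x ;; climb_y ;; attach_ear ;; xCNT ::= $xCNT + #1)
       (xSTUCK ::= #1)).

Definition output_blocked : cmd :=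
  Out #0 ;;
  for_loop xI eN (If (aSTAT<[$xI]> =? #2) (Out ($xI)) Skip).

Definition output_cycles : cmd :=
  clear_status ;; Out #1 ;;
  for_loop xJ eK
    (reset ;; delete_dead ;; trim ;; copy_edges ;; explore ;; climb_x ;; climb_y ;; output_cycle).

(* D is chosen so that 4T < 2^D, since H has at most 2T branch vertices. *)
Definition set_bounds : cmd :=
  (xL ::= #0 ;; xX ::= eK) ;;
  While ($xX) (xX ::= $xX / #2 ;; xL ::= $xL + #1) ;;
  xD ::= #2 * $xL + #8 ;;
  xT ::= (eK - #1) * (#8 * $xD + #5) + #1.

(** Trivial inputs are answered at once: zero cycles for k = 0, and the empty set for a graph
    without vertices. Everything else runs with k and n positive. *)
Definition main : cmd :=
  If eK
    (If eN
       (set_bounds ;; build_adjacency ;; find_ears ;;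
        If ($xSTUCK) output_blocked output_cycles)
       (Out #0))
    (Out #1).

End Programs.

(** * Correctness of the program *)

Ltac mem_solve facts :=
  rewrite /= /update /= ?facts /= ?eqxx /=; repeat split; try done; try (clear; lia); try lia.

Ltac do_put i x facts :=
  try apply/wp_seq;
  apply: (wp_put (i := i) (x := x));
    [by mem_solve facts | by mem_solve facts | by mem_solve facts | by mem_solve facts
    | by mem_solve facts |].

Ltac do_if facts :=
  try apply/wp_seq;
  apply: wp_if; [by mem_solve facts
    | let h := fresh "tst" in intro h; rewrite /= /update /= ?facts /= in h; revert h
    | let h := fresh "tst" in intro h; rewrite /= /update /= ?facts /= in h; revert h].

(** The walk being laid out occupies positions below 2n, and half-edge codes go up to 2m. The square
    makes room for [aSUM], which adds up edge numbers. *)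
Record roomy (n m w S : nat) : Prop := Roomy {
  word_128 : 128 < 2 ^ w;
  word_nm : 8 * (n + m + 2) * (n + m + 2) < 2 ^ w;
  cells_nm : 2 * n + 2 * m + 8 < S;
  n_gt0 : 0 < n }.

Section Machine.
Variables (n m k : nat) (ed : 'I_m -> 'I_n * 'I_n) (w S : nat).
Hypothesis room : roomy n m w S.
Let w_ge := word_128 room.
Let w_big := word_nm room.
Let S_big := cells_nm room.
Let n_pos := n_gt0 room.
Let lS0 : 0 < S. Proof. by clear -S_big; lia. Qed.
Let lw0 : 0 < 2 ^ w. Proof. by rewrite expn_gt0. Qed.
Let lw1 : 1 < 2 ^ w. Proof. exact: ltn_trans w_ge. Qed.
Let lnS : n < S. Proof. by clear -S_big; lia. Qed.
Let lmS : m < S. Proof. by clear -S_big; lia. Qed.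
Local Notation half := ('I_m * bool)%type.
Local Notation search := (search 'I_n 'I_m).
Local Notation steps := (seq ('I_n * 'I_m)).
Local Notation jn := (jn ed).
Local Notation deg := (deg ed).
Local Notation ends_at := (ends_at ed).
Local Notation excess := (excess ed).

(** * Adjacency lists in memory *)

Definition code (a : half) : nat := (2 * a.1 + a.2).+1.

Fixpoint chain (next : nat -> nat) (h : nat) (l : seq half) : Prop :=
  if l is a :: l' then h = code a /\ chain next (next h) l' else h = 0.

Lemma code_inj : injective code.
Proof.
move=> [e b] [e' b'] [] h; have : nat_of_ord e = e' by case: b b' h => [] []; lia.
by move/val_inj=> ee; subst e'; congr (_, _); case: b b' h => [] []; lia.
Qed.

Lemma eq_chain f g h l : (forall a, a \in l -> f (code a) = g (code a)) ->
  chain f h l -> chain g h l.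
Proof.
elim: l h => //= a l IH h fg [-> c]; split=> //.
rewrite -fg ?mem_head //; apply: IH c => b bl; apply: fg; by rewrite inE bl orbT.
Qed.

Definition base_mem (M : memory) : Prop :=
  [/\ M 0 0 = n, M 0 1 = m, M 0 2 = k,
      forall e : 'I_m, M aSRC e = (ed e).1 & forall e : 'I_m, M aDST e = (ed e).2].

Definition adjacency (M : memory) (adj : 'I_n -> seq half) : Prop :=
  [/\ forall v : 'I_n, chain (M aNEXT) (M aHEAD v) (adj v),
      forall v a, (a \in adj v) = (base ed a == v) &
      \sum_v size (adj v) <= 2 * m].

Lemma base_mem_frame c s s' : frame c s s' ->
  all (fun a => a \notin writes c) [:: 0; aSRC; aDST] -> base_mem s.1 -> base_mem s'.1.
Proof.
move=> [f _] /= /and4P[n0 n1 n2 _] [h0 h1 h2 h3 h4].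
by split=> [|||e|e]; rewrite ?(f 0 n0) ?(f _ n1) ?(f _ n2).
Qed.

Lemma adjacency_frame c s s' adj : frame c s s' ->
  all (fun a => a \notin writes c) [:: aHEAD; aNEXT] -> adjacency s.1 adj -> adjacency s'.1 adj.
Proof.
move=> [f _] /= /and3P[n0 n1 _] [h0 h1 h2]; split=> // v; rewrite (f _ n0).
by apply: eq_chain (h0 v) => a _; rewrite (f _ n1).
Qed.

Lemma nm_word c : c <= 8 * (n + m + 2) -> c < 2 ^ w.
Proof. by move=> h; apply: leq_ltn_trans w_big; apply: leq_trans h _; rewrite leq_pmulr // addn2. Qed.

Definition push (M : memory) (a : half) : memory :=
  update (update M aNEXT (code a) (M aHEAD (base ed a))) aHEAD (base ed a) (code a).

Definition buckets (M : memory) (L : seq half) : Prop :=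
  forall v : 'I_n, chain (M aNEXT) (M aHEAD v) [seq a <- L | base ed a == v].

(** As the half-edge is new, writing its [aNEXT] cell damages no existing list. *)
Lemma buckets_push M L a : a \notin L -> buckets M L -> buckets (push M a) (a :: L).
Proof.
move=> na h v; have fr b : b \in L -> push M a aNEXT (code b) = M aNEXT (code b).
  move=> bL; rewrite /push /update /=; case: eqP => // /code_inj eb.
  by rewrite -eb bL in na.
rewrite /= {2}/push /update /= val_eqE eq_sym; case: eqP => [<-|_] /=.
  split=> //; rewrite {2}/push /update /= eqxx.
  by apply: eq_chain (h (base ed a)) => b; rewrite mem_filter => /andP[_ /fr].
by apply: eq_chain (h v) => b; rewrite mem_filter => /andP[_ /fr].
Qed.

Lemma build_adjacency_runs s : bounded w s.1 -> base_mem s.1 -> (forall v, s.1 aHEAD v = 0) ->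
  runs w S build_adjacency s (100 * (n + m + 1)) (fun s' => exists adj, adjacency s'.1 adj).
Proof.
move=> bs bm h0.
apply: (@runs_for _ _ w_ge _ _ _ _ _ m 60 _ (fun j s' => exists L : seq half,
   [/\ forall a, (a \in L) = (a.1 < j), size L = 2 * j & buckets s'.1 L])) => //.
- move=> s' f; have [_ bm1 _ _ _] := base_mem_frame f isT bm.
  by rewrite /= bm1; split=> //; split=> //; lia.
- by apply: nm_word; lia.
- by exists [::]; split=> [a||v] //=; rewrite /update /= h0.
- move=> j [M o] lj /= bM f xj [L [memL sL bk]].
  have bmM := base_mem_frame f isT bm; have [m0 m1 m2 m3 m4] := bmM.
  pose e := Ordinal lj; have s3 := m3 e; have s4 := m4 e; rewrite /= in s3 s4.
  have lu := ltn_ord (ed e).1; have lv := ltn_ord (ed e).2.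
  have lw : 2 * j + 2 < 2 ^ w by apply: nm_word; lia.
  have lw2 : (2 * j) < 2 ^ w by lia.
  have lw3 : (2 * j).+1 < 2 ^ w by lia.
  apply: (runs_block w_ge); [exact: bM | by [] |].
  have c0 : code (e, false) = 2 * j + 1 by rewrite /code /= addn0 addn1.
  have c1 : code (e, true) = 2 * j + 2 by rewrite /code /= addn1 addn2.
  do_put (2 * j + 1) (M aHEAD (ed e).1) (xj, s3, s4).
  do_put (nat_of_ord (ed e).1) (2 * j + 1) (xj, s3, s4).
  do_put (2 * j + 2) (update M aHEAD (ed e).1 (2 * j + 1) aHEAD (ed e).2) (xj, s3, s4).
  do_put (nat_of_ord (ed e).2) (2 * j + 2) (xj, s3, s4).
  pose M' := push (push M (e, false)) (e, true).
  exists [:: (e, true), (e, false) & L]; split.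
  + move=> a; rewrite !inE memL; case: a => e' b; rewrite !xpair_eqE -!val_eqE /=.
    by case: b; rewrite ?andbF ?andbT ?orbF /=; case: ltngtP; lia.
  + by rewrite /= sL mulnS.
  + have nL b : (e, b) \notin L by rewrite memL /= ltnn.
    have h : buckets M' [:: (e, true), (e, false) & L].
      apply: buckets_push; last exact: buckets_push.
      by rewrite inE xpair_eqE andbF (negbTE (nL _)).
    move=> v; have := h v; rewrite /M' /push c0 c1; exact: id.
- move=> [M o] /= _ _ [L [memL sL bk]].
  exists (fun v => [seq a <- L | base ed a == v]); split=> //.
    by move=> v a; rewrite mem_filter memL ltn_ord andbT.
  rewrite -sL (eq_bigr (fun v => \sum_(a <- L) (base ed a == v))); last first.
    by move=> v _; rewrite size_filter -sum1_count big_mkcond.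
  rewrite exchange_big /= -sum1_size; apply: leq_sum => a _.
  by rewrite (bigD1 (base ed a)) //= eqxx big1 // => v; rewrite eq_sym => /negbTE->.
- rewrite /=; lia.
Qed.

(** * Initialisation of a round *)

Definition stored (M : memory) (a : nat) (l : seq 'I_n) : Prop :=
  forall i, i < size l -> M a i = nth 0 [seq nat_of_ord v | v <- l] i.

Record fresh (st : nat -> nat) (ws : seq 'I_n) (j : nat) (M : memory) : Prop := Fresh {
  fr_uniq : uniq ws;
  fr_ws : forall v, (v \in ws) = (v < j) && (st v == 1);
  fr_sp : M xSP 0 = size ws;
  fr_stk : stored M aSTK ws;
  fr_v : forall v, v < j -> [/\ M aVIS v = (st v == 1), M aPAR v = 0,
     M aPTR v = M aHEAD v & M aDEP v = 0] /\ [/\ M aDEG v = 0, M aSUM v = 0 & M aMARK v = 0];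
  fr_r : M xR 0 = 0;
  fr_found : M xFOUND 0 = 0 }.

Lemma size_ord (l : seq 'I_n) : uniq l -> size l <= n.
Proof. by move=> /card_uniqP <-; apply: leq_trans (max_card _) _; rewrite card_ord. Qed.

Lemma stored_rcons M l v i : stored M aSTK l -> i = size l ->
  stored (update M aSTK i (nat_of_ord v)) aSTK (rcons l v).
Proof.
move=> h -> i'; rewrite size_rcons ltnS => li; rewrite /update /= map_rcons nth_rcons size_map.
by case: ltngtP li => // li _; rewrite h.
Qed.

Lemma reset_runs s : bounded w s.1 -> base_mem s.1 ->
  runs w S reset s (100 * n.+1) (fun s' => exists ws, fresh (s.1 aSTAT) ws n s'.1).
Proof.
move=> bs bm.
pose Q0 (s' : state) := [/\ s'.1 xSP 0 = 0, s'.1 xR 0 = 0 & s'.1 xFOUND 0 = 0].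
suff h s1 : bounded w s1.1 -> Q0 s1 -> base_mem s1.1 -> s1.1 aSTAT =1 s.1 aSTAT ->
    runs w S (for_loop xI eN
    (aVIS@[$xI] ::= (aSTAT<[$xI]> =? #1) ;;
     aPAR@[$xI] ::= #0 ;;
     aPTR@[$xI] ::= aHEAD<[$xI]> ;;
     aDEP@[$xI] ::= #0 ;;
     aDEG@[$xI] ::= #0 ;;
     aSUM@[$xI] ::= #0 ;;
     aMARK@[$xI] ::= #0 ;;
     If (aSTAT<[$xI]> =? #1) (aSTK@[$xSP] ::= $xI ;; xSP ::= $xSP + #1) Skip)%prog) s1
      (90 * n.+1) (fun s' => exists ws, fresh (s.1 aSTAT) ws n s'.1).
  have pre : runs w S (xSP ::= #0 ;; xR ::= #0 ;; xFOUND ::= #0)%prog s 10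
      (fun s1 => Q0 s1 /\ s1.1 aSTAT =1 s.1 aSTAT).
    case: (s) bs => M o b0; apply: (runs_block w_ge); [exact: b0 | by [] |].
    by do 3 do_put 0 0 tt.
  apply: (runs_seq bs pre (T2 := 90 * n.+1)); first lia.
  by move=> s1 b1 f1 [q1 e1]; apply: h => //; exact: base_mem_frame f1 isT bm.
move=> b1 [sp0 r0 fd0] bm1 eST.
apply: (@runs_for _ _ w_ge _ _ _ _ _ n 70 _
  (fun j s' => exists ws, fresh (s.1 aSTAT) ws j s'.1)) => //.
- move=> s' f; have [bm0 _ _ _ _] := base_mem_frame f isT bm1.
  by rewrite /= bm0; split=> //; split=> //; lia.
- by apply: nm_word; lia.
- by exists [::]; split.
- move=> j [M o] lj bM f xj [ws fr].
  have bmM := base_mem_frame f isT bm1; have [m0 m1 m2 m3 m4] := bmM; rewrite /= in xj m0.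
  have stj : M aSTAT j = s.1 aSTAT j by have := (proj1 f) aSTAT isT j; rewrite eST.
  have sws : size ws <= j.
    rewrite -(size_map val) -(size_iota 0 j); apply: uniq_leq_size.
      by rewrite (map_inj_uniq val_inj) (fr_uniq fr).
    by move=> v /mapP[u]; rewrite (fr_ws fr) mem_iota => /andP[lv _] ->.
  have sp := fr_sp fr; rewrite /= in sp.
  have lw : (size ws) + 1 < 2 ^ w by apply: nm_word; lia.
  apply: (runs_block w_ge); [exact: bM | by [] |].
  do_put j (nat_of_bool (s.1 aSTAT j == 1)) (xj, stj).
  do_put j 0 (xj, stj).
  do_put j (M aHEAD j) (xj, stj).
  do 4 do_put j 0 (xj, stj).
  have fv v : v < j.+1 -> v == j \/ v < j /\ (v == j) = false.
    by rewrite ltnS leq_eqVlt; case: eqP; auto.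
  do_if (xj, stj).
    case: (s.1 aSTAT j =P 1) => // stj1 _.
    do_put (size ws) j (xj, sp).
    do_put 0 (size ws).+1 (xj, sp, addn1).
    exists (rcons ws (Ordinal lj)); split.
    + by rewrite rcons_uniq (fr_uniq fr) (fr_ws fr) /= ltnn.
    + move=> v; rewrite mem_rcons inE (fr_ws fr) [in RHS]ltnS [in RHS]leq_eqVlt -?val_eqE /=.
      by case: (nat_of_ord v =P j) => //= ->; rewrite stj1 eqxx.
    + by rewrite size_rcons.
    + have h := @stored_rcons M ws (Ordinal lj) (size ws) (fr_stk fr) erefl.
      by move=> i li; rewrite -h.
    + move=> v /fv; rewrite /update /=; case=> [/eqP->|[lv ->]]; rewrite ?eqxx /=.
        by rewrite stj1.
      exact: fr_v fr _ lv.
    + by rewrite /update /=; exact: fr_r fr.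
    + by rewrite /update /=; exact: fr_found fr.
  case: (s.1 aSTAT j =P 1) => // stj1 _.
  exists ws; split; rewrite /update /=; try by case: fr.
  + move=> v; rewrite (fr_ws fr) [in RHS]ltnS [in RHS]leq_eqVlt -?val_eqE /=.
    by case: (nat_of_ord v =P j) => //= ->; rewrite ltnn; case: eqP stj1.
  + move=> v /fv; case=> [/eqP->|[lv ->]]; rewrite ?eqxx /=.
      by case: eqP stj1.
    exact: fr_v fr _ lv.
- rewrite /=; lia.
Qed.

(** * The search in memory *)

Section Search.
Variables (J : {set 'I_m}) (W : {set 'I_n}) (D : nat) (inc : 'I_n -> nat).
Hypothesis D_gt0 : 0 < D.
Hypothesis inc_le1 : forall v, inc v <= 1.
Local Notation sinv := (sinv ed J W D inc).

Definition parents (M : memory) (s : search) : Prop :=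
  (forall v : 'I_n, M aPAR v = if par s v is Some (u, _) then u.+1 else 0) /\
  (forall (v u : 'I_n) (e : 'I_m), par s v = Some (u, e) -> M aPE v = e).

Record rep (M : memory) (s : search) : Prop := Rep {
  rp_vis : forall v : 'I_n, M aVIS v = (v \in vis s);
  rp_par : parents M s;
  rp_dep : forall v : 'I_n, M aDEP v = dp s v;
  rp_act : forall e : 'I_m, M aACT e = (e \in act s);
  rp_todo : forall v : 'I_n, chain (M aNEXT) (M aPTR v) (todo s v);
  rp_sp : M xSP 0 = size (stk s);
  rp_stk : stored M aSTK (stk s) }.

Definition params (M : memory) : Prop :=
  [/\ base_mem M, M xD 0 = D & forall v : 'I_n, inc v = (2 < M aDEG v)].

(** A potential that drops at every step of the loop: scanning a half-edge, popping a vertex and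
    passing a root candidate all lower it, and a newly visited vertex pays for its own push. *)
Definition work (s : search) (r : nat) : nat :=
  \sum_v size (todo s v) + size (stk s) + 2 * (n - size (vis s)) + (n - r).

Record searching (M : memory) (s : search) (r : nat) : Prop := Searching {
  sg_inv : sinv s;
  sg_rep : rep M s;
  sg_found : M xFOUND 0 = 0;
  sg_r : M xR 0 = r;
  sg_rn : r <= n;
  sg_vis : forall v : 'I_n, v < r -> v \in vis s }.

(** [s] is the state before the closing edge was scanned. Only the parents are still tied to the
    memory, which is all that the climbs read of the tree. *)
Definition found (M : memory) (s : search) : Prop :=
  exists x y e, [/\ closing ed J W D inc s x y e, parents M s, M xX 0 = nat_of_ord x,
    M xY 0 = nat_of_ord y & M xE 0 = nat_of_ord e] /\ (M xFOUND 0 = 1 /\ M xSP 0 <= n).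

Lemma other_end (a : half) (x : 'I_n) : base ed a = x ->
  (ed a.1).1 + (ed a.1).2 - x = tip ed a.
Proof. by rewrite /base /tip; case: a => e [] /= <-; rewrite ?addnK // addnC addnK. Qed.

Lemma sum_upd (f : 'I_n -> seq half) x l :
  \sum_v size (upd f x l v) + size (f x) = \sum_v size (f v) + size l.
Proof.
rewrite (bigD1 x) //= [in RHS](bigD1 x) //= updE eqxx.
rewrite (eq_bigr (fun v => size (f v))); last by move=> v /negbTE nv; rewrite updE nv.
lia.
Qed.

Lemma work_arith a a' b b' p c : a' < a -> b' <= b.+1 -> p < n ->
  a' + b' + 2 * (n - p.+1) + c < a + b + 2 * (n - p) + c.
Proof. clear; lia. Qed.

Lemma scan_runs M o s r : bounded w M -> params M -> searching M s r -> stk s != [::] ->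
  runs w S scan (M, o) 130 (fun s' =>
    (exists s1, searching s'.1 s1 r /\ work s1 r < work s r) \/ found s'.1 s).
Proof.
move=> bM [[m0 m1 m2 m3 m4] mD mdeg] [inv rp fd er rn rv].
case/lastP es: (stk s) => [//|st x] _.
have xs : x \in stk s by rewrite es mem_rcons mem_head.
have [xv dxlt] := si_stkvis inv xs.
have sst : size (stk s) <= n by apply: size_ord (si_stkuniq inv).
have ssv : size (vis s) <= n by apply: size_ord (si_uniq inv).
have lst : size st < n by move: sst; rewrite es size_rcons.
have lstS : (size st).+1 < S by apply: leq_ltn_trans lst _; lia.
have lstS' := ltnW lstS.
have sp := rp_sp rp; rewrite es size_rcons in sp.
have sp1 : M xSP 0 - 1 = size st by rewrite sp subn1.
have stx : M aSTK (size st) = x.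
  by rewrite (rp_stk rp) es ?size_rcons // map_rcons nth_rcons size_map ltnn eqxx.
have lx := ltn_ord x.
have ch := rp_todo rp x.
apply: (runs_block w_ge); [exact: bM | by [] |].
do_put 0 (nat_of_ord x) (sp1, sp, stx).
case tx: (todo s x) => [|a l]; rewrite tx /= in ch.
  do_put 0 0 (sp1, sp, stx, ch).
  do_if tt; last by [].
  move=> _.
  do_put 0 (size st) (sp1, sp).
  left; exists (pop s st); split.
    split=> //=; first exact: sinv_pop inv es tx.
    case: (rp) => *; split=> //=.
    move=> i li; rewrite /update /= (rp_stk rp) ?es ?size_rcons 1?ltnW //.
    by rewrite map_rcons nth_rcons size_map li.
  by rewrite /work /= es size_rcons !ltn_add2r ltn_add2l.
case: ch => hx ch; rewrite hx in ch.
have la := ltn_ord a.1; have laS : a.1 < S by clear -la S_big; lia.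
have lxS : x < S by clear -lx S_big; lia.
have bx : base ed a = x by apply: (si_base inv); rewrite tx mem_head.
have oe := other_end bx.
have ec : (code a - 1) %/ 2 = a.1.
  by rewrite /code subn1 /= mulnC divnMDl // divn_small ?addn0 //; case: (a.2).
have lc : code a < S by rewrite /code; have := S_big; move: la; case: (a.2) => /=; clear; lia.
do_put 0 (code a) (sp1, sp, stx, hx).
do_if tt; first by [].
move=> _.
do_put (nat_of_ord x) (M aNEXT (code a)) tt.
do_put 0 (nat_of_ord a.1) ec.
have s3 := m3 a.1; have s4 := m4 a.1; have ac := rp_act rp a.1.
have lu := ltn_ord (ed a.1).1; have lv := ltn_ord (ed a.1).2.
have lsum : (ed a.1).1 + (ed a.1).2 < 2 ^ w by apply: nm_word; lia.
have chain' (M' : memory) : (forall v : 'I_n, M' aPTR v = if v == x :> nat then M aNEXT (code a) else M aPTR v) ->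
    M' aNEXT =1 M aNEXT -> forall v : 'I_n, chain (M' aNEXT) (M' aPTR v) (upd (todo s) x l v).
  move=> h1 h2 v; rewrite h1 updE -val_eqE /=; case: (nat_of_ord v =P x) => _.
    by apply: eq_chain ch => b _; rewrite h2.
  by apply: eq_chain (rp_todo rp v) => b _; rewrite h2.
have dw : \sum_v size (upd (todo s) x l v) < \sum_v size (todo s v).
  by rewrite -(leq_add2r (size l)) -(sum_upd (todo s) x l) tx /= addSn addnS ltnS leqnn.
do_if ac; last first.
  case ea: (a.1 \in act s) => // _; left; exists (skip s x l); split.
    split=> //=; first by apply: (sinv_skip inv xs tx); rewrite ea.
    case: (rp) => *; split=> //=; by apply: chain'.
  by rewrite /work /= !ltn_add2r.
case ea: (a.1 \in act s) => // _.
do_put (nat_of_ord a.1) 0 tt.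
have ltip := ltn_ord (tip ed a); have ltipS : tip ed a < S by clear -ltip S_big; lia.
have luS : a.1 < S /\ 1 < 2 ^ w by split=> //; apply: leq_trans w_ge.
do_put 0 (nat_of_ord (tip ed a)) (s3, s4, oe).
have vy := rp_vis rp (tip ed a).
do_if vy.
  case yv: (tip ed a \in vis s) => // _.
  do_put 0 1 tt.
  right; exists x, (tip ed a), a.1; split; last by split=> //; rewrite /update /= sp.
  split=> //.
    exact: closing_step inv xs tx ea yv.
  exact: rp_par rp.
case yv: (tip ed a \in vis s) => // _.
set y := tip ed a in oe ltip ltipS vy yv *.
have lDD : dp s x + inc y < 2 ^ w.
  apply: (@leq_ltn_trans D); last by rewrite -mD.
  by apply: leq_trans (leq_add (leqnn _) (inc_le1 y)) _; rewrite addn1.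
have dx := rp_dep rp x; have dgy := mdeg y.
have lDw : D < 2 ^ w by have := bM xD 0; rewrite mD.
have iy := inc_le1 y.
have lxw : x.+1 < 2 ^ w by apply: nm_word; lia.
have nxy : (x == y :> nat) = false.
  by apply/negbTE; apply: contraFneq yv => /val_inj <-.
have new : size (vis s) < n.
  have := size_ord (l := rcons (vis s) y); rewrite size_rcons rcons_uniq yv (si_uniq inv).
  by apply.
do_put (nat_of_ord y) 1 tt.
do_put (nat_of_ord y) x.+1 addn1.
do_put (nat_of_ord y) (nat_of_ord a.1) tt.
do_put (nat_of_ord y) (dp s x + inc y) (dx, dgy).
have invg := sinv_grow D_gt0 inc_le1 inv xs tx ea erefl (negbT yv).
have wk : size (stk (grow D inc s x l a.1 y)) <= (size (stk s)).+1.
  by rewrite /=; case: (_ < D); rewrite ?size_rcons ?leqnSn.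
have work' : work (grow D inc s x l a.1 y) r < work s r.
  by rewrite /work /= size_rcons; apply: work_arith.
have fin (M' : memory) : (forall v : 'I_n, M' aVIS v = if v == y :> nat then 1 else M aVIS v) ->
   (forall v : 'I_n, M' aPAR v = if v == y :> nat then x.+1 else M aPAR v) ->
   (forall v : 'I_n, M' aPE v = if v == y :> nat then nat_of_ord a.1 else M aPE v) ->
   (forall v : 'I_n, M' aDEP v = if v == y :> nat then dp s x + inc y else M aDEP v) ->
   (forall e : 'I_m, M' aACT e = if e == a.1 :> nat then 0 else M aACT e) ->
   (forall v : 'I_n, M' aPTR v = if v == x :> nat then M aNEXT (code a) else M aPTR v) ->
   M' aNEXT =1 M aNEXT ->
   M' xFOUND 0 = 0 -> M' xR 0 = r ->
   M' xSP 0 = size (stk (grow D inc s x l a.1 y)) ->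
   stored M' aSTK (stk (grow D inc s x l a.1 y)) ->
   searching M' (grow D inc s x l a.1 y) r.
  move=> h1 h2 h3 h4 h5 h6 h7 h8 h9 h10 h11; split=> //.
    split=> //.
    + by move=> v; rewrite h1 /= mem_rcons inE -val_eqE /= (rp_vis rp); case: eqP.
    + have [p1 p2] := rp_par rp; split=> v; first by rewrite h2 /= updE -val_eqE /= p1; case: eqP.
      move=> u e; rewrite h3 /= updE -val_eqE /=; case: eqP => _; first by case=> _ <-.
      exact: p2.
    + by move=> v; rewrite h4 /= updE -val_eqE /= (rp_dep rp); case: eqP.
    + by move=> e; rewrite h5 /= in_setD1 -val_eqE /= (rp_act rp); case: eqP.
    + exact: chain'.
  by move=> v /rv; rewrite /= mem_rcons inE orbC => ->.
have lsp : (size st).+2 < 2 ^ w by apply: nm_word; lia.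
do_if mD.
  move=> lt.
  have {}lt : dp s x + inc y < D by move: lt; rewrite ?eqxx /=; case: (_ < D).
  do_put (size st).+1 (nat_of_ord y) (sp).
  do_put 0 (size st).+2 (sp, addn1).
  left; exists (grow D inc s x l a.1 y); split; last exact: work'.
  apply: fin => //=.
    by rewrite lt size_rcons es size_rcons.
  rewrite lt; have h := @stored_rcons M (stk s) y (size (stk s)) (rp_stk rp) erefl.
  by move=> i li; rewrite -h // es size_rcons.
move=> lt.
have {}lt : (dp s x + inc y < D) = false by move: lt; rewrite ?eqxx /=; case: (_ < D).
left; exists (grow D inc s x l a.1 y); split; last exact: work'.
apply: fin => //=; rewrite lt; first by rewrite /update /= sp es size_rcons.
by move=> i li; rewrite /update /= (rp_stk rp).
Qed.

Lemma work_root (a b p : nat) r : p < n -> r < n ->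
  a + 1 + 2 * (n - p.+1) + (n - r.+1) < a + 0 + 2 * (n - p) + (n - r).
Proof. clear; lia. Qed.

Lemma new_root_runs M o s r : bounded w M -> params M -> searching M s r -> stk s = [::] ->
  r < n -> (forall u, u \in vis s -> ~ live ed s u) ->
  runs w S new_root (M, o) 30 (fun s' =>
    exists s1, searching s'.1 s1 r.+1 /\ work s1 r.+1 < work s r).
Proof.
move=> bM [[m0 m1 m2 m3 m4] mD mdeg] [inv rp fd er rn rv] es lr nl.
pose v := Ordinal lr.
have vr : M aVIS r = (v \in vis s) by rewrite -(rp_vis rp).
have lrS : r < S by clear -S_big lr; lia.
have lrw : r.+1 < 2 ^ w by apply: nm_word; lia.
have lS : 0 < S by clear -S_big; lia.
apply: (runs_block w_ge); [exact: bM | by [] |].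
have rv' s1 : {subset vis s <= vis s1} -> v \in vis s1 ->
    forall u : 'I_n, u < r.+1 -> u \in vis s1.
  move=> sub v1 u; rewrite ltnS leq_eqVlt => /orP[/eqP eu|/rv/sub//].
  by rewrite (_ : u = v) //; apply: val_inj.
apply/wp_seq; do_if (er, vr).
  case vv: (v \in vis s) => // _.
  do_put 0 r.+1 (er, addn1).
  exists s; split; last by rewrite /work ltn_add2l ltn_sub2l.
  split=> //; last exact: rv'.
  by case: (rp) => *; split.
case vv: (v \in vis s) => // _.
do_put r 1 er.
do_put 0 r (er, er).
do_put 0 1 er.
do_put 0 r.+1 (er, addn1).
have new : size (vis s) < n.
  have := size_ord (l := rcons (vis s) v); rewrite size_rcons rcons_uniq vv (si_uniq inv).
  by apply.
exists (plant s v); split.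
  split=> //; first exact: (sinv_root D_gt0 inv es (negbT vv) nl).
    case: (rp) => p1 p2 p3 p4 p5 p6 p7; split=> //.
    + move=> u; rewrite /update /= mem_rcons inE p1 -val_eqE /=; by case: (nat_of_ord u =P r).
    + by move=> [|//] _; rewrite /update /=.
  apply: rv' => /=; last by rewrite mem_rcons mem_head.
  by move=> u uv; rewrite mem_rcons inE uv orbT.
rewrite /work /= size_rcons es; exact: work_root.
Qed.

Lemma params_frame c s s' : frame c s s' ->
  all (fun a => a \notin writes c) [:: 0; aSRC; aDST; xD; aDEG] -> params s.1 -> params s'.1.
Proof.
move=> f h [bm eD eg]; have [f1 _] := f.
move: h => /= /and5P[n0 n1 n2 n3 /andP[n4 _]].
split; first by apply: (base_mem_frame f _ bm); rewrite /= n0 n1 n2.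
  by rewrite f1.
by move=> v; rewrite f1.
Qed.

(** That an empty stack leaves no live vertex holds for different reasons in the two phases,
    complete expansion for ears and the weight argument for cycles; hence it is a hypothesis
    here. *)
Lemma explore_runs s s0 : bounded w s.1 -> params s.1 -> searching s.1 s0 0 ->
  (forall s1, sinv s1 -> stk s1 = [::] -> forall u, u \in vis s1 -> ~ live ed s1 u) ->
  \sum_v size (todo s0 v) <= 2 * m ->
  runs w S explore s (200 * (2 * m + 4 * n + 1)) (fun s' =>
    (exists s1, found s'.1 s1) \/
    s'.1 xFOUND 0 = 0 /\ exists s1, [/\ sinv s1, stk s1 = [::] & forall v, v \in vis s1]).
Proof.
move=> bs ps sg nl td.
pose I v (s' : state) := (exists s1 r, searching s'.1 s1 r /\ work s1 r <= v) \/
   (exists s1, found s'.1 s1).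
apply: (@runs_while _ _ w_ge _ _ _ 140 (2 * m + 4 * n) _ I) => //.
- left; exists s0, 0; split=> //; rewrite /work.
  have h1 := size_ord (si_stkuniq (sg_inv sg)).
  move: td h1; set a := \sum_v _; set b := size _; clear; lia.
- move=> v [M o] bM f Iv.
  have pM := params_frame f isT ps; have [[m0 _ _ _ _] _ _] := pM; rewrite /= in m0.
  case: Iv => [[s1 [r [sg1 wk]]]|[s1 fd]]; last first.
    have [fd1 lsp] : M xFOUND 0 = 1 /\ M xSP 0 <= n by case: fd => [x [y [e []]]].
    split; last by rewrite /= fd1 mul0n /=; left; exists s1.
    have h1 : M xSP 0 + (M xR 0 < M 0 0) < 2 ^ w.
      by apply: nm_word; have := leq_b1 (M xR 0 < M 0 0); move: lsp; clear; lia.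
    by rewrite /= fd1 !mul0n; do !split => //.
  have [inv rp fd er rn rv] : searching M s1 r := sg1.
  have lst : M xSP 0 <= n by rewrite (rp_sp rp); exact: size_ord (si_stkuniq inv).
  have h1 : M xSP 0 + (M xR 0 < M 0 0) < 2 ^ w.
    by apply: nm_word; have := leq_b1 (M xR 0 < M 0 0); move: lst; clear; lia.
  split.
    rewrite /= fd !mul1n; do !split => //.
    by apply: leq_ltn_trans (leq_b1 _) _; apply: leq_trans w_ge.
  rewrite /= fd mul1n er m0.
  case esp: (M xSP 0) => [|sp] /=.
    have es : stk s1 = [::] by apply/nilP; rewrite /nilp -(rp_sp rp) esp.
    case: (ltnP r n) => lr /=; last first.
      right; split=> //; exists s1; split=> // u; apply: rv.
      exact: leq_trans (ltn_ord u) lr.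
    apply: (runs_if w_ge (T := 137)) => //=.
      by rewrite esp.
    move=> _; apply: (runs_sub _ (new_root_runs o bM pM sg1 es lr (nl _ inv es))) => //.
    move=> s' _ _ [s2 [sg2 lt]]; exists (work s2 r.+1); first exact: leq_trans lt wk.
    by left; exists s2, r.+1.
  apply: (runs_if w_ge (T := 137)) => //=.
    move=> _; have es : stk s1 != [::] by rewrite -size_eq0 -(rp_sp rp) esp.
    apply: (runs_sub _ (scan_runs o bM pM sg1 es)) => //.
    move=> s' _ _ [[s2 [sg2 lt]]|fd2].
      by exists (work s2 r); [exact: leq_trans lt wk | left; exists s2, r].
    (* The next test ends the loop, so any smaller bound will do. *)
    exists (work s1 r).-1; last by right; exists s1.
    have : 0 < work s1 r by rewrite /work -(rp_sp rp) esp addnS !addSn.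
    by move: wk; case: (work s1 r).
  by rewrite esp.
- by rewrite /=; lia.
Qed.

(** * Climbing from both ends of the closing edge *)

Definition stored_from (M : memory) (a b : nat) (l : seq nat) : Prop :=
  forall i, i < size l -> M a (b + i) = nth 0 l i.

Lemma stored_from_rcons M a b l x i : stored_from M a b l -> i = b + size l ->
  stored_from (update M a i x) a b (rcons l x).
Proof.
move=> h -> j; rewrite size_rcons ltnS => lj; rewrite /update eqxx eqn_add2l nth_rcons /=.
by case: ltngtP lj => // lj _; rewrite h.
Qed.

Lemma stored_from_cons M a b l x : stored_from M a b.+1 l ->
  stored_from (update M a b x) a b (x :: l).
Proof.
move=> h [|j] /= lj; first by rewrite addn0 /update !eqxx.
by rewrite /update eqxx /= -[X in _ == X]addn0 eqn_add2l /= addnS -addSn h.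
Qed.

Lemma eq_stored_from M M' a b l : M' a =1 M a -> stored_from M a b l -> stored_from M' a b l.
Proof. by move=> e h i li; rewrite e h. Qed.

Definition marked (M : memory) (t : seq 'I_n) : Prop :=
  forall v : 'I_n, M aMARK v = if v \in t then n + index v t else 0.

Record climbed_x (M : memory) (s : search) (x : 'I_n) (l : steps) (z : 'I_n) : Prop := ClimbedX {
  cx_chain : up_chain s l z;
  cx_head : head z (unzip1 l) = x;
  cx_top : M xTOP 0 = n + size l;
  cx_v : stored_from M aPV n [seq nat_of_ord v | v <- trace l z];
  cx_e : stored_from M aPW n [seq nat_of_ord e | e <- unzip2 l];
  cx_mark : marked M (trace l z) }.

(** A parent is visited before its children, so the visiting index bounds the number of steps left.
    The path has distinct vertices and therefore fits into the n cells from position n on. *)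
Lemma climb_x_runs s s0 x : bounded w s.1 -> base_mem s.1 -> sinv s0 -> parents s.1 s0 ->
  s.1 xX 0 = nat_of_ord x -> x \in vis s0 -> (forall v : 'I_n, s.1 aMARK v = 0) ->
  runs w S climb_x s (100 * (n + 1)) (fun s' =>
    exists l z, [/\ climbed_x s'.1 s0 x l z, z \in vis s0 & par s0 z = None]).
Proof.
case: s => M0 o0 /= b0 bm0 inv pr0 eX xv mk0.
have [m0 _ _ _ _] := bm0.
have lx := ltn_ord x; have lxS : x < S by clear -lx S_big; lia.
have svis : size (vis s0) <= n by apply: size_ord (si_uniq inv).
pose I v (s' : state) := exists l z, [/\ climbed_x s'.1 s0 x l z, z \in vis s0,
  s'.1 xCUR 0 = nat_of_ord z & index z (vis s0) <= v].
pose c1 : cmd := (xTOP ::= eN ;; xCUR ::= $xX ;;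
  aPV@[$xTOP] ::= $xCUR ;; aMARK@[$xCUR] ::= $xTOP)%prog.
pose c2 : cmd := (While (aPAR<[$xCUR]>)
    (aPW@[$xTOP] ::= aPE<[$xCUR]> ;;
     xCUR ::= aPAR<[$xCUR]> - #1 ;;
     xTOP ::= $xTOP + #1 ;;
     aPV@[$xTOP] ::= $xCUR ;;
     aMARK@[$xCUR] ::= $xTOP))%prog.
have loop s : bounded w s.1 -> parents s.1 s0 -> I n s ->
   runs w S c2 s (60 * (n + 1)) (fun s' =>
    exists l z, [/\ climbed_x s'.1 s0 x l z, z \in vis s0 & par s0 z = None]).
  move=> bs ps Is.
  apply: (runs_while w_ge (K := 50) (v := n) (I := I)) => //; last by rewrite /= addn1 mulnC leq_mul2r.
  move=> v [M o] bM f [l [z [cx zv ec iz]]].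
  have pM : parents M s0.
    have [f1 _] := f; have [p1 p2] := ps.
    split=> [u|u u' e pu]; first by have := f1 aPAR isT u => /= ->.
    by have := f1 aPE isT u => /= ->; exact: p2 pu.
  have lz := ltn_ord z; have lzS : z < S by clear -lz S_big; lia.
  rewrite /= in ec cx.
  split; first by rewrite /= ec.
  rewrite /= ec (proj1 pM); case pz: (par s0 z) => [[u e]|] /=; last first.
    by exists l, z.
  have pez := proj2 pM _ _ _ pz; have paz := proj1 pM z; rewrite pz in paz.
  have [[_ uv lt _] _] := si_par inv pz.
  case: cx => ch hd tp sv se mk.
  have ch' := up_chain_rcons ch pz.
  have tr' : trace (rcons l (z, e)) u = rcons (trace l z) u by rewrite /trace /unzip1 map_rcons.
  have un := up_chain_uniq inv ch'; rewrite tr' in un.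
  have su : (size l).+1 < n by have := size_ord un; rewrite !size_rcons size_map.
  have lu := ltn_ord u; have luS : u < S by clear -lu S_big; lia.
  have lt1 : (n + size l).+1 < S by move: su S_big; clear; lia.
  have lt1' := ltnW lt1.
  have lt2 : (n + size l).+1 < 2 ^ w by apply: nm_word; move: su; clear; lia.
  apply: (runs_block w_ge); [exact: bM | by [] |].
  do_put (n + size l) (nat_of_ord e) (tp, ec, pez).
  do_put 0 (nat_of_ord u) (ec, paz, subn1).
  do_put 0 (n + size l).+1 (tp, addn1).
  do_put (n + size l).+1 (nat_of_ord u) tp.
  do_put (nat_of_ord u) (n + size l).+1 tp.
  exists (index u (vis s0)); first exact: leq_trans lt iz.
  exists (rcons l (z, e)), u; split=> //.
  have st : size (trace l z) = (size l).+1 by rewrite size_rcons size_map.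
  split=> //.
  + by rewrite -hd; case: (l).
  + by rewrite /update /= size_rcons addnS.
  + rewrite tr' map_rcons.
    have := stored_from_rcons (x := u) (i := (n + size l).+1) sv.
    rewrite size_map st addnS => /(_ erefl); exact: eq_stored_from.
  + rewrite /unzip2 map_rcons map_rcons.
    have := stored_from_rcons (x := e) (i := n + size l) se.
    rewrite !size_map => /(_ erefl); exact: eq_stored_from.
  + move=> v'; rewrite tr' mem_rcons inE /update /= val_eqE; case: (v' =P u) => [->|/eqP nv] /=.
      move: un; rewrite rcons_uniq => /andP[nu _].
      by rewrite -cats1 index_cat (negbTE nu) /= eqxx addn0 st addnS.
    have := mk v'; rewrite /= => ->; case: ifP => // vt.
    by rewrite -cats1 index_cat vt.
have b1 : runs w S c1 (M0, o0) 20 (fun s' => parents s'.1 s0 /\ I n s').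
  apply: (runs_block w_ge); [exact: b0 | by [] |].
  do_put 0 n m0.
  do_put 0 (nat_of_ord x) eX.
  do_put n (nat_of_ord x) eX.
  do_put (nat_of_ord x) n eX.
  split=> //.
  exists [::], x; split=> //; last by apply: leq_trans svis; rewrite ltnW // index_mem.
  split=> //=.
  + by rewrite /update /= addn0.
  + by move=> [|//] _; rewrite /update /= addn0 eqxx.
  + by move=> v; rewrite /update /= inE val_eqE; case: (v =P x) => [->|_]; rewrite ?eqxx ?addn0 ?mk0.
apply: (runs_seq (s := (M0, o0)) (T2 := 60 * (n + 1)) b0 b1) => [|s' b' _ [p' I']]; last exact: loop.
by clear; lia.
Qed.

Record walk_mem (M : memory) (c : steps) (z : 'I_n) : Prop := WalkMem {
  wm_hi : M xLO 0 + size c = M xHI 0;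
  wm_bound : M xHI 0 < 2 * n;
  wm_v : stored_from M aPV (M xLO 0) [seq nat_of_ord v | v <- trace c z];
  wm_e : stored_from M aPW (M xLO 0) [seq nat_of_ord e | e <- unzip2 c] }.

Definition good_walk (s : search) (c : steps) (z : 'I_n) : Prop :=
  [/\ simple_walk ed c z, {subset unzip2 c <= J},
      (forall v, v \in behead (unzip1 c) -> v \in vis s /\ par s v != None),
      z = head z (unzip1 c) \/ [/\ z != head z (unzip1 c), z \in W & head z (unzip1 c) \in W] &
      \sum_(v <- unzip1 c) inc v <= inc (head z (unzip1 c)) + (D + D)].

Record climbing_y (M : memory) (s : search) (y : 'I_n) (e : 'I_m) (lx : steps) (zx : 'I_n)
    (ly : steps) (zy : 'I_n) : Prop := ClimbingY {
  cy_chain : up_chain s ly zy;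
  cy_head : head zy (unzip1 ly) = y;
  cy_vis : zy \in vis s;
  cy_lo : M xLO 0 + (size ly).+1 = n;
  cy_v : stored_from M aPV (M xLO 0)
    [seq nat_of_ord v | v <- (zy :: rev (unzip1 ly)) ++ trace lx zx];
  cy_e : stored_from M aPW (M xLO 0)
    [seq nat_of_ord e | e <- rcons (rev (unzip2 ly)) e ++ unzip2 lx];
  cy_dis : forall v, v \in unzip1 ly -> v \notin trace lx zx }.

Lemma stored_from_prefix M a b l l' : stored_from M a b (l ++ l') -> stored_from M a b l.
Proof. by move=> h i li; rewrite h ?nth_cat ?li // size_cat ltn_addr. Qed.

(** The memory holds the whole path from [x] to its root; setting [xHI] cuts it at position [i], so
    the walk is a prefix of what is stored. *)
Lemma walk_mem_final M s x y e lx zx ly zy i : closing ed J W D inc s x y e ->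
  up_chain s lx zx -> head zx (unzip1 lx) = x -> par s zx = None -> zx \in vis s ->
  climbing_y M s y e lx zx ly zy ->
  (if zy \in trace lx zx then i = index zy (trace lx zx) else
     i = size lx /\ par s zy = None) -> M xHI 0 = n + i ->
  exists c z, walk_mem M c z /\ good_walk s c z.
Proof.
move=> cl ux hx px zxv [uy hy zyv lo sv se dis] hi ehi.
have inv := cl_inv cl.
have := @closing_walk _ _ ed J W D inc s inv x y e lx zx ly zy i cl ux hx px uy hy dis hi zxv zyv
  (si_dpD inv (cl_x cl)) (si_dpD inv (cl_y cl)).
set c := _ ++ _; set z := nth _ _ _ => -[sw sub [hd inner] ends cnt].
exists c, z; split; last first.
  by split=> //; rewrite hd.
have i_le : i <= size lx.
  move: hi; case: ifP => [zin ->|_ [->]//]; rewrite -ltnS.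
  by rewrite -(size_map fst lx) -(size_rcons _ zx) index_mem.
have sc : size c = (size ly).+1 + i.
  by rewrite /c size_cat size_takel // -(size_map fst (down_walk ly zy e)) -/(unzip1 _) down_walk1 /= size_rev size_map.
have lxn : size lx < n.
  by have := size_ord (up_chain_uniq inv ux); rewrite size_rcons size_map.
have c1 : trace c z = (zy :: rev (unzip1 ly)) ++ take i.+1 (trace lx zx).
  rewrite {1}/trace /c /unzip1 map_cat map_take -/(unzip1 (down_walk ly zy e)) down_walk1 rcons_cat.
  rewrite [in RHS](take_nth zx) ?size_rcons ?size_map ?ltnS //.
  by congr (_ ++ rcons _ _); rewrite /trace -cats1 takel_cat ?size_map.
have c2 : unzip2 c = rcons (rev (unzip2 ly)) e ++ take i (unzip2 lx).
  by rewrite /c /unzip2 map_cat map_take -/(unzip2 (down_walk ly zy e)) down_walk2.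
split.
- by rewrite sc ehi addnA lo.
- by rewrite ehi mul2n -addnn ltn_add2l (leq_ltn_trans i_le).
- rewrite c1; apply: (@stored_from_prefix _ _ _ _ [seq nat_of_ord v | v <- drop i.+1 (trace lx zx)]).
  by rewrite -map_cat -catA cat_take_drop.
- rewrite c2; apply: (@stored_from_prefix _ _ _ _ [seq nat_of_ord v | v <- drop i (unzip2 lx)]).
  by rewrite -map_cat -catA cat_take_drop.
Qed.

(** Writing to the left puts the path from [y], already reversed, directly in front of the path from
    [x], with the closing edge stored at position n - 1. *)
Lemma climb_y_runs s s0 x y e lx zx : bounded w s.1 -> base_mem s.1 ->
  closing ed J W D inc s0 x y e -> parents s.1 s0 ->
  s.1 xY 0 = nat_of_ord y -> s.1 xE 0 = nat_of_ord e ->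
  climbed_x s.1 s0 x lx zx -> zx \in vis s0 -> par s0 zx = None ->
  runs w S climb_y s (200 * (n + 1)) (fun s' =>
    exists c z, walk_mem s'.1 c z /\ good_walk s0 c z).
Proof.
case: s => M0 o0 /= b0 bm0 cl pr0 eY eE cx0 zxv pzx.
have [m0 _ _ _ _] := bm0; have inv := cl_inv cl.
have ly := ltn_ord y; have lyS : y < S by clear -ly S_big; lia.
have le := ltn_ord e.
have ln1S : n.-1 < S by clear -S_big; lia.
have svis : size (vis s0) <= n by apply: size_ord (si_uniq inv).
pose I v (s' : state) := exists l z, [/\ climbing_y s'.1 s0 y e lx zx l z,
  s'.1 xCUR 0 = nat_of_ord z & index z (vis s0) <= v].
pose c1 : cmd := (xLO ::= eN - #1 ;; xCUR ::= $xY ;;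
  aPV@[$xLO] ::= $xCUR ;; aPW@[$xLO] ::= $xE)%prog.
pose c2 : cmd := (While ((aMARK<[$xCUR]> =? #0) * (#0 <? aPAR<[$xCUR]>))
    (xLO ::= $xLO - #1 ;;
     aPW@[$xLO] ::= aPE<[$xCUR]> ;;
     xCUR ::= aPAR<[$xCUR]> - #1 ;;
     aPV@[$xLO] ::= $xCUR))%prog.
pose c3 : cmd := (If (aMARK<[$xCUR]>) (xHI ::= aMARK<[$xCUR]>) (xHI ::= $xTOP))%prog.
pose ok (M : memory) := [/\ parents M s0, marked M (trace lx zx) & M xTOP 0 = n + size lx].
have b1 : runs w S c1 (M0, o0) 20 (fun s' => I n s').
  apply: (runs_block w_ge); [exact: b0 | by [] |].
  do_put 0 n.-1 (m0, subn1).
  do_put 0 (nat_of_ord y) eY.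
  do_put n.-1 (nat_of_ord y) eY.
  do_put n.-1 (nat_of_ord e) eE.
  exists [::], y; split=> //; last by apply: leq_trans svis; rewrite ltnW // index_mem (cl_y cl).
  split=> //=; [exact: cl_y cl | by rewrite /update /= addn1 prednK | |].
  + have h : stored_from M0 aPV n.-1.+1 [seq nat_of_ord v | v <- trace lx zx].
      by rewrite prednK //; exact: cx_v cx0.
    by have := stored_from_cons (x := y) h; exact: eq_stored_from.
  + have h : stored_from M0 aPW n.-1.+1 [seq nat_of_ord v | v <- unzip2 lx].
      by rewrite prednK //; exact: cx_e cx0.
    by have := stored_from_cons (x := e) h; exact: eq_stored_from.
have loop s : bounded w s.1 -> ok s.1 -> I n s ->
   runs w S c2 s (70 * (n + 1)) (fun s' => exists l z, [/\ climbing_y s'.1 s0 y e lx zx l z,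
      s'.1 xCUR 0 = nat_of_ord z & z \in trace lx zx \/ par s0 z = None]).
  move=> bs oks Is.
  apply: (runs_while w_ge (K := 50) (v := n) (I := I)) => //; last by rewrite /=; clear; lia.
  move=> v [M o] bM f [l [z [cy ec iz]]].
  have [pM mk tp] : ok M.
    have [f1 _] := f; case: oks => [[p1 p2] mk tp]; split.
    - split=> [u|u u' e' pu]; first by have := f1 aPAR isT u => /= ->.
      by have := f1 aPE isT u => /= ->; exact: p2 pu.
    - by move=> u; have := f1 aMARK isT u => /= ->.
    - by have := f1 xTOP isT 0 => /= ->.
  have lz := ltn_ord z; have lzS : z < S by clear -lz S_big; lia.
  rewrite /= in ec cy.
  split.
    rewrite /= ec (mk z); do !split => //.
    by apply: leq_ltn_trans lw1; case: (_ == 0); rewrite ?mul0n // mul1n leq_b1.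
  have mkz : (M aMARK z == 0) = (z \notin trace lx zx).
    rewrite (mk z); case: ifP => //= _.
    by apply/negbTE; rewrite -lt0n ltn_addr.
  rewrite /= ec mkz (proj1 pM).
  case zt: (z \in trace lx zx); first by rewrite mul0n /=; exists l, z; split=> //; left.
  case pz: (par s0 z) => [[u e']|] /=; last by exists l, z; split=> //; right.
  have pez := proj2 pM _ _ _ pz; have paz := proj1 pM z; rewrite pz in paz.
  have [[_ uv lt _] _] := si_par inv pz.
  case: cy => ch hd zv lo sv se dis.
  have ch' := up_chain_rcons ch pz.
  have su : (size l).+1 < n.
    by have := size_ord (up_chain_uniq inv ch'); rewrite size_rcons size_map size_rcons.
  have lu := ltn_ord u; have luS : u < S by clear -lu S_big; lia.
  have llo : M xLO 0 < S by move: lo S_big; clear; lia.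
  have plo : 0 < M xLO 0 by move: lo su; clear; lia.
  have llo' : (M xLO 0).-1 < S by apply: leq_ltn_trans llo; exact: leq_pred.
  apply: (runs_block w_ge); [exact: bM | by [] |].
  do_put 0 (M xLO 0).-1 subn1.
  do_put (M xLO 0).-1 (nat_of_ord e') (ec, pez).
  do_put 0 (nat_of_ord u) (ec, paz, subn1).
  do_put (M xLO 0).-1 (nat_of_ord u) ec.
  exists (index u (vis s0)); first exact: leq_trans lt iz.
  exists (rcons l (z, e')), u; split=> //.
  split=> //.
  + by rewrite -hd; case: (l).
  + by rewrite /update /= size_rcons addnS -addSn prednK.
  + rewrite /unzip1 map_rcons rev_rcons /=.
    have h : stored_from M aPV (M xLO 0).-1.+1
        [seq nat_of_ord v | v <- (z :: rev (unzip1 l)) ++ trace lx zx] by rewrite prednK.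
    by have := stored_from_cons (x := u) h; exact: eq_stored_from.
  + rewrite /unzip2 map_rcons rev_rcons /=.
    have h : stored_from M aPW (M xLO 0).-1.+1
        [seq nat_of_ord v | v <- rcons (rev (unzip2 l)) e ++ unzip2 lx] by rewrite prednK.
    by have := stored_from_cons (x := e') h; exact: eq_stored_from.
  + move=> v'; rewrite /unzip1 map_rcons mem_rcons inE => /orP[/eqP->|/dis//].
    by rewrite zt.
have ok_frame c s s' : frame c s s' ->
   all (fun a => a \notin writes c) [:: aPAR; aPE; aMARK; xTOP] -> ok s.1 -> ok s'.1.
  move=> [f1 _] /= /and5P[n1 n2 n3 n4 _] [[p1 p2] mk tp]; split.
  - by split=> [u|u u' e' pu]; rewrite f1 //; exact: p2 pu.
  - by move=> u; rewrite f1.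
  - by rewrite f1.
have ok0 : ok M0 by split=> //; [exact: cx_mark cx0 | exact: cx_top cx0].
apply: (runs_seq (s := (M0, o0)) (T2 := 80 * (n + 1) + 50) b0 b1) => [|s1 bb1 f1 I1].
  by clear; lia.
have ok1 := ok_frame _ _ _ f1 isT ok0.
apply: (runs_seq (T2 := 50) bb1 (loop s1 bb1 ok1 I1)) => [|s2 bb2 f2].
  by clear; lia.
move=> [l [z [cy ec fin]]]; have := ok_frame _ _ _ f2 isT ok1.
case: s2 bb2 cy ec {f2} => M o bM /= cy ec [pM mk tp].
have lz := ltn_ord z; have lzS : z < S by clear -lz S_big; lia.
apply: (runs_block w_ge); [exact: bM | by [] |].
have final i (M' : memory) : M' xHI 0 = n + i -> (forall a, a != xHI -> M' a =1 M a) ->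
   (if z \in trace lx zx then i = index z (trace lx zx) else
     i = size lx /\ par s0 z = None) ->
   exists c z, walk_mem M' c z /\ good_walk s0 c z.
  move=> hM' eM' hi.
  apply: (walk_mem_final (ly := l) cl (cx_chain cx0) (cx_head cx0) pzx zxv _ hi hM').
  case: cy => q1 q2 q3 q4 q5 q6 q7; split; rewrite ?(eM' xLO isT) //.
    exact: (eq_stored_from (eM' aPV isT) q5).
  exact: (eq_stored_from (eM' aPW isT) q6).
have mkz := mk z.
do_if ec; rewrite mkz.
  case: ifP => zt // _.
  do_put 0 (n + index z (trace lx zx)) (ec, mkz, zt).
  apply: (final (index z (trace lx zx))) => [//||]; last by rewrite zt.
  by move=> a na j; rewrite /= /update (negbTE na).
case: ifP => zt; first by move=> /eqP; rewrite addn_eq0 eqn0Ngt n_pos.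
move=> _; do_put 0 (n + size lx) tp.
apply: (final (size lx)) => [//||].
  by move=> a na j; rewrite /= /update (negbTE na).
by rewrite zt; case: fin => //; rewrite zt.
Qed.

End Search.

(** * Edge sets, statuses and degree counts in memory *)

Definition edge_set (M : memory) (a : nat) (A : {set 'I_m}) : Prop :=
  forall e : 'I_m, M a e = (e \in A).

Definition status (M : memory) (st : 'I_n -> nat) : Prop := forall v : 'I_n, M aSTAT v = st v.

Definition fresh_edges (st : 'I_n -> nat) (H : {set 'I_m}) : {set 'I_m} :=
  [set e | [&& e \notin H, st (ed e).1 < 2 & st (ed e).2 < 2]].

Lemma ord_S (v : 'I_n) : v < S.
Proof. exact: ltn_trans (ltn_ord v) lnS. Qed.

Lemma ord_mS (e : 'I_m) : e < S.
Proof. exact: ltn_trans (ltn_ord e) lmS. Qed.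

Lemma edge_loop_bound s c : base_mem s.1 -> all (fun a => a \notin writes (for_loop xI eM c)) [:: 0; aSRC; aDST] ->
  forall s', frame (for_loop xI eM c) s s' -> safe w S s'.1 eM /\ den s'.1 eM = m.
Proof.
move=> bm h s' f; have [_ m1 _ _ _] := base_mem_frame f h bm.
rewrite /= m1; do !split => //; clear -S_big; lia.
Qed.

Lemma vertex_loop_bound s c : base_mem s.1 -> all (fun a => a \notin writes (for_loop xI eN c)) [:: 0; aSRC; aDST] ->
  forall s', frame (for_loop xI eN c) s s' -> safe w S s'.1 eN /\ den s'.1 eN = n.
Proof.
move=> bm h s' f; have [m0 _ _ _ _] := base_mem_frame f h bm.
rewrite /= m0; do !split => //; clear -S_big; lia.
Qed.

Lemma m_word : m < 2 ^ w.
Proof. by apply: nm_word; clear; lia. Qed.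

Lemma n_word : n < 2 ^ w.
Proof. by apply: nm_word; clear; lia. Qed.

Lemma select_new_runs s st H : bounded w s.1 -> base_mem s.1 -> status s.1 st ->
  edge_set s.1 aINH H ->
  runs w S select_new s (100 * (m + 1)) (fun s' => edge_set s'.1 aACT (fresh_edges st H)).
Proof.
move=> bs bm hst hH.
apply: (@runs_for _ _ w_ge lS0 _ _ _ _ m 60 _ (fun j s' => forall e : 'I_m, e < j ->
  s'.1 aACT e = (e \in fresh_edges st H))) => //.
- exact: edge_loop_bound.
- exact: m_word.
- move=> j [M o] lj bM f xj IH.
  have bmM := base_mem_frame f isT bm; have [m0 m1 m2 m3 m4] := bmM.
  pose e := Ordinal lj; have s3 := m3 e; have s4 := m4 e; rewrite /= in s3 s4 xj.
  have [f1 _] := f.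
  have t1 : M aSTAT (ed e).1 = st (ed e).1 by have := f1 aSTAT isT (ed e).1 => /= ->; rewrite hst.
  have t2 : M aSTAT (ed e).2 = st (ed e).2 by have := f1 aSTAT isT (ed e).2 => /= ->; rewrite hst.
  have t0 : M aINH j = (e \in H) by have := f1 aINH isT j => /= ->; rewrite -(hH e).
  have l1 := ord_S (ed e).1; have l2 := ord_S (ed e).2; have le := ord_mS e; rewrite /= in le.
  have bb (b1 b2 b3 : bool) : b1 * (b2 * b3) < 2 ^ w by apply: leq_ltn_trans lw1; case: b1 b2 b3 => [] [] [].
  have bb2 (b1 b2 : bool) : b1 * b2 < 2 ^ w by apply: leq_ltn_trans lw1; case: b1 b2 => [] [].
  apply: (runs_block w_ge); [exact: bM | by [] |].
  do_put j ((e \notin H) * ((st (ed e).1 < 2) * (st (ed e).2 < 2))) (xj, t0, s3, s4, t1, t2, eqb0).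
  have -> : (e \notin H) * ((st (ed e).1 < 2) * (st (ed e).2 < 2)) = (e \in fresh_edges st H).
    by rewrite inE !mulnb.
  move=> e'; rewrite ltnS leq_eqVlt /update /= => /orP[/eqP ee|lt].
    by rewrite ee eqxx (_ : e' = e) //; apply: val_inj.
  by rewrite (ltn_eqF lt); exact: IH.
- by move=> s' _ _ h e; apply: h.
- by rewrite /=; clear; lia.
Qed.

Lemma copy_edges_runs s A : bounded w s.1 -> base_mem s.1 -> edge_set s.1 aINH A ->
  runs w S copy_edges s (100 * (m + 1)) (fun s' => edge_set s'.1 aACT A).
Proof.
move=> bs bm hA.
apply: (@runs_for _ _ w_ge lS0 _ _ _ _ m 20 _ (fun j s' => forall e : 'I_m, e < j ->
  s'.1 aACT e = (e \in A))) => //.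
- exact: edge_loop_bound.
- exact: m_word.
- move=> j [M o] lj bM f xj IH; rewrite /= in xj.
  pose e := Ordinal lj; have [f1 _] := f.
  have t0 : M aINH j = (e \in A) by have := f1 aINH isT j => /= ->; rewrite -(hA e).
  have le := ord_mS e; rewrite /= in le.
  apply: (runs_block w_ge); [exact: bM | by [] |].
  do_put j (nat_of_bool (e \in A)) (xj, t0).
  move=> e'; rewrite ltnS leq_eqVlt /update /= => /orP[/eqP ee|lt].
    by rewrite ee eqxx (_ : e' = e) //; apply: val_inj.
  by rewrite (ltn_eqF lt); exact: IH.
- by move=> s' _ _ h e; apply: h.
- by rewrite /=; clear; lia.
Qed.

Lemma clear_status_runs s : bounded w s.1 -> base_mem s.1 ->
  runs w S clear_status s (100 * (n + 1)) (fun s' => status s'.1 (fun=> 0)).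
Proof.
move=> bs bm.
apply: (@runs_for _ _ w_ge lS0 _ _ _ _ n 20 _ (fun j s' => forall v : 'I_n, v < j ->
  s'.1 aSTAT v = 0)) => //.
- exact: vertex_loop_bound.
- exact: n_word.
- move=> j [M o] lj bM f xj IH; rewrite /= in xj.
  have le := ord_S (Ordinal lj); rewrite /= in le.
  apply: (runs_block w_ge); [exact: bM | by [] |].
  do_put j 0 xj.
  move=> v; rewrite ltnS leq_eqVlt /update /= => /orP[/eqP ->|lt]; first by rewrite eqxx.
  by rewrite (ltn_eqF lt); exact: IH.
- by move=> s' _ _ h v; apply: h.
- by rewrite /=; clear; lia.
Qed.

Definition edge_sum (A : {set 'I_m}) (v : 'I_n) : nat := \sum_(e in A) ends_at e v * e.

Lemma deg_le A v : deg A v <= 2 * m.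
Proof.
apply: (@leq_trans (\sum_(e < m) 2)); last by rewrite sum_nat_const card_ord mulnC.
rewrite degE big_mkcond /=; apply: leq_sum => e _; case: ifP => // _.
by rewrite !ends_atE; do 2 case: (_ == v).
Qed.

Lemma edge_sum_le A v : edge_sum A v <= 2 * m * m.
Proof.
apply: (@leq_trans (\sum_(e < m) 2 * m)); last by rewrite sum_nat_const card_ord mulnC.
rewrite /edge_sum big_mkcond /=; apply: leq_sum => e _; case: ifP => // _.
apply: leq_mul; last by rewrite ltnW.
by rewrite !ends_atE; do 2 case: (_ == v).
Qed.

(** Nothing is said of the sum at degree 0, since trimming leaves a stale value at the leaf that it
    cuts. *)
Record counted (M : memory) (A : {set 'I_m}) : Prop := Counted {
  ct_deg : forall v : 'I_n, M aDEG v = deg A v;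
  ct_sum : forall v : 'I_n, deg A v != 0 -> M aSUM v = edge_sum A v }.

Lemma delete_dead_runs s st A : bounded w s.1 -> base_mem s.1 -> status s.1 st ->
  edge_set s.1 aINH A -> (forall v : 'I_n, s.1 aDEG v = 0 /\ s.1 aSUM v = 0) ->
  let A' := avoid ed A [set v | 1 < st v] in
  runs w S delete_dead s (200 * (m + 1)) (fun s' => edge_set s'.1 aINH A' /\ counted s'.1 A').
Proof.
move=> bs bm hst hA h0 A'.
pose part j := [set e in A' | e < j].
have partE e j : (e \in part j) = (e \in A') && (e < j) by rewrite inE.
apply: (@runs_for _ _ w_ge lS0 _ _ _ _ m 120 _ (fun j s' =>
  (forall e : 'I_m, s'.1 aINH e = if e < j then e \in A' else e \in A) /\
  (forall v : 'I_n, s'.1 aDEG v = deg (part j) v /\ s'.1 aSUM v = edge_sum (part j) v))) => //.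
- exact: edge_loop_bound.
- exact: m_word.
- split=> // v; rewrite (_ : part 0 = set0); last by apply/setP=> e; rewrite !inE andbF.
  by rewrite deg0 /edge_sum big_set0; exact: h0.
- move=> j [M o] lj bM f xj [IH1 IH2].
  have bmM := base_mem_frame f isT bm; have [m0 m1 m2 m3 m4] := bmM.
  pose e := Ordinal lj; have s3 := m3 e; have s4 := m4 e; rewrite /= in s3 s4 xj IH1 IH2.
  have [f1 _] := f.
  have t1 : M aSTAT (ed e).1 = st (ed e).1 by have := f1 aSTAT isT (ed e).1 => /= ->; rewrite hst.
  have t2 : M aSTAT (ed e).2 = st (ed e).2 by have := f1 aSTAT isT (ed e).2 => /= ->; rewrite hst.
  have t0 : M aINH j = (e \in A) by have := IH1 e; rewrite /= ltnn.
  have l1 := ord_S (ed e).1; have l2 := ord_S (ed e).2; have le := ord_mS e; rewrite /= in le.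
  have bb (b1 b2 b3 : bool) : b1 * (b2 * b3) < 2 ^ w by apply: leq_ltn_trans lw1; case: b1 b2 b3 => [] [] [].
  have bb2 (b1 b2 : bool) : b1 * b2 < 2 ^ w by apply: leq_ltn_trans lw1; case: b1 b2 => [] [].
  pose b := e \in A'.
  have bE : (e \in A) * ((st (ed e).1 < 2) * (st (ed e).2 < 2)) = b.
    by rewrite /b !inE !mulnb -!leqNgt.
  have [d1 q1] := IH2 (ed e).1; have [d2 q2] := IH2 (ed e).2.
  have d1b := deg_le (part j) (ed e).1; have d2b := deg_le (part j) (ed e).2.
  have q1b := edge_sum_le (part j) (ed e).1; have q2b := edge_sum_le (part j) (ed e).2.
  have lwj (q : nat) (c : bool) : q <= 2 * m * m -> q + c * j + b * j < 2 ^ w.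
    move=> lq; apply: leq_ltn_trans (word_nm room).
    apply: (@leq_trans (2 * m * m + m + m)); last by clear; nia.
    by rewrite leq_add ?leq_add ?(leq_trans lq) //; case: (c) (b) => [] []; rewrite ?mul1n // ltnW.
  have lwd (d : nat) (c : bool) : d <= 2 * m -> d + c + b < 2 ^ w.
    move=> ld; apply: nm_word; have := leq_b1 b; have := leq_b1 c; move: ld; clear; lia.
  have ljw : b * j < 2 ^ w by have := lwj 0 false isT; rewrite mul0n.
  have x1 : deg (part j) (ed e).1 + b < 2 ^ w by have := lwd _ false d1b; rewrite addn0.
  have x2 : edge_sum (part j) (ed e).1 + b * j < 2 ^ w by have := lwj _ false q1b; rewrite mul0n addn0.
  (* For a self-loop both updates hit the same cell, so the second reads the result of the first;
     [c] accounts for this. *)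
  pose c := (ed e).2 == (ed e).1.
  have x3 : deg (part j) (ed e).2 + c * b + b < 2 ^ w.
    by have := lwd _ (c && b) d2b; rewrite mulnb.
  have x4 : edge_sum (part j) (ed e).2 + c * b * j + b * j < 2 ^ w.
    by have := lwj _ (c && b) q2b; rewrite mulnb.
  apply: (runs_block w_ge); [exact: bM | by [] |].
  do_put j (nat_of_bool b) (xj, t0, s3, s4, t1, t2, bE).
  do_put (nat_of_ord (ed e).1) (deg (part j) (ed e).1 + b) (xj, s3, d1).
  do_put (nat_of_ord (ed e).1) (edge_sum (part j) (ed e).1 + b * j) (xj, s3, q1).
  have r3 : (if (ed e).2 == (ed e).1 :> nat then deg (part j) (ed e).1 + b else M aDEG (ed e).2)
      = deg (part j) (ed e).2 + c * b.
    by rewrite val_eqE /c; case: eqP => [->|_]; rewrite ?mul1n // d2 mul0n addn0.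
  have r4 : (if (ed e).2 == (ed e).1 :> nat then edge_sum (part j) (ed e).1 + b * j else M aSUM (ed e).2)
      = edge_sum (part j) (ed e).2 + c * b * j.
    by rewrite val_eqE /c; case: eqP => [->|_]; rewrite ?mul1n // q2 !mul0n addn0.
  do_put (nat_of_ord (ed e).2) (deg (part j) (ed e).2 + c * b + b) (xj, s4, r3).
  do_put (nat_of_ord (ed e).2) (edge_sum (part j) (ed e).2 + c * b * j + b * j) (xj, s4, r4).
  have partS (g : 'I_m -> nat) : \sum_(i in part j.+1) g i = \sum_(i in part j) g i + b * g e.
    rewrite /b; case eA: (e \in A').
      rewrite (big_setD1 e) /=; last by rewrite partE eA ltnSn.
      rewrite mul1n addnC; congr (_ + _); apply: eq_bigl => i; rewrite in_setD1 !partE ltnS [_ <= j]leq_eqVlt -val_eqE /=.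
      by case: (nat_of_ord i =P j) => [->|_]; rewrite ?ltnn ?andbF.
    rewrite mul0n addn0; apply: eq_bigl => i; rewrite !partE ltnS leq_eqVlt.
    by case: (nat_of_ord i =P j) => [ij|//]; rewrite (_ : i = e) ?eA //; apply: val_inj.
  split=> [i|v].
    rewrite /update /= ltnS leq_eqVlt; case: (nat_of_ord i =P j) => [ij|_] /=; last exact: IH1.
    by rewrite (_ : i = e) //; apply: val_inj.
  have hd : deg (part j.+1) v = deg (part j) v + b * ends_at e v := partS _.
  have hs : edge_sum (part j.+1) v = edge_sum (part j) v + b * (ends_at e v * j) := partS _.
  rewrite hd hs !ends_atE /update /= !val_eqE.
  have [dv qv] := IH2 v.
  have cs : c = ((ed e).1 == (ed e).2) by rewrite /c eq_sym.
  case: (v =P (ed e).2) => [->|/eqP n2].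
    rewrite eqxx cs; move: (deg (part j) _) (edge_sum (part j) _) (_ == _) (b); clear => u1 u2 [] [];
    by rewrite ?mul0n ?mul1n; lia.
  rewrite [(ed e).2 == v]eq_sym (negbTE n2) addn0; case: (v =P (ed e).1) => [->|/eqP n1].
    by rewrite eqxx mul1n muln1.
  by rewrite [(ed e).1 == v]eq_sym (negbTE n1) dv qv mul0n muln0 !addn0.
- move=> s' _ _ [h1 h2]; have pm : part m = A'.
    by apply/setP=> e; rewrite inE ltn_ord andbT.
  split; first by move=> e; rewrite h1 ltn_ord.
  by split=> v; have [] := h2 v; rewrite pm.
- by rewrite /=; clear; lia.
Qed.

(** * Trimming leaves *)

Lemma deg1_edge (A : {set 'I_m}) x : deg A x = 1 ->
  exists e, [/\ e \in A, ends_at e x = 1 & edge_sum A x = e].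
Proof.
move=> d1; have: exists2 e, e \in A & 0 < ends_at e x.
  case: (pickP [pred e in A | 0 < ends_at e x]) => [e /andP[]|no]; first by exists e.
  move: d1; rewrite degE big1 // => e eA; have := no e; rewrite /= eA /=.
  by case: (ends_at e x).
move=> [e eA le]; exists e; have := degD1 ed x eA; rewrite d1 => hd.
have e1 : ends_at e x = 1 by move: le hd; clear; lia.
split=> //; rewrite /edge_sum (big_setD1 e) //= e1 mul1n big1 ?addn0 // => e' e'A.
have /eqP : deg (A :\ e) x = 0 by move: hd; rewrite e1 add1n => -[<-].
rewrite degE sum_nat_eq0 => /forall_inP/(_ _ e'A)/eqP ->; exact: mul0n.
Qed.

Definition trims_to (A A1 : {set 'I_m}) : Prop :=
  A1 \subset A /\ forall p, excess A p -> excess A1 p.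

Record trimming (M : memory) (A A1 : {set 'I_m}) : Prop := Trimming {
  tm_inh : edge_set M aINH A1;
  tm_count : counted M A1;
  tm_to : trims_to A A1 }.

(** Cutting a leaf can turn only its neighbour into a leaf, and that one is treated next. Thus [xx]
    is the only possible leaf up to the sweep position [vv]. Each iteration advances the sweep or
    removes an edge, which gives the measure. *)
Lemma trim_runs s A : bounded w s.1 -> base_mem s.1 -> edge_set s.1 aINH A -> counted s.1 A ->
  runs w S trim s (200 * (n + m + 1)) (fun s' => exists A1, trimming s'.1 A A1 /\
    (forall v, deg A1 v != 1)).
Proof.
case: s => M0 o0 /= b0 bm0 hA hc.
pose I q (s' : state) := exists A1 vv xx,
  [/\ trimming s'.1 A A1, s'.1 xV 0 = vv, s'.1 xX 0 = xx,
      (vv < n /\ xx < n) \/ (vv = n /\ xx = n) &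
      (forall u : 'I_n, u <= vv -> u != xx :> nat -> deg A1 u != 1) /\ n - vv + #|A1| <= q].
have pre : runs w S (xV ::= #0 ;; xX ::= #0)%prog (M0, o0) 10 (fun s' => I (n + m) s').
  apply: (runs_block w_ge); [exact: b0 | by [] |].
  do_put 0 0 lw0.
  do_put 0 0 lw0.
  exists A, 0, 0; split=> //; last 2 first.
  - by left.
  - split; first by move=> u; rewrite leqn0 => ->.
    by rewrite subn0 leq_add2l -[X in _ <= X]card_ord max_card.
  split=> //; case: hc => *; by split.
apply: (runs_seq (s := (M0, o0)) (T2 := 150 * (n + m + 1)) b0 pre) => [|s1 b1 f1 I1].
  by clear; lia.
have bm1 := base_mem_frame f1 isT bm0.
apply: (runs_while w_ge (K := 80) (v := n + m) (I := I)) => //; last by rewrite /=; clear; lia.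
move=> q [M o] bM f [A1 [vv [xx [tm ev ex vx [hu hq]]]]].
have bmM := base_mem_frame f isT bm1; have [m0 m1 m2 m3 m4] := bmM.
rewrite /= in ev ex m0 m3 m4.
split; first by rewrite /=; do !split.
rewrite /= ev m0; case: ltnP => lv /=; last first.
  case: vx => [[h _]|[vn xn]]; first by rewrite ltnNge lv in h.
  by exists A1; split=> // v; apply: hu; rewrite ?vn ?xn ?(ltn_eqF (ltn_ord v)) // ltnW.
have lx : xx < n by case: vx => [[]//|[vn _]]; move: lv; rewrite vn ltnn.
pose x := Ordinal lx; have lxS := ord_S x; rewrite /= in lxS.
have lv1 : vv.+1 < 2 ^ w by apply: nm_word; move: lv; clear; lia.
case: tm => hI [cd cs] [sub tr].
have dx : M aDEG xx = deg A1 x by have := cd x.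
have lxS' : xx < S by [].
apply: (runs_block w_ge); [exact: bM | by [] |].
do_if (ex, dx); last first.
  case: (deg A1 x =P 1) => // /eqP d1 _.
  do_put 0 vv.+1 (ev, addn1).
  do_put 0 vv.+1 ev.
  exists (n - vv.+1 + #|A1|).
    apply: leq_trans hq; rewrite ltn_add2r; move: lv; clear; lia.
  exists A1, vv.+1, vv.+1; split=> //.
    by move: lv; clear; lia.
  split=> // u; rewrite leq_eqVlt => /orP[->//|]; rewrite ltnS => lu _.
  case: (nat_of_ord u =P xx) => [eu|/eqP nu]; last exact: hu.
  by rewrite (_ : u = x) //; apply: val_inj.
case: (deg A1 x =P 1) => [d1 _|_]; last by case/eqP.
have [e [eA e1 es]] := deg1_edge d1.
have sx : M aSUM xx = e by have := cs x; rewrite d1 es; apply.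
have leS := ord_mS e.
have ep : 0 < ends_at e x by rewrite e1.
have [y jxy] := ends_at_jn ep.
have s3 := m3 e; have s4 := m4 e.
have oe : (ed e).1 + (ed e).2 - xx = y.
  case/orP: jxy => /eqP ee; rewrite ee /=; last by rewrite addnK.
  by rewrite addnC addnK.
have lyS := ord_S y.
have yx : (y == xx :> nat) = false.
  apply/negbTE/negP=> /eqP yx; have exy : y = x by apply: val_inj.
  by have := jn_ends_at x jxy; rewrite e1 exy eqxx.
have lsum : (ed e).1 + (ed e).2 < 2 ^ w.
  by apply: nm_word; have := ltn_ord (ed e).1; have := ltn_ord (ed e).2; clear; lia.
have ey : ends_at e y = 1.
  rewrite (jn_ends_at y jxy) eqxx -val_eqE /=; by rewrite eq_sym yx.
have dy := degD1 ed y eA; rewrite ey add1n in dy.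
have cdy : M aDEG y = (deg (A1 :\ e) y).+1 by rewrite -dy; exact: cd.
do_put 0 (nat_of_ord e) (ex, sx).
do_put xx 0 (ex, ex).
do_put (nat_of_ord e) 0 (ex, ex).
do_put 0 (nat_of_ord y) (ex, s3, s4, oe).
do_put (nat_of_ord y) (deg (A1 :\ e) y) (yx, cdy, subn1).
do_put (nat_of_ord y) (M aSUM y - e) yx.
do_put 0 (nat_of_ord y) yx.
have other v : v != x -> v != y -> ends_at e v = 0.
  by move=> nx ny; rewrite (jn_ends_at v jxy) ![_ == v]eq_sym (negbTE nx) (negbTE ny).
have dx0 : deg (A1 :\ e) x = 0.
  by have := degD1 ed x eA; rewrite d1 e1 add1n => -[<-].
have cardA : #|A1| = #|A1 :\ e|.+1 by rewrite (cardsD1 e) eA.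
exists (n - vv + #|A1 :\ e|); first by rewrite cardA addnS in hq.
have dE v : v != x -> v != y -> deg (A1 :\ e) v = deg A1 v.
  by move=> nx ny; rewrite (degD1 ed v eA) other.
exists (A1 :\ e), vv, (nat_of_ord y); split=> //.
- split.
  + move=> e'; rewrite /update /= in_setD1 -val_eqE /=.
    by case: (nat_of_ord e' =P e) => //= _; exact: hI.
  + split=> v; rewrite /update /=.
      case: (nat_of_ord v =P y) => [/val_inj->//|/eqP ny].
      case: (nat_of_ord v =P xx) => [evx|/eqP nx]; first by rewrite (_ : v = x) //; apply: val_inj.
      by rewrite dE //; exact: cd.
    move=> dv; have nx : v != x by apply: contraNneq dv => ->; rewrite dx0.
    have sE : edge_sum A1 v = ends_at e v * e + edge_sum (A1 :\ e) v.
      by rewrite /edge_sum (big_setD1 e).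
    have dv1 : deg A1 v != 0 by rewrite (degD1 ed v eA) addn_eq0 negb_and dv orbT.
    have := cs v dv1; rewrite /= => cv.
    case: (nat_of_ord v =P y) => [/val_inj vy|/eqP ny].
      by rewrite -vy cv sE vy ey mul1n addKn.
    by rewrite cv sE other.
  + split; first by apply: subset_trans sub; exact: subD1set.
    by move=> p /tr h; apply: (excess_trim h d1 eA); rewrite e1.
- by left.
- split=> // u lu ny; case: (u =P x) => [->|/eqP nx]; first by rewrite dx0.
  by rewrite dE //; apply: hu.
Qed.

(** * Attaching and printing the walk *)

Lemma walk_mem_nth M (c : steps) z p0 j : walk_mem M c z -> j < size c ->
  [/\ M aPV (M xLO 0 + j) = (nth p0 c j).1, M aPW (M xLO 0 + j) = (nth p0 c j).2,
      M xLO 0 + j < S & M xLO 0 + j < 2 ^ w].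
Proof.
move=> [h1 h2 h3 h4] lj; have lt : M xLO 0 + j < 2 * n by apply: leq_trans h2; rewrite ltnS ltnW // -h1 ltn_add2l.
split.
- rewrite h3; last by rewrite size_map size_rcons size_map ltnS ltnW.
  rewrite (nth_map p0.1) ?size_rcons ?size_map ?ltnS 1?ltnW //.
  by rewrite nth_rcons size_map lj (nth_map p0).
- by rewrite h4 ?(nth_map p0.2) ?(nth_map p0) ?size_map.
- by move: lt S_big; clear; lia.
- by apply: nm_word; move: lt; clear; lia.
Qed.

Lemma walk_mem_frame cc s s' (c : steps) z : frame cc s s' ->
  all (fun a => a \notin writes cc) [:: aPV; aPW; xLO; xHI] -> walk_mem s.1 c z -> walk_mem s'.1 c z.
Proof.
move=> [f1 _] /= /and5P[n1 n2 n3 n4 _] [h1 h2 h3 h4].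
split; rewrite ?f1 //; first by apply: eq_stored_from h3; apply: f1.
by apply: eq_stored_from h4; apply: f1.
Qed.

Lemma walk_loop_bound s cc (c : steps) z : walk_mem s.1 c z ->
  all (fun a => a \notin writes (for_loop xI (Op Minus (Get xHI (Const 0)) (Get xLO (Const 0))) cc))
    [:: aPV; aPW; xLO; xHI] ->
  forall s', frame (for_loop xI (Op Minus (Get xHI (Const 0)) (Get xLO (Const 0))) cc) s s' ->
    safe w S s'.1 (Op Minus (Get xHI (Const 0)) (Get xLO (Const 0))) /\
    den s'.1 (Op Minus (Get xHI (Const 0)) (Get xLO (Const 0))) = size c.
Proof.
move=> wm h s' f; have [h1 _ _ _] := walk_mem_frame f h wm.
by split; [rewrite /=; do !split | rewrite /= -h1 addKn].
Qed.

Lemma walk_size M (c : steps) z : walk_mem M c z -> size c < 2 * n.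
Proof. by move=> [h1 h2 _ _]; apply: leq_ltn_trans h2; rewrite -h1 leq_addl. Qed.

Lemma mem_take_S (T : eqType) (x0 x : T) (l : seq T) j : j < size l ->
  (x \in take j.+1 l) = (x == nth x0 l j) || (x \in take j l).
Proof. by move=> lj; rewrite (take_nth x0 lj) mem_rcons inE. Qed.

Lemma attach_ear_runs s st H (c : steps) z : bounded w s.1 -> status s.1 st ->
  edge_set s.1 aINH H -> walk_mem s.1 c z -> c != [::] ->
  runs w S attach_ear s (300 * (n + 1)) (fun s' =>
    status s'.1 (add_ear st c z) /\ edge_set s'.1 aINH (H :|: [set e in unzip2 c])).
Proof.
move=> bs hst hH wm; case ec: {1}c => [//|p0 c'] _.
have lsz := walk_size wm.
pose body := (aINH@[aPW<[$xLO + $xI]>] ::= #1 ;; aSTAT@[aPV<[$xLO + $xI]>] ::= #1)%prog.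
have loop : runs w S (for_loop xI (Op Minus (Get xHI (Const 0)) (Get xLO (Const 0))) body) s (200 * (n + 1))
   (fun s' => (forall e : 'I_m, s'.1 aINH e = (e \in H) || (e \in unzip2 c)) /\
     (forall v : 'I_n, s'.1 aSTAT v = if v \in unzip1 c then 1 else st v)).
  apply: (@runs_for _ _ w_ge lS0 _ _ _ _ (size c) 40 _ (fun j s' =>
    (forall e : 'I_m, s'.1 aINH e = (e \in H) || (e \in take j (unzip2 c))) /\
    (forall v : 'I_n, s'.1 aSTAT v = if v \in take j (unzip1 c) then 1 else st v))) => //.
  - exact: walk_loop_bound wm _.
  - by apply: nm_word; move: lsz; clear; lia.
  - by split=> e; rewrite take0 ?orbF; [exact: hH | exact: hst].
  - move=> j [M o] lj bM f xj [IH1 IH2]; rewrite /= in xj IH1 IH2.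
    have wmM := walk_mem_frame f isT wm; have [q1 q2 q3 q4] := walk_mem_nth p0 wmM lj.
    rewrite /= in q1 q2 q3 q4.
    have l1 := ord_S (nth p0 c j).1; have l2 := ord_mS (nth p0 c j).2.
    apply: (runs_block w_ge); [exact: bM | by [] |].
    do_put (nat_of_ord (nth p0 c j).2) 1 (xj, q2).
    do_put (nat_of_ord (nth p0 c j).1) 1 (xj, q1).
    split=> i; rewrite /update /= val_eqE.
      rewrite (mem_take_S p0.2) ?size_map // (nth_map p0) //.
      by case: eqP => _; rewrite ?orbT //= IH1.
    rewrite (mem_take_S p0.1) ?size_map // (nth_map p0) //.
    by case: eqP => //= _; rewrite IH2.
  - by move=> s' _ _ [h1 h2]; split=> i; [rewrite h1 | rewrite h2]; rewrite take_oversize ?size_map.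
  - by rewrite /=; move: lsz; clear; lia.
apply: (runs_seq bs loop (T2 := 50)); first by clear; lia.
move=> [M o] bM f [h1 h2]; have wmM := walk_mem_frame f isT wm; rewrite /= in h1 h2.
have sz : 0 < size c by rewrite ec.
have [q1 _ q3 _] := walk_mem_nth p0 wmM sz; rewrite /= addn0 in q1 q3.
have qz : M aPV (M xHI 0) = z.
  case: (wmM : walk_mem M c z) => g1 _ g3 _; rewrite -g1 g3; last by rewrite size_map size_rcons size_map.
  by rewrite (nth_map z) ?size_rcons ?size_map // nth_rcons size_map ltnn eqxx.
have hS : M xHI 0 < S.
  by case: (wmM : walk_mem M c z) => _ g2 _ _; have := S_big; move: g2; rewrite /=; clear; lia.
have l1 := ord_S (nth p0 c 0).1; have l2 := ord_S z.
apply: (runs_block w_ge); [exact: bM | by [] |].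
do_put (nat_of_ord (nth p0 c 0).1) 2 q1.
do_put (nat_of_ord z) 2 qz.
split=> i; rewrite /update /=; last by rewrite h1 !inE.
rewrite /add_ear ec /= !val_eqE h2 ec /=.
by case: (i =P z) => [->|_]; rewrite ?orbT // orbF; case: (i == p0.1).
Qed.

Definition cycle_code (c : steps) : seq nat :=
  size c :: flatten [seq [:: nat_of_ord x.1; nat_of_ord x.2] | x <- c].

Lemma output_cycle_runs s st (c : steps) z : bounded w s.1 -> status s.1 st ->
  walk_mem s.1 c z -> c != [::] ->
  runs w S output_cycle s (300 * (n + 1)) (fun s' =>
    status s'.1 (fun v => if v \in unzip1 c then 2 else st v) /\ s'.2 = s.2 ++ cycle_code c).
Proof.
move=> bs hst wm; case ec: {1}c => [//|p0 c'] _.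
have lsz := walk_size wm.
have pre : runs w S (Out ($xHI - $xLO)%prog) s 10 (fun s' => s' = (s.1, rcons s.2 (size c))).
  case: s bs hst wm => M o bM hst wm; apply: (runs_block w_ge); [exact: bM | by [] |].
  have [h1 h2 h3 h4] := wm; rewrite /= in h1.
  apply: (wp_out (x := size c)); first by rewrite /= -h1 addKn.
    by rewrite /=; do !split.
  by [].
apply: (runs_seq bs pre (T2 := 280 * (n + 1))); first by clear; lia.
move=> s1 b1 _ e1; have wm1 : walk_mem s1.1 c z by rewrite e1.
apply: (@runs_for _ _ w_ge lS0 _ _ _ _ (size c) 40 _ (fun j s' =>
    s'.2 = s1.2 ++ flatten [seq [:: nat_of_ord x.1; nat_of_ord x.2] | x <- take j c] /\
    (forall v : 'I_n, s'.1 aSTAT v = if v \in take j (unzip1 c) then 2 else st v))) => //.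
- exact: walk_loop_bound wm1 _.
- by apply: nm_word; move: lsz; clear; lia.
- by split=> [|e]; rewrite take0 ?cats0 //= e1; exact: hst.
- move=> j [M o] lj bM f xj [IH1 IH2]; rewrite /= in xj IH1 IH2.
  have wmM := walk_mem_frame f isT wm1; have [q1 q2 q3 q4] := walk_mem_nth p0 wmM lj.
  rewrite /= in q1 q2 q3 q4.
  have l1 := ord_S (nth p0 c j).1; have l2 := ord_mS (nth p0 c j).2.
  apply: (runs_block w_ge); [exact: bM | by [] |].
  apply/wp_seq; apply: (wp_out (x := (nth p0 c j).1)); [by mem_solve (xj, q1) | by mem_solve (xj, q1) |].
  apply/wp_seq; apply: (wp_out (x := (nth p0 c j).2)); [by mem_solve (xj, q2) | by mem_solve (xj, q2) |].
  do_put (nat_of_ord (nth p0 c j).1) 2 (xj, q1).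
  split=> [|i].
    rewrite /= IH1 (take_nth p0 lj) map_rcons flatten_rcons catA.
    by rewrite -!cats1 -catA.
  rewrite /update /= val_eqE (mem_take_S p0.1) ?size_map // (nth_map p0) //.
  by case: eqP => //= _; rewrite IH2.
- move=> s' _ _ [h1 h2]; split=> [i|]; first by rewrite h2 take_oversize // size_map.
  by rewrite h1 take_size e1 /= cat_rcons.
- by rewrite /=; move: lsz; clear; lia.
Qed.

Lemma output_blocked_runs s st : bounded w s.1 -> base_mem s.1 -> status s.1 st ->
  runs w S output_blocked s (200 * (n + 1)) (fun s' =>
    s'.2 = s.2 ++ 0 :: [seq nat_of_ord v | v <- enum 'I_n & st v == 2]).
Proof.
move=> bs bm hst.
have pre : runs w S (Out (#0)%prog) s 10 (fun s' => s' = (s.1, rcons s.2 0)).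
  case: s bs bm hst => M o bM _ _; apply: (runs_block w_ge); [exact: bM | by [] |].
  by apply: (wp_out (x := 0)).
apply: (runs_seq bs pre (T2 := 180 * (n + 1))); first by clear; lia.
move=> s1 b1 _ e1; have bm1 : base_mem s1.1 by rewrite e1.
apply: (@runs_for _ _ w_ge lS0 _ _ _ _ n 40 _ (fun j s' =>
    s'.2 = s1.2 ++ [seq nat_of_ord v | v <- take j (enum 'I_n) & st v == 2])) => //.
- exact: (vertex_loop_bound bm1).
- exact: n_word.
- by rewrite take0 /= cats0.
- move=> j [M o] lj bM f xj IH; rewrite /= in xj IH.
  have [f1 _] := f; have l1 := ord_S (Ordinal lj); rewrite /= in l1.
  have tj : M aSTAT j = st (Ordinal lj).
    by have := f1 aSTAT isT j => /= ->; rewrite e1; exact: (hst (Ordinal lj)).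
  have sz : j < size (enum 'I_n) by rewrite size_enum_ord.
  have tk : take j.+1 (enum 'I_n) = rcons (take j (enum 'I_n)) (Ordinal lj).
    by rewrite (take_nth (Ordinal lj)) //; congr rcons; apply: val_inj; rewrite /= nth_enum_ord.
  apply: (runs_block w_ge); [exact: bM | by [] |].
  do_if (xj, tj).
    move=> tst; have st2 : (st (Ordinal lj) == 2) = true by case: (st _ == 2) tst.
    apply: (wp_out (x := j)); [by mem_solve xj | by mem_solve xj |].
    by rewrite /= IH tk filter_rcons st2 map_rcons rcons_cat.
  move=> tst; have st2 : (st (Ordinal lj) == 2) = false by case: (st _ == 2) tst.
  by rewrite /= IH tk filter_rcons st2.
- move=> s' _ _ ->; rewrite e1 take_oversize ?size_enum_ord //=.
  by rewrite cat_rcons.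
- by rewrite /=; clear; lia.
Qed.

(** The part of [fresh] from which a search starts. The clauses on [aDEG] and [aSUM] are dropped
    because deletion and trimming change these arrays before the search for a cycle. *)
Record ready (M : memory) (W : {set 'I_n}) (ws : seq 'I_n) : Prop := Ready {
  rd_uniq : uniq ws;
  rd_ws : ws =i W;
  rd_sp : M xSP 0 = size ws;
  rd_stk : stored M aSTK ws;
  rd_v : forall v : 'I_n, [/\ M aVIS v = (v \in W), M aPAR v = 0,
     M aPTR v = M aHEAD v & M aDEP v = 0];
  rd_mark : forall v : 'I_n, M aMARK v = 0;
  rd_r : M xR 0 = 0;
  rd_found : M xFOUND 0 = 0 }.

Lemma fresh_ready M (st : nat -> nat) ws : fresh st ws n M -> ready M [set v : 'I_n | st v == 1] ws.
Proof.
move=> [h1 h2 h3 h4 h5 h6 h7]; split=> //.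
- by move=> v; rewrite h2 ltn_ord inE.
- by move=> v; have [[q1 q2 q3 q4] _] := h5 v (ltn_ord v); rewrite inE.
- by move=> v; have [_ []] := h5 v (ltn_ord v).
Qed.

Lemma ready_frame c s s' W ws : frame c s s' ->
  all (fun a => a \notin writes c) [:: xSP; aSTK; aVIS; aPAR; aPTR; aHEAD; aDEP; aMARK; xR; xFOUND] ->
  ready s.1 W ws -> ready s'.1 W ws.
Proof.
move=> [f _] /allP h [h1 h2 h3 h4 h5 h6 h7 h8].
have g a : a \in [:: xSP; aSTK; aVIS; aPAR; aPTR; aHEAD; aDEP; aMARK; xR; xFOUND] -> s'.1 a =1 s.1 a.
  by move=> /h; exact: f.
split=> // [|i li|v|v||]; rewrite ?(g xSP) ?(g aSTK) ?(g aVIS) ?(g aPAR) ?(g aPTR) ?(g aHEAD) ?(g aDEP)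
  ?(g aMARK) ?(g xR) ?(g xFOUND) //; exact: h4.
Qed.

Lemma ready_searching M W ws adj J D inc : 0 < D -> ready M W ws -> adjacency M adj ->
  edge_set M aACT J -> searching J W D inc M (search0 J ws adj) 0.
Proof.
move=> D0 [h1 h2 h3 h4 h5 h6 h7 h8] [a1 a2 _] hJ; split=> //.
- apply: sinv0 => // [v a|v e eJ].
    by rewrite a2 => /eqP.
  rewrite !ends_atE addn_gt0 !lt0b => /orP[]/eqP ev.
    by apply/mapP; exists (e, false); rewrite ?a2 ?/base /= ?ev.
  by apply/mapP; exists (e, true); rewrite ?a2 ?/base /= ?ev.
- split=> //=.
  + by move=> v; have [-> _ _ _] := h5 v; rewrite h2.
  + by split=> // v; have [] := h5 v.
  + by move=> v; have [] := h5 v.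
  + by move=> v; have [_ _ -> _] := h5 v; exact: a1.
Qed.

(** The continuation [C] stands for what the phases do differently with the walk, attaching it to H
    or printing it. *)
Lemma climbs_runs C s s0 T Q J W D inc : bounded w s.1 -> base_mem s.1 ->
  found J W D inc s.1 s0 -> (forall v : 'I_n, s.1 aMARK v = 0) ->
  (forall s' c z, bounded w s'.1 -> frame (Seq climb_x climb_y) s s' -> walk_mem s'.1 c z ->
     good_walk J W D inc s0 c z -> runs w S C s' T Q) ->
  runs w S (Seq climb_x (Seq climb_y C)) s (T + 300 * (n + 1)) Q.
Proof.
move=> bs bm [x [y [e [[cl pr ex ey ee] _]]]] mk h.
apply: (runs_seq bs (climb_x_runs bs bm (cl_inv cl) pr ex (cl_x cl) mk) (T2 := T + 200 * (n + 1))).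
  by clear; lia.
move=> s1 b1 f1 [lx [zx [cx zxv pz]]].
have bm1 := base_mem_frame f1 isT bm; have [g1 _] := f1.
have pr1 : parents s1.1 s0.
  by case: pr => p1 p2; split=> [v|v u e' pv]; rewrite g1 //; exact: p2 pv.
have ey1 : s1.1 xY 0 = y by rewrite g1.
have ee1 : s1.1 xE 0 = e by rewrite g1.
apply: (runs_seq b1 (climb_y_runs b1 bm1 cl pr1 ey1 ee1 cx zxv pz) (T2 := T)).
  by clear; lia.
move=> s2 b2 f2 [c [z [wm gw]]]; apply: (h _ c z) => //.
apply: (@frame_trans _ _ s1); [apply: frame_sub f1 | apply: frame_sub f2] => //; exact/allP.
Qed.

(** An inner vertex has a parent, so it is not in [W] and its status is not 1; edges of
    [fresh_edges] touch no blocked vertex, which leaves status 0. *)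
Lemma good_walk_ear H st r (W : {set 'I_n}) D inc s0 c z : ear_inv ed H st r ->
  (forall v, (v \in W) = (st v == 1)) -> sinv ed (fresh_edges st H) W D inc s0 ->
  good_walk (fresh_edges st H) W D inc s0 c z -> is_ear ed H st c z.
Proof.
move=> inv WE sv [sw sub inner ends _].
have inJ e v : e \in fresh_edges st H -> 0 < ends_at e v -> st v < 2.
  by rewrite inE /ends_at addn_gt0 !lt0b => /and3P[_ h1 h2] /orP[]/eqP <-.
split=> //.
- by move=> e /sub; rewrite inE => /and3P[].
- move=> v /inner [vv]; case pv: (par s0 v) => [[u e]|] // _.
  have [[_ _ _ nW] [eJ _ je]] := si_par sv pv.
  have := inJ _ _ eJ (jn_ends_atl je); rewrite WE in nW.
  by case: (st v) nW => [|[|]].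
- case: ends => [ez|[ne zW hW]]; [left | right]; last first.
    by split=> //; apply/eqP; rewrite -WE.
  split=> //; rewrite ez; case: sw => cn0 wc _ _ _.
  case: c cn0 wc sub {inner ez} => // p c _ /= /andP[je _] sub.
  by have := inJ _ _ (sub p.2 (mem_head _ _)) (jn_ends_atl je).
Qed.

(** * Rounds that add an ear *)

Definition acyclic_off (st : 'I_n -> nat) : Prop :=
  forall c : steps, all (fun v => st v < 2) (unzip1 c) -> ~~ simple_cycle ed c.

Record ears (M : memory) (st : 'I_n -> nat) (H : {set 'I_m}) (r : nat) : Prop := Ears {
  er_inv : ear_inv ed H st r;
  er_st : status M st;
  er_le : forall v, st v <= 2;
  er_inh : edge_set M aINH H;
  er_cnt : M xCNT 0 = r }.

(** With zero increments the depth bound cuts nothing off. *)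
Lemma dp0 J W D s0 v : 0 < D -> sinv ed J W D (fun=> 0) s0 -> dp s0 v < D.
Proof.
move=> D0 sv; case pv: (par s0 v) => [[u e]|]; last by rewrite (si_dp0 sv).
by have [-> h] := si_dp sv pv; rewrite addn0.
Qed.

Lemma add_ear_le st (c : steps) z v : (forall u, st u <= 2) -> add_ear st c z v <= 2.
Proof. by move=> h; rewrite /add_ear; case: ifP => // _; case: ifP. Qed.

Definition ear_round : cmd :=
  (reset ;; select_new ;; explore ;;
     If ($xFOUND)
       (climb_x ;; climb_y ;; attach_ear ;; xCNT ::= $xCNT + #1)
       (xSTUCK ::= #1))%prog.

Lemma ear_round_runs s st H r D T adj : 0 < D -> bounded w s.1 -> base_mem s.1 ->
  adjacency s.1 adj -> s.1 xD 0 = D -> s.1 xSTUCK 0 = 0 -> T < 2 ^ w ->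
  ears s.1 st H r -> r < T ->
  runs w S ear_round s (3000 * (n + m + 1)) (fun s' =>
    (s'.1 xSTUCK 0 = 0 /\ exists st1 H1, ears s'.1 st1 H1 r.+1) \/
    [/\ s'.1 xSTUCK 0 = 1, ears s'.1 st H r & acyclic_off st]).
Proof.
move=> D0 bs bm ad eD eS lT er rT.
apply: (runs_seq bs (reset_runs bs bm) (T2 := 2800 * (n + m + 1))); first by clear; lia.
move=> s1 b1 f1 [ws fr1]; have bm1 := base_mem_frame f1 isT bm; have [g1 o1] := f1.
pose W := [set v : 'I_n | s.1 aSTAT v == 1].
have rd1 : ready s1.1 W ws := fresh_ready fr1.
have ad1 := adjacency_frame f1 isT ad.
have st1 : status s1.1 st by move=> v; rewrite g1 //; exact: (er_st er).
have in1 : edge_set s1.1 aINH H by move=> e; rewrite g1 //; exact: (er_inh er).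
apply: (runs_seq b1 (select_new_runs b1 bm1 st1 in1) (T2 := 2600 * (n + m + 1))); first by clear; lia.
move=> s2 b2 f2 hJ; have bm2 := base_mem_frame f2 isT bm1; have [g2 o2] := f2.
have rd2 := ready_frame f2 isT rd1; have ad2 := adjacency_frame f2 isT ad1.
set J := fresh_edges st H in hJ.
have WE v : (v \in W) = (st v == 1) by rewrite inE (er_st er).
have ps2 : params D (fun=> 0) s2.1.
  split=> // [|v]; first by rewrite g2 // g1.
  by rewrite g2 //; have [_ [-> _ _]] := fr_v fr1 (ltn_ord v).
have sg2 := ready_searching (fun=> 0) D0 rd2 ad2 hJ.
apply: (runs_seq b2 (@explore_runs J W D (fun=> 0) D0 (fun=> isT) s2 _ b2 ps2 sg2 _ _)
  (T2 := 1000 * (n + m + 1))).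
- move=> s0 sv es u uv; apply: (stk0_notlive sv es uv); exact: dp0 sv.
- by case: ad2.
- by clear; lia.
move=> s3 b3 f3 post3; have bm3 := base_mem_frame f3 isT bm2; have [g3 o3] := f3.
have mk3 (v : 'I_n) : s3.1 aMARK v = 0 by rewrite g3 //; exact: (rd_mark rd2 v).
have er3 : ears s3.1 st H r.
  case: er => q1 q2 q3 q4 q5; split=> // [v|e|]; by rewrite g3 // g2 // g1.
have eS3 : s3.1 xSTUCK 0 = 0 by rewrite g3 // g2 // g1.
apply: (runs_if w_ge (T := 900 * (n + m + 1))) => //=; last by clear; lia.
- move=> fd; case: post3 => [[s0 fd3]|[fd0 _]]; last by rewrite fd0 in fd.
  have sv0 : sinv ed J W D (fun=> 0) s0 by case: fd3 => [x [y [e [[cl _ _ _ _] _]]]]; exact: cl_inv cl.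
  apply: (runs_sub b3 (T := 400 * (n + 1) + 300 * (n + 1)) (Q := fun s' =>
     s'.1 xSTUCK 0 = 0 /\ exists st1 H1, ears s'.1 st1 H1 r.+1)); last 2 first.
  + by clear; lia.
  + by move=> s' _ _ h; left.
  apply: (climbs_runs b3 bm3 fd3 mk3) => s4 c z b4 f4 wm gw; have [g4 o4] := f4.
  have cn0 : c != [::] by case: gw => [[]].
  have st4 : status s4.1 st by move=> v; rewrite g4 //; exact: (er_st er3).
  have in4 : edge_set s4.1 aINH H by move=> e; rewrite g4 //; exact: (er_inh er3).
  apply: (runs_seq b4 (attach_ear_runs b4 st4 in4 wm cn0) (T2 := 20)); first by clear; lia.
  move=> [M o] bM [g5 o5] [hst hin]; apply: (runs_block w_ge); [exact: bM | by [] |].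
  have cnt : M xCNT 0 = r by have := g5 xCNT isT 0 => /= ->; rewrite g4 //; exact: (er_cnt er3).
  have lr : r.+1 < 2 ^ w by apply: leq_ltn_trans lT.
  do_put 0 r.+1 (cnt, addn1).
  split; first by rewrite /update /=; have := g5 xSTUCK isT 0 => /= ->; rewrite g4.
  exists (add_ear st c z), (H :|: [set e in unzip2 c]); split=> //.
    apply: (is_ear_step (er_inv er3)); exact: good_walk_ear (er_inv er3) WE sv0 gw.
  by move=> v; apply: add_ear_le; exact: (er_le er3).
- move=> /eqP fd; case: post3 => [[s0 [x [y [e [_ [fd1 _]]]]]]|[_ [s0 [sv es allv]]]].
    by rewrite fd1 in fd.
  case: s3 b3 er3 eS3 {f3 bm3 g3 o3 mk3 fd} => M o bM er3 eS3.
  apply: (runs_block w_ge); [exact: bM | by move: n_pos; rewrite /=; clear; lia |].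
  do_put 0 1 lw1.
  right; split=> //.
    by case: er3 => *; split.
  apply: (forest_order (er_inv er) (J := J) (W := W) _ _ sv) => //.
    by apply/setP=> v; rewrite WE inE.
  move=> v; apply: (stk0_notlive sv es (allv v)); exact: dp0 sv.
Qed.

Lemma find_ears_runs s D T adj : 0 < D -> bounded w s.1 -> base_mem s.1 ->
  adjacency s.1 adj -> s.1 xD 0 = D -> s.1 xT 0 = T ->
  status s.1 (fun _ : 'I_n => 0) -> edge_set s.1 aINH (set0 : {set 'I_m}) ->
  runs w S find_ears s ((T + 2) * (3000 * (n + m + 2))) (fun s' =>
    (s'.1 xSTUCK 0 = 0 /\ exists st H, ears s'.1 st H T) \/
    [/\ s'.1 xSTUCK 0 = 1 & exists st H r, [/\ r < T, ears s'.1 st H r & acyclic_off st]]).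
Proof.
move=> D0 bs bm ad eD eT st0 in0.
pose I q (s' : state) :=
  (s'.1 xSTUCK 0 = 0 /\ exists st H r, [/\ r <= T, ears s'.1 st H r & T - r + 1 <= q]) \/
  [/\ s'.1 xSTUCK 0 = 1 & exists st H r, [/\ r < T, ears s'.1 st H r & acyclic_off st]].
have pre : runs w S (xCNT ::= #0 ;; xSTUCK ::= #0)%prog s 10 (fun s' => I (T + 1) s').
  case: (s) bs st0 in0 => M o bM st0 in0; apply: (runs_block w_ge); [exact: bM | by [] |].
  do_put 0 0 lw0.
  do_put 0 0 lw0.
  left; split=> //; exists (fun=> 0), set0, 0; split=> //; last by rewrite subn0.
  by split=> //; exact: ear_inv0.
apply: (runs_seq bs pre (T2 := (T + 2) * (3000 * (n + m + 2)) - 10)).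
  have : 10 <= (T + 2) * (3000 * (n + m + 2)) by clear; nia.
  by clear; lia.
move=> s1 b1 f1 I1; have bm1 := base_mem_frame f1 isT bm; have [g1 o1] := f1.
have ad1 := adjacency_frame f1 isT ad.
apply: (runs_while w_ge (K := 3000 * (n + m + 1)) (v := T + 1) (I := I)) => //; last first.
  by rewrite /=; clear; nia.
move=> q s2 b2 f2 I2; have bm2 := base_mem_frame f2 isT bm1; have [g2 o2] := f2.
have ad2 := adjacency_frame f2 isT ad1.
have eT2 : s2.1 xT 0 = T by rewrite g2 // g1.
have eD2 : s2.1 xD 0 = D by rewrite g2 // g1.
have lT : T < 2 ^ w by rewrite -eT2.
case: I2 => [[eS [st [H [r [rT er lq]]]]]|[eS h]].
  have ec := er_cnt er.
  split; first by rewrite /= eS ec eT2; do !split => //; apply: leq_ltn_trans lw1; rewrite mul1n leq_b1.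
  rewrite /= eS ec eT2 mul1n; case: ltnP => lr /=; last first.
    have rE : r = T by apply/eqP; rewrite eqn_leq rT.
    by left; split=> //; exists st, H; rewrite -rE.
  apply: (runs_sub b2 (ear_round_runs D0 b2 bm2 ad2 eD2 eS lT er lr)) => //.
  move=> s3 _ _ [[eS3 [st3 [H3 er3]]]|[eS3 er3 ac]].
    exists (T - r.+1 + 1); first by move: lq lr; clear; lia.
    by left; split=> //; exists st3, H3, r.+1.
  exists q.-1; first by move: lq; clear; lia.
  by right; split=> //; exists st, H, r.
split; first by rewrite /= eS; do !split.
by rewrite /= eS mul0n /=; right.
Qed.

(** * Rounds that print a cycle *)

Definition disjoint_walks (c1 c2 : steps) : bool := ~~ has (mem (unzip1 c1)) (unzip1 c2).

Definition covered (cs : seq steps) : {set 'I_n} := [set v | has (fun c => v \in unzip1 c) cs].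

(** Edges at the cycle printed last are still in [A], as they are deleted at the start of the next
    round; hence the excess is that of [avoid]. It pays [8 * D + 5] for each deletion still to come
    before the last round and keeps 1, so that an edge is always left. *)
Record packing (D : nat) (M : memory) (A : {set 'I_m}) (cs : seq steps) : Prop := Packing {
  pk_inh : edge_set M aINH A;
  pk_st : status M (fun v => if v \in covered cs then 2 else 0);
  pk_cycle : all (simple_cycle ed) cs;
  pk_disj : pairwise disjoint_walks cs;
  pk_deg : forall v, deg A v <= 4;
  pk_branch : 2 * #|[set v | 2 < deg A v]| < 2 ^ D;
  pk_excess : size cs < k ->
    excess (avoid ed A (covered cs)) ((k - (size cs).+1) * (8 * D + 5) + 1) }.

Lemma avoid_sub A (C : {set 'I_n}) : avoid ed A C \subset A.
Proof. by apply/subsetP=> e; rewrite inE => /andP[]. Qed.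

Lemma branch_sub (A B : {set 'I_m}) D : A \subset B ->
  2 * #|[set v | 2 < deg B v]| < 2 ^ D -> 2 * #|[set v | 2 < deg A v]| < 2 ^ D.
Proof.
move=> sAB; apply: leq_ltn_trans; rewrite leq_mul2l /=; apply: subset_leq_card.
by apply/subsetP=> v; rewrite !inE => /leq_trans; apply; exact: deg_sub.
Qed.

Lemma packing_step D M M' (A A1 : {set 'I_m}) cs c z s0 : 0 < D ->
  packing D M A cs -> size cs < k -> A1 \subset avoid ed A (covered cs) ->
  excess A1 ((k - (size cs).+1) * (8 * D + 5) + 1) ->
  good_walk A1 set0 D (fun v => 2 < deg A1 v) s0 c z ->
  edge_set M' aINH A1 -> status M' (fun v => if v \in unzip1 c then 2 else if v \in covered cs then 2 else 0) ->
  packing D M' A1 (rcons cs c).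
Proof.
move=> D0 pk lk sub exc [[cn0 wc u1 u2 zn] cA inner ends cnt] hI hS.
have sub1 : A1 \subset A := subset_trans sub (avoid_sub A _).
(* Without initial roots the walk is necessarily closed. *)
have zh : z = head z (unzip1 c) by case: ends => [//|[_]]; rewrite inE.
have zc : z \in unzip1 c.
  by rewrite zh; case: (c) cn0 => //= p c' _; rewrite mem_head.
have cfree v : v \in unzip1 c -> v \notin covered cs.
  have dead e u : e \in A1 -> 0 < ends_at e u -> u \notin covered cs.
    move=> /(subsetP sub); rewrite inE /ends_at addn_gt0 !lt0b => /and3P[_ h1 h2].
    by case/orP=> /eqP <-.
  move=> vc; have: exists2 e, e \in unzip2 c & 0 < ends_at e v.
    elim: (c) wc vc {cn0 u1 u2 zn cA inner ends cnt hS zh zc} => //= p c' IH /andP[jp wc'].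
    rewrite inE => /orP[/eqP->|/(IH wc') [e ec le]].
      by exists p.2; rewrite ?mem_head //; exact: jn_ends_atl jp.
    by exists e; rewrite // inE ec orbT.
  by move=> [e /cA eA le]; exact: dead eA le.
have cov v : (v \in covered (rcons cs c)) = (v \in unzip1 c) || (v \in covered cs).
  by rewrite !inE has_rcons.
split=> //.
- by move=> v; rewrite hS cov; case: (v \in unzip1 c).
- rewrite all_rcons (pk_cycle pk) andbT.
  case: (c) cn0 wc u1 u2 zh => // p c' _ wc u1 u2 zh.
  by apply: walk_simple_cycle => //; rewrite zh in wc.
- rewrite pairwise_rcons (pk_disj pk) andbT; apply/allP=> c' c's.
  apply/hasPn=> v /cfree; apply: contra => vc'; rewrite inE; apply/hasP; by exists c'.
- by move=> v; apply: leq_trans (deg_sub ed v sub1) (pk_deg pk v).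
- exact: branch_sub sub1 (pk_branch pk).
- rewrite size_rcons => lk2.
  have -> : avoid ed A1 (covered (rcons cs c)) = avoid ed A1 [set v in unzip1 c].
    apply/setP=> e; rewrite [in LHS]inE [in RHS]inE; case eA: (e \in A1) => //=.
    have := subsetP sub _ eA; rewrite [in X in X -> _]inE => /and3P[_ h1 h2].
    by rewrite !cov !negb_or h1 h2 !andbT !in_set.
  (* The cycle consists of a top vertex and two tree paths with at most [D] branch vertices each; 4
     (2D + 1) + 1 = 8D + 5. *)
  apply: (@excess_cycle _ _ ed A1 _ (2 * D + 1) c z) => //.
  + move: exc; congr (excess _ _).
    have -> : k - (size cs).+1 = (k - (size cs).+2).+1 by move: lk2; clear; lia.
    by rewrite mulSn; clear; lia.
  + by move=> v; apply: leq_trans (deg_sub ed v sub1) (pk_deg pk v).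
  + rewrite -sum1_count big_mkcond /=.
    apply: leq_trans (_ : \sum_(v <- unzip1 c) (2 < deg A1 v) <= _).
      by apply: leq_sum => v _; case: (2 < _).
    apply: leq_trans cnt _; have := leq_b1 (2 < deg A1 (head z (unzip1 c))); clear; lia.
Qed.

Definition cycle_round : cmd :=
  (reset ;; delete_dead ;; trim ;; copy_edges ;; explore ;; climb_x ;; climb_y ;; output_cycle)%prog.

Lemma cycle_round_runs s D A cs adj : 0 < D -> bounded w s.1 -> base_mem s.1 ->
  adjacency s.1 adj -> s.1 xD 0 = D -> packing D s.1 A cs -> size cs < k ->
  runs w S cycle_round s (3000 * (n + m + 1)) (fun s' => exists A1 c,
    packing D s'.1 A1 (rcons cs c) /\ s'.2 = s.2 ++ cycle_code c).
Proof.
move=> D0 bs bm ad eD pk lk.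
apply: (runs_seq bs (reset_runs bs bm) (T2 := 2900 * (n + m + 1))); first by clear; lia.
move=> s1 b1 f1 [ws fr1]; have bm1 := base_mem_frame f1 isT bm; have [g1 o1] := f1.
have rd1 : ready s1.1 set0 ws.
  have -> : set0 = [set v : 'I_n | s.1 aSTAT v == 1]; last exact: fresh_ready fr1.
  by apply/setP=> v; rewrite !inE (pk_st pk); case: (_ \in _).
have ad1 := adjacency_frame f1 isT ad.
pose st v := if v \in covered cs then 2 else 0.
have st1 : status s1.1 st by move=> v; rewrite g1 //; exact: (pk_st pk).
have in1 : edge_set s1.1 aINH A by move=> e; rewrite g1 //; exact: (pk_inh pk).
have z1 (v : 'I_n) : s1.1 aDEG v = 0 /\ s1.1 aSUM v = 0.
  by have [_ [-> -> _]] := fr_v fr1 (ltn_ord v).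
apply: (runs_seq b1 (delete_dead_runs b1 bm1 st1 in1 z1) (T2 := 2700 * (n + m + 1))); first by clear; lia.
have -> : [set v | 1 < st v] = covered cs.
  by apply/setP=> v; rewrite inE /st; case: (v \in covered cs).
move=> s2 b2 f2 [in2 ct2]; have bm2 := base_mem_frame f2 isT bm1; have [g2 o2] := f2.
apply: (runs_seq b2 (trim_runs b2 bm2 in2 ct2) (T2 := 2500 * (n + m + 1))); first by clear; lia.
move=> s3 b3 f3 [A1 [[in3 ct3 [sub3 ex3]] no1]]; have bm3 := base_mem_frame f3 isT bm2; have [g3 o3] := f3.
apply: (runs_seq b3 (copy_edges_runs b3 bm3 in3) (T2 := 2400 * (n + m + 1))); first by clear; lia.
move=> s4 b4 f4 ac4; have bm4 := base_mem_frame f4 isT bm3; have [g4 o4] := f4.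
have rd4 := ready_frame f4 isT (ready_frame f3 isT (ready_frame f2 isT rd1)).
have ad4 := adjacency_frame f4 isT (adjacency_frame f3 isT (adjacency_frame f2 isT ad1)).
pose inc (v : 'I_n) : nat := 2 < deg A1 v.
have ps4 : params D inc s4.1.
  split=> // [|v]; first by rewrite g4 // g3 // g2 // g1.
  by rewrite g4 // (ct_deg ct3).
have sg4 := ready_searching inc D0 rd4 ad4 ac4.
have inc1 v : inc v <= 1 by exact: leq_b1.
have sub1 : A1 \subset A := subset_trans sub3 (avoid_sub A _).
have few : 2 * #|[set v | 2 < deg A1 v]| < 2 ^ D := branch_sub sub1 (pk_branch pk).
have flat s0 : sinv ed A1 set0 D inc s0 -> stk s0 = [::] -> forall u, u \in vis s0 -> ~ live ed s0 u.
  move=> sv es u uv; apply: (stk0_notlive sv es uv).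
  by rewrite (si_dp0 sv) //; exact: (search_exhausted sv D0 es (fun=> erefl) no1 few).
apply: (runs_seq b4 (@explore_runs A1 set0 D inc D0 inc1 s4 _ b4 ps4 sg4 flat _)
  (T2 := 1000 * (n + m + 1))).
- by case: ad4.
- by clear; lia.
move=> s5 b5 f5 post5; have bm5 := base_mem_frame f5 isT bm4; have [g5 o5] := f5.
have exA1 := ex3 _ (pk_excess pk lk).
(* The search cannot end without a cycle: an edge is left by the excess, it is either active at a
   visited vertex or a tree edge, and an exhausted search has neither. *)
case: post5 => [[s0 fd]|[_ [s0 [sv es allv]]]]; last first.
  have [e eA] : exists e, e \in A1 by move: exA1; rewrite addn1 => /excess_edge.
  case ea: (e \in act s0).
    have := flat s0 sv es _ (allv (ed e).1); case; exists e => //; exact: jn_ends_atl (jn_ends ed e).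
  have [v [u pv]] := si_used sv eA (negbT ea).
  by rewrite (search_exhausted sv D0 es (fun=> erefl) no1 few) in pv.
have mk5 (v : 'I_n) : s5.1 aMARK v = 0 by rewrite g5 //; exact: (rd_mark rd4 v).
apply: (runs_sub b5 (T := 300 * (n + 1) + 300 * (n + 1)) (Q := fun s' => exists A1 c,
    packing D s'.1 A1 (rcons cs c) /\ s'.2 = s5.2 ++ cycle_code c)); last 2 first.
- by clear; lia.
- move=> s' _ _ [A2 [c [h1 h2]]]; exists A2, c; split=> //.
  by rewrite h2 o5 // o4 // o3 // o2 // o1.
apply: (climbs_runs b5 bm5 fd mk5) => s6 c z b6 f6 wm gw; have [g6 o6] := f6.
have cn0 : c != [::] by case: gw => [[]].
have st6 : status s6.1 st by move=> v; rewrite g6 // g5 // g4 // g3 // g2 //; exact: st1.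
apply: (runs_sub b6 (output_cycle_runs b6 st6 wm cn0)) => // s7 b7 [g7 _] [st7 out7].
exists A1, c; split; last by rewrite out7 o6.
apply: (packing_step D0 pk lk sub3 exA1 gw) => //.
by move=> e; rewrite g7 // g6 // g5 // g4 //; exact: in3.
Qed.

Lemma output_cycles_runs s D H st r adj : 0 < D -> bounded w s.1 -> base_mem s.1 ->
  adjacency s.1 adj -> s.1 xD 0 = D -> ears s.1 st H r -> 0 < k ->
  r = (k - 1) * (8 * D + 5) + 1 -> 4 * r < 2 ^ D ->
  runs w S output_cycles s ((k + 2) * (3200 * (n + m + 2))) (fun s' => exists cs : seq steps,
    [/\ size cs = k, all (simple_cycle ed) cs, pairwise disjoint_walks cs &
        s'.2 = s.2 ++ 1 :: flatten [seq cycle_code c | c <- cs]]).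
Proof.
move=> D0 bs bm ad eD er k0 rE lrD.
apply: (runs_seq bs (clear_status_runs bs bm) (T2 := (k + 1) * (3200 * (n + m + 2)) + 20)).
  by clear; nia.
move=> s1 b1 f1 st1; have bm1 := base_mem_frame f1 isT bm; have [g1 o1] := f1.
have ad1 := adjacency_frame f1 isT ad.
have pre : runs w S (Out (#1)%prog) s1 10 (fun s' => s' = (s1.1, rcons s1.2 1)).
  case: (s1) b1 => M o bM; apply: (runs_block w_ge); [exact: bM | by [] |].
  by apply: (wp_out (x := 1)).
apply: (runs_seq b1 pre (T2 := (k + 1) * (3200 * (n + m + 2)))); first by clear; lia.
move=> s2 b2 f2 e2; have bm2 := base_mem_frame f2 isT bm1.
have ad2 := adjacency_frame f2 isT ad1.
have eD2 : s2.1 xD 0 = D by rewrite e2 /= g1.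
have lkw : k < 2 ^ w by case: bm2 => _ _ <- _ _.
apply: (@runs_for _ _ w_ge lS0 _ _ _ _ k (3000 * (n + m + 1)) _ (fun j s' => exists A (cs : seq steps),
  [/\ size cs = j, packing D s'.1 A cs & s'.2 = s2.2 ++ flatten [seq cycle_code c | c <- cs]])) => //.
- move=> s' f; have [_ _ mk _ _] := base_mem_frame f isT bm2.
  rewrite /= mk; do !split => //; have := S_big; clear; lia.
- exists H, [::]; split=> //; last by rewrite /= cats0.
  have cov0 : covered [::] = set0 by apply/setP=> v; rewrite !inE.
  split=> //.
  + by move=> e; rewrite /update /= e2 /= g1 //; exact: (er_inh er).
  + by move=> v; rewrite cov0 inE /update /= e2; exact: st1.
  + exact: ear_deg4 (er_inv er).
  (* Branch vertices of H are blocked, so there are at most [2 * r] of them. *)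
  + apply: leq_ltn_trans lrD; rewrite -[4]/(2 * 2) -mulnA leq_mul2l /=.
    apply: leq_trans (ear_blocked (er_inv er)); apply: subset_leq_card.
    apply/subsetP=> v; rewrite !inE => dv; have := er_le er v.
    case e: (st v) => [|[|[|]]] // _; first by rewrite (ear_absent (er_inv er) e) in dv.
    by have := ear_plain (er_inv er) e; rewrite leqNgt dv.
  + move=> _; rewrite cov0 /= -rE.
    have -> : avoid ed H set0 = H by apply/setP=> e; rewrite !inE !andbT.
    exact: ear_inv_excess (er_inv er).
- move=> j s3 lj b3 f3 xj [A [cs [sz pk out]]].
  have bm3 := base_mem_frame f3 isT bm2; have ad3 := adjacency_frame f3 isT ad2; have [g3 _] := f3.
  have eD3 : s3.1 xD 0 = D by rewrite g3.
  rewrite -sz in lj.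
  apply: (runs_sub b3 (cycle_round_runs D0 b3 bm3 ad3 eD3 pk lj)) => // s4 _ _ [A1 [c [pk1 out1]]].
  exists A1, (rcons cs c); split; first by rewrite size_rcons sz.
    by case: pk1 => *; split.
  by rewrite /= out1 out map_rcons flatten_rcons catA.
- move=> s' _ _ [A [cs [sz pk out]]]; exists cs; split=> //; [exact: pk_cycle pk | exact: pk_disj pk |].
  by rewrite out e2 /= o1 // cat_rcons.
- rewrite /=; clear; nia.
Qed.

Lemma forest_delete (st : 'I_n -> nat) (F : {set 'I_n}) :
  acyclic_off st -> (forall v, (v \in F) = (1 < st v)) ->
  @feedback_vertex_set (graph_of ed) F.
Proof.
move=> ac FE c; apply/negP=> /and4P[c0 u1 u2 cc].
pose f (p : vertex (@delete_vertices (graph_of ed) F) * edge (@delete_vertices (graph_of ed) F)) :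
  'I_n * 'I_m := (val p.1, val p.2).
have fu1 : unzip1 (map f c) = map val (unzip1 c) by rewrite /unzip1 -!map_comp.
have fu2 : unzip2 (map f c) = map val (unzip2 c) by rewrite /unzip2 -!map_comp.
have := ac (map f c); rewrite fu1; case/(_ _)/negP.
  apply/allP=> v /mapP[u _ ->]; have := valP u; rewrite /= FE -leqNgt; exact: id.
apply/and4P; split.
- by case: (c) c0.
- by rewrite fu1 (map_inj_uniq val_inj).
- by rewrite fu2 (map_inj_uniq val_inj).
- apply: homo_cycle cc => p q; rewrite /joins /jn /= /kept_ends.
  by case/orP=> /eqP[e1 e2]; apply/orP; [left | right]; apply/eqP;
    rewrite [LHS]surjective_pairing; congr (_, _); rewrite -?e1 -?e2.
Qed.

(** * Thresholds and the whole program *)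

Section Main.
Hypothesis word_k : 200 * (k + 1) * (k + 1) < 2 ^ w.
Hypothesis k_gt0 : 0 < k.

(** [L] is the bit length of [k]; it serves as an integer substitute for log k. *)
Record bounds (M : memory) (L : nat) : Prop := Bounds {
  bd_lt : k < 2 ^ L;
  bd_le : 2 ^ L <= 2 * k;
  bd_D : M xD 0 = 2 * L + 8;
  bd_T : M xT 0 = (k - 1) * (8 * (2 * L + 8) + 5) + 1 }.

Lemma set_bounds_runs s : bounded w s.1 -> base_mem s.1 ->
  runs w S set_bounds s (100 * (k + 1)) (fun s' => exists L, bounds s'.1 L).
Proof.
have lS2 : 2 < S by have := S_big; clear; lia.
have kw x : x <= 200 * (k + 1) -> x < 2 ^ w.
  by move=> h; apply: leq_ltn_trans word_k; apply: leq_trans h _; rewrite leq_pmulr // addn1.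
move=> bs bm.
pose I v (s' : state) := exists L, [/\ s'.1 xL 0 = L, s'.1 xX 0 = k %/ 2 ^ L,
  2 ^ L <= 2 * k & k %/ 2 ^ L <= v].
have pre : runs w S (xL ::= #0 ;; xX ::= eK)%prog s 20 (fun s' => I k s').
  case: (s) bs bm => M o bM [_ _ m2 _ _]; rewrite /= in m2; apply: (runs_block w_ge); [exact: bM | by [] |].
  do_put 0 0 lw0.
  do_put 0 k m2.
  exists 0; split=> //=; rewrite ?expn0 ?divn1 //; move: k_gt0; clear; lia.
apply: (runs_seq bs pre (T2 := 50 * (k + 1) + 30)); first by clear; lia.
move=> s1 b1 f1 I1; have bm1 := base_mem_frame f1 isT bm.
apply: (runs_seq b1 (T1 := 50 * (k + 1)) (T2 := 30) (Q1 := fun s' => exists L,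
   [/\ s'.1 xL 0 = L, k < 2 ^ L & 2 ^ L <= 2 * k])) => //.
  apply: (runs_while w_ge (K := 40) (v := k) (I := I)) => //; last by rewrite /=; clear; lia.
  move=> v [M o] bM f [L [eL eX lL lv]]; rewrite /= in eL eX.
  split; first by rewrite /=; do !split.
  rewrite /= eX; case: (k %/ 2 ^ L =P 0) => [z|/eqP nz].
    by exists L; split=> //; rewrite ltnNge -divn_gt0 ?expn_gt0 // z.
  have pos : 0 < k %/ 2 ^ L by rewrite lt0n.
  have lk : 2 ^ L <= k by rewrite -divn_gt0 ?expn_gt0.
  have lLk : L < k by apply: leq_trans lk; exact: ltn_expl.
  have lw2 : L + 1 < 2 ^ w by apply: kw; move: lLk; clear; lia.
  apply: (runs_block w_ge); [exact: bM | by [] |].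
  do_put 0 (k %/ 2 ^ L %/ 2) eX.
  do_put 0 (L + 1) eL.
  exists (k %/ 2 ^ L %/ 2).
    by apply: leq_trans lv; rewrite ltn_Pdiv.
  exists (L + 1); rewrite -divnMA -expnSr addn1; split=> //.
  by rewrite expnS leq_mul2l.
move=> [M o] bM f2 [L [eL lL Lk]].
have [m0 m1 m2 _ _] := base_mem_frame f2 isT bm1; rewrite /= in m2 eL.
have lLk : L < 2 * k by apply: leq_trans Lk; exact: ltn_expl.
have w1 : 2 * L < 2 ^ w by apply: kw; move: lLk; clear; lia.
have w2 : 2 * L + 8 < 2 ^ w by apply: kw; move: lLk; clear; lia.
have w3 : 8 * (2 * L + 8) < 2 ^ w by apply: kw; move: lLk; clear; lia.
have w4 : 8 * (2 * L + 8) + 5 < 2 ^ w by apply: kw; move: lLk; clear; lia.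
have w6 : (k - 1) * (8 * (2 * L + 8) + 5) + 1 < 2 ^ w.
  by apply: leq_ltn_trans word_k; move: lLk; clear; nia.
have w5 : (k - 1) * (8 * (2 * L + 8) + 5) < 2 ^ w by move: w6; clear; lia.
apply: (runs_block w_ge); [exact: bM | by [] |].
do_put 0 (2 * L + 8) eL.
do_put 0 ((k - 1) * (8 * (2 * L + 8) + 5) + 1) m2.
by exists L.
Qed.

(** Let P = [2 ^ L], which exceeds k and L. Then 4T is bounded by a quadratic in P with leading
    coefficient 64, while [2 ^ D] is 256 P^2. *)
Lemma threshold_lt M L : bounds M L -> 4 * M xT 0 < 2 ^ M xD 0.
Proof.
move=> [h1 h2 -> ->].
have L0 : 0 < L by case: L h1 {h2} => // ; rewrite expn0; move: k_gt0; clear; lia.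
have -> : 2 ^ (2 * L + 8) = 2 ^ L * (256 * 2 ^ L).
  by rewrite expnD mul2n -addnn expnD [256 * _]mulnC mulnA.
have lL : L < 2 ^ L by exact: ltn_expl.
move: lL h1 L0; move: (2 ^ L) k_gt0 => P; clear; nia.
Qed.

(** The first factor counts rounds, T for ears and k for cycles, with another k to absorb the
    computation of the thresholds; the second bounds the cost of a round. *)
Definition main_time (T : nat) : nat := (T + 2 * k + 10) * (4000 * (n + m + 2)).

Lemma main_time_setup T : 100 * (k + 1) + (T + k + 8) * (4000 * (n + m + 2)) <= main_time T - 30.
Proof.
have hP : 4000 <= 4000 * (n + m + 2) by clear; lia.
rewrite /main_time; move: hP; move: (4000 * (n + m + 2)) => P; clear => hP.
have : (k + 2) * 4000 <= (k + 2) * P by rewrite leq_mul2l hP orbT.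
have -> : (T + 2 * k + 10) * P = (T + k + 8) * P + (k + 2) * P by rewrite -mulnDl; congr (_ * _); lia.
move: ((T + k + 8) * P) ((k + 2) * P) => a b; lia.
Qed.

Lemma main_time_adjacency T : 100 * (n + m + 1) + (T + k + 7) * (4000 * (n + m + 2)) <=
  (T + k + 8) * (4000 * (n + m + 2)).
Proof.
rewrite -[T + k + 8]/(T + k + (7 + 1)) addnA [X in _ <= X]mulnDl mul1n addnC leq_add2l.
clear; lia.
Qed.

Lemma main_time_rounds T : (T + 2) * (3000 * (n + m + 2)) + ((k + 2) * (3200 * (n + m + 2)) + 100) <=
  (T + k + 7) * (4000 * (n + m + 2)).
Proof.
have h1 : (T + 2) * (3000 * (n + m + 2)) <= (T + 2) * (4000 * (n + m + 2)).
  by rewrite leq_mul2l leq_mul2r /= !orbT.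
have h2 : (k + 2) * (3200 * (n + m + 2)) <= (k + 2) * (4000 * (n + m + 2)).
  by rewrite leq_mul2l leq_mul2r /= !orbT.
have -> : (T + k + 7) * (4000 * (n + m + 2)) =
    (T + 2) * (4000 * (n + m + 2)) + ((k + 2) * (4000 * (n + m + 2)) + 3 * (4000 * (n + m + 2))).
  by rewrite -!mulnDl; congr (_ * _); clear; lia.
apply: leq_add => //; apply: leq_add => //; clear; lia.
Qed.

Lemma main_time_if_n T : (cost eN + (main_time T - 30)).+1 <= main_time T - 20.
Proof.
have : 100 * (k + 1) + 0 <= main_time T - 30 by apply: leq_trans (main_time_setup T); rewrite leq_add2l.
rewrite /=; clear; lia.
Qed.

Lemma main_time_if_k T : (cost eK + (main_time T - 20)).+1 <= main_time T.
Proof.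
have : 100 * (k + 1) + 0 <= main_time T - 30 by apply: leq_trans (main_time_setup T); rewrite leq_add2l.
rewrite /=; clear; lia.
Qed.

Lemma main_runs s : bounded w s.1 -> base_mem s.1 -> (forall a i, 2 < a -> s.1 a i = 0) ->
  exists L, k < 2 ^ L /\ 2 ^ L <= 2 * k /\
  runs w S main s (main_time ((k - 1) * (8 * (2 * L + 8) + 5) + 1)) (fun s' =>
    (exists cs : seq steps,
      [/\ size cs = k, all (simple_cycle ed) cs, pairwise disjoint_walks cs &
        s'.2 = s.2 ++ 1 :: flatten [seq cycle_code c | c <- cs]]) \/
    (exists st : 'I_n -> nat,
      [/\ acyclic_off st, forall v, st v <= 2,
        #|[set v | st v == 2]| <= 2 * ((k - 1) * (8 * (2 * L + 8) + 5)) &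
        s'.2 = s.2 ++ 0 :: [seq nat_of_ord v | v <- enum 'I_n & st v == 2]])).
Proof.
have lS2 : 2 < S by have := S_big; clear; lia.
move=> bs bm z0; have [m0 m1 m2 m3 m4] := bm.
have [t1 [s1 [x1 l1 [L bd]]]] := set_bounds_runs bs bm.
have b1 := exec_bounded x1 bs; have f1 := exec_frame x1; have [g1 o1] := f1.
have [kL Lk eD eT] := bd; set T := (k - 1) * _ + 1 in eT *.
exists L; split=> //; split=> //.
apply: (runs_if w_ge (T := main_time T - 20)) => //.
  move=> _; apply: (runs_if w_ge (T := main_time T - 30)) => //.
  - move=> _.
    have pre : runs w S set_bounds s (100 * (k + 1)) (fun s' => s' = s1) by exists t1, s1.
    apply: (runs_seq bs pre (T2 := (T + k + 8) * (4000 * (n + m + 2)))).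
      exact: main_time_setup.
    move=> _ _ _ ->; have bm1 := base_mem_frame f1 isT bm.
    have hd0 v : s1.1 aHEAD v = 0 by rewrite g1 // z0.
    apply: (runs_seq b1 (build_adjacency_runs b1 bm1 hd0) (T2 := (T + k + 7) * (4000 * (n + m + 2)))).
      exact: main_time_adjacency.
    move=> s2 b2 f2 [adj ad]; have bm2 := base_mem_frame f2 isT bm1; have [g2 o2] := f2.
    have D0 : 0 < 2 * L + 8 by rewrite addnS.
    have eD2 : s2.1 xD 0 = 2 * L + 8 by rewrite g2.
    have eT2 : s2.1 xT 0 = T by rewrite g2.
    have st2 : status s2.1 (fun _ : 'I_n => 0) by move=> v; rewrite g2 // g1 // z0.
    have in2 : edge_set s2.1 aINH (set0 : {set 'I_m}) by move=> v; rewrite g2 // g1 // z0 // inE.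
    apply: (runs_seq b2 (find_ears_runs D0 b2 bm2 ad eD2 eT2 st2 in2)
      (T2 := (k + 2) * (3200 * (n + m + 2)) + 100)); first exact: main_time_rounds.
    move=> s3 b3 f3 post; have bm3 := base_mem_frame f3 isT bm2; have [g3 o3] := f3.
    have ad3 := adjacency_frame f3 isT ad.
    have eo : s3.2 = s.2 by rewrite o3 // o2 // o1.
    apply: (runs_if w_ge (T := (k + 2) * (3200 * (n + m + 2)))) => //=.
    + move=> stuck; case: post => [[e0]|[_ [st [H [r [rT er ac]]]]]]; first by rewrite e0 in stuck.
      apply: (runs_sub b3 (output_blocked_runs b3 bm3 (er_st er))); first by clear; nia.
      move=> s4 _ _ out; right; exists st; split=> //; [exact: er_le er | | by rewrite out eo].
      (* A stuck search has added at most T - 1 ears. For k = 1 this is 0, so the set is empty, as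
         it must be when k log k = 0. *)
      apply: leq_trans (ear_blocked (er_inv er)) _; rewrite leq_mul2l /=.
      by move: rT; rewrite /T addn1 ltnS.
    + move=> /eqP ns; case: post => [[_ [st [H er]]]|[e1]]; last by rewrite e1 in ns.
      have eD3 : s3.1 xD 0 = 2 * L + 8 by rewrite g3.
      have lt := threshold_lt bd; rewrite eT eD in lt.
      apply: (runs_sub b3 (output_cycles_runs D0 b3 bm3 ad3 eD3 er k_gt0 erefl lt)) => //.
      move=> s4 _ _ [cs [q1 q2 q3 q4]]; left; exists cs; split=> //; by rewrite q4 eo.
    + by clear; lia.
  - by rewrite /= m0 eqn0Ngt n_pos.
  - exact: main_time_if_n.
- by rewrite /= m2 eqn0Ngt k_gt0.
- exact: main_time_if_k.
Qed.

End Main.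

End Machine.

(** * Bounds *)

Section Logarithm.
Local Open Scope R_scope.

Lemma INR_mulS (a b : nat) : INR (a * b)%N = INR a * INR b.
Proof. by rewrite -multE mult_INR. Qed.

Lemma INR_addS (a b : nat) : INR (a + b)%N = INR a + INR b.
Proof. by rewrite -plusE plus_INR. Qed.

Lemma INR_leq (a b : nat) : (a <= b)%N -> INR a <= INR b.
Proof. by move=> /leP; exact: le_INR. Qed.

Lemma INR_exp2 (L : nat) : INR (2 ^ L)%N = 2 ^ L.
Proof. by elim: L => [|L IH] //; rewrite expnS INR_mulS IH. Qed.

Lemma INR_ge1 (k : nat) : (0 < k)%N -> 1 <= INR k.
Proof. by move=> /INR_leq. Qed.

Lemma ln_INR_bounds (k : nat) : (0 < k)%N -> 0 <= ln (INR k) <= INR k.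
Proof.
move=> /INR_ge1 h; split.
  by rewrite -ln_1; case: h => [h|<-]; [left; apply: ln_increasing => //; lra | right].
have := exp_ineq1_le (ln (INR k)); rewrite exp_ln; lra.
Qed.

(** The upper bound combines ln k <= k with ln 2 > 1/2. *)
Lemma klogk_bounds (k : nat) : 0 <= klogk k <= 2 * INR (k * k).
Proof.
rewrite /klogk /Rlog2 INR_mulS; case: (posnP k) => [->|k0].
  by rewrite /= !Rmult_0_l; lra.
have [h1 h2] := ln_INR_bounds k0; have h3 := INR_ge1 k0; have h4 := ln_lt_2.
have h5 : 0 <= ln (INR k) / ln 2 by apply: Rmult_le_pos => //; left; apply: Rinv_0_lt_compat; lra.
have h6 : ln (INR k) / ln 2 <= 2 * INR k.
  by apply: (Rmult_le_reg_r (ln 2)); first lra; rewrite /Rdiv Rmult_assoc Rinv_l; [nra | lra].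
by split; nra.
Qed.

(** The crude bound on k log k replaces the assumption over the reals by one over naturals, at the
    price of a higher power of k in the running time. *)
Lemma few_edges_leq (d : R) (dn n m k : nat) : d < INR dn -> few_edges d n m k ->
  (m <= dn * (2 * (k * k) + 1) * n)%N.
Proof.
move=> hd hm; apply/leP; apply: INR_le; rewrite !INR_mulS INR_addS !INR_mulS /=.
have [h1 h2] := klogk_bounds k; rewrite INR_mulS in h2; have hn := pos_INR n.
apply: Rle_trans hm _; apply: Rmult_le_compat_r => //.
have h0 : 0 <= INR dn := pos_INR dn.
apply: (Rle_trans _ (INR dn * (klogk k + 1))); first by apply: Rmult_le_compat_r; lra.
by apply: Rmult_le_compat_l; lra.
Qed.

(** As L <= 1 + log k, the sum 16L + 69 is at most 16 log k + 85, hence at most 101 log k once log k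
    >= 1; twice 101 is the constant 202. For k = 1 the factor k - 1 vanishes. *)
Lemma blocked_size_klogk (k L r : nat) : (0 < k)%N -> (2 ^ L <= 2 * k)%N ->
  (r <= 2 * ((k - 1) * (8 * (2 * L + 8) + 5)))%N -> at_most_klogk 202 k r.
Proof.
rewrite /at_most_klogk => k0 lL lr; have [k1|k2] := leqP k 1.
  have r0 : r = 0%N by move: lr; rewrite (_ : k - 1 = 0)%N ?mul0n ?muln0 //; lia.
  by rewrite r0 /=; have [h _] := klogk_bounds k; lra.
have h1 : 2 <= INR k by apply: (INR_leq (a := 2)).
have h4 := ln_lt_2.
set g := Rlog2 (INR k).
have kE : klogk k = INR k * g by [].
have gk : g * ln 2 = ln (INR k) by rewrite /g /Rlog2 /Rdiv Rmult_assoc Rinv_l ?Rmult_1_r //; lra.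
have ln2k : ln 2 <= ln (INR k).
  by case: h1 => [h|<-]; [left; apply: ln_increasing => //; lra | right].
have g1 : 1 <= g by apply: (Rmult_le_reg_r (ln 2)); lra.
have Lg : INR L <= 1 + g.
  apply: (Rmult_le_reg_r (ln 2)); first lra.
  rewrite -ln_pow; last lra.
  rewrite Rmult_plus_distr_r gk Rmult_1_l -ln_mult; [|lra|lra].
  have : 2 ^ L <= 2 * INR k by rewrite -INR_exp2 -[2 * _]/(INR 2 * INR k) -INR_mulS; exact: INR_leq.
  case=> [h|->]; last exact: Rle_refl.
  by left; apply: ln_increasing => //; apply: pow_lt; lra.
have : INR r <= 2 * (INR k * (16 * INR L + 69)).
  have lr2 : (r <= 2 * (k * (16 * L + 69)))%N.
    apply: leq_trans lr _; rewrite leq_mul2l /=; apply: leq_mul; first exact: leq_subr.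
    by clear; lia.
  have := INR_leq lr2; rewrite !INR_mulS INR_addS INR_mulS /=.
  have -> : (1 + 1 + 1 + 1 + 1 + 1 + 1 + 1 + 1 + 1 + 1 + 1 + 1 + 1 + 1 + 1) = 16 by lra.
  by lra.
rewrite kE => hr; apply: Rle_trans hr _.
have : 16 * INR L + 69 <= 101 * g by lra.
by move=> h; nra.
Qed.

End Logarithm.

Lemma bit_length_lt x : x < 2 ^ bit_length x.
Proof. exact: trunc_log_ltn. Qed.

(** The input size contains only the bits of [k], so the bit length of n + m + k must be bounded by
    n + m plus these bits. *)
Lemma bit_length_add a k : bit_length (a + k) <= a + bit_length k.
Proof.
rewrite {1}/bit_length; case: (posnP (a + k)) => [->|pos]; first by rewrite addnS ltnS.
have h : 2 ^ trunc_log 2 (a + k) < 2 ^ (a + bit_length k).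
  apply: leq_ltn_trans (trunc_logP _ pos) _ => //.
  have h1 := bit_length_lt k; have h2 : a < 2 ^ a by exact: ltn_expl.
  by rewrite expnD; move: h1 h2; move: (2 ^ _) (2 ^ _) => x y; clear; nia.
by rewrite ltn_exp2l in h.
Qed.

(** * Word length, space and time *)

Section Final.
Variables (n m k : nat) (ed : 'I_m -> 'I_n * 'I_n).
Let w := 20 * bit_length (n + m + k).
Let S := 2 * n + 2 * m + 9.

Lemma input_le a i : input_memory ed k a i <= n + m + k.
Proof.
have nth_le (s : seq nat) : (forall x, x \in s -> x <= n + m + k) -> nth 0 s i <= n + m + k.
  move=> h; case: (ltnP i (size s)) => li; first by apply: h; exact: mem_nth.
  by rewrite nth_default.
case: a => [|[|[|a]]] //=; apply: nth_le => x.
- by rewrite !inE => /or3P[]/eqP->; clear; lia.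
- by move=> /mapP[e _ ->]; apply: leq_trans (ltnW (ltn_ord _)) _; rewrite -addnA leq_addr.
- by move=> /mapP[e _ ->]; apply: leq_trans (ltnW (ltn_ord _)) _; rewrite -addnA leq_addr.
Qed.

Lemma word_pow x : x < 2 ^ bit_length (n + m + k) -> x < 2 ^ w.
Proof. by move=> h; apply: leq_trans h _; rewrite leq_exp2l // /w leq_pmull. Qed.

Lemma input_bounded : bounded w (input_memory ed k).
Proof. by move=> a i; apply: word_pow; apply: leq_ltn_trans (input_le a i) (bit_length_lt _). Qed.

Lemma input_base : base_mem k ed (input_memory ed k).
Proof.
by split=> // e; rewrite /= (nth_map e) ?size_enum_ord ?nth_ord_enum.
Qed.

Lemma word_ge : 128 < 2 ^ w.
Proof.
by rewrite -[128]/(2 ^ 7) ltn_exp2l // /w; apply: (@leq_trans (20 * 1)); rewrite // leq_mul2l.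
Qed.

Lemma word_square c x : c <= 2 ^ 8 -> x <= n + m + k + 1 -> c * x * x < 2 ^ w.
Proof.
move=> hc hx; set P := 2 ^ bit_length (n + m + k).
have hP : x <= P by apply: leq_trans hx _; rewrite addn1; exact: bit_length_lt.
have P2 : 2 <= P by rewrite -[2]/(2 ^ 1) leq_exp2l.
have -> : 2 ^ w = P ^ 20 by rewrite /w mulnC expnM.
rewrite -mulnA; apply: (@leq_ltn_trans (P ^ 8 * (P * P))).
  by apply: leq_mul; [apply: leq_trans hc _; rewrite leq_exp2r | exact: leq_mul].
by rewrite mulnA -!expnSr ltn_exp2l.
Qed.

Lemma space_bound : space main w S <= (input_size n m k).+2 ^ 12.
Proof.
rewrite /space (_ : size (undup (arrays main)) = 38) //.
set X := (input_size n m k).+2.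
have hw : w <= 20 * X.
  rewrite /w leq_mul2l /=; apply: leq_trans (bit_length_add _ _) _.
  by rewrite /X /input_size; clear; lia.
have hS : S <= 9 * X by rewrite /X /input_size /S; clear; lia.
have X3 : 3 <= X by rewrite /X /input_size /bit_length; clear; lia.
(* Cells and word length give one factor [X] each; as [X] is at least 3, the constants 38, 20 and 9
   are below [X ^ 4], [X ^ 3] and [X ^ 3]. *)
have -> : X ^ 12 = X ^ 4 * X * (X ^ 3 * X) * X ^ 3 by rewrite -!expnSr -!expnD.
apply: leq_trans (leq_mul (leq_mul (leqnn 38) hS) hw) _.
have h3 : 27 <= X ^ 3 by rewrite -[27]/(3 ^ 3) leq_exp2r.
have h4 : 81 <= X ^ 4 by rewrite -[81]/(3 ^ 4) leq_exp2r.
have -> : 38 * (9 * X) * (20 * X) = 38 * X * (20 * X) * 9 by clear; nia.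
apply: leq_mul; last by apply: leq_trans h3.
by apply: leq_mul; rewrite leq_mul2r; apply/orP; right; [apply: leq_trans h4 | apply: leq_trans h3].
Qed.

(** Rounds number O(k^2), since L < 2k, and each costs O(k^2 n) by the bound on m. *)
Lemma main_time_bound dn L : 0 < k -> 0 < n -> 2 ^ L <= 2 * k ->
  m <= dn * (2 * (k * k) + 1) * n ->
  main_time n m k ((k - 1) * (8 * (2 * L + 8) + 5) + 1) <= 114 * (4000 * (3 + 3 * dn)) * (k ^ 4 * n).+1.
Proof.
move=> k0 n0 hL hm.
have lL : L < 2 * k by apply: leq_trans hL; exact: ltn_expl.
rewrite /main_time.
have hT : (k - 1) * (8 * (2 * L + 8) + 5) + 1 + 2 * k + 10 <= 114 * (k * k).
  by move: lL k0; clear; nia.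
have hN : n + m + 2 <= (3 + 3 * dn) * (k * k * n).
  have h1 : 2 * (k * k) + 1 <= 3 * (k * k) by move: k0; clear; nia.
  have h2 : m <= dn * (3 * (k * k)) * n.
    by apply: leq_trans hm _; rewrite leq_mul2r leq_mul2l h1 !orbT.
  have h3 : n <= k * k * n by rewrite leq_pmull // muln_gt0 k0.
  have -> : (3 + 3 * dn) * (k * k * n) = 3 * (k * k * n) + dn * (3 * (k * k)) * n.
    by rewrite mulnDl; congr (_ + _); rewrite -!mulnA [3 * _]mulnCA.
  by move: h2 h3 n0; move: (k * k * n) (dn * _ * n); clear; lia.
apply: leq_trans (leq_mul hT (leq_mul (leqnn 4000) hN)) _.
have -> : 114 * (k * k) * (4000 * ((3 + 3 * dn) * (k * k * n))) = 114 * (4000 * (3 + 3 * dn)) * (k ^ 4 * n).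
  by rewrite -[k ^ 4]/(k * (k * (k * k))); clear; lia.
by rewrite leq_mul2l leqnSn orbT.
Qed.

End Final.

Theorem theorem2 :
  exists (c : R) (P : cmd) (q a b : nat),
  forall d : R, exists C : nat,
  forall (n m : nat) (ed : 'I_m -> 'I_n * 'I_n) (k : nat),
    multiplicity_le2 (graph_of ed) ->
    few_edges d n m k ->
    let w := q * bit_length (n + m + k) in
    exists (S t : nat) (M : memory) (ans : answer n m),
      [/\ exec w S P (input_memory ed k, [::]) t (M, encode_answer ans),
          correct_answer c ed k ans,
          t <= C * (k ^ a * n).+1 &
          space P w S <= (input_size n m k).+2 ^ b].
Proof.
exists (IZR 202), main, 20, 4, 12 => d.
have [dn hdn] := INR_unbounded d.
exists (114 * (4000 * (3 + 3 * dn))) => n m ed k _ fe w.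
exists (2 * n + 2 * m + 9); set S := 2 * n + 2 * m + 9.
set C := 114 * _; have C20 : 40 <= C by apply: (@leq_trans (114 * 1)); rewrite // leq_mul2l muln_gt0 /= addn_gt0.
have sp := space_bound n m k; have w_ge := word_ge n m k; rewrite -/w in w_ge.
pose s0 : state := (input_memory ed k, [::]).
have b0 : bounded w s0.1 := input_bounded k ed.
have bm0 : base_mem k ed s0.1 := input_base k ed.
have lS2 : 2 < S by rewrite /S; lia.
have lS0 : 0 < S by rewrite /S; lia.
suff [ans [cor [t [[M o] [x lt /= eo]]]]] : exists ans : answer n m, correct_answer (IZR 202) ed k ans /\
    runs w S main s0 (C * (k ^ 4 * n).+1) (fun s' => s'.2 = encode_answer ans).
  by exists t, M, ans; split=> //; rewrite -eo.
have dk : den s0.1 eK = k by [].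
have dn0 : den s0.1 eN = n by [].
have short c T (Q : state -> Prop) e c' : den s0.1 e = 0 -> safe w S s0.1 e -> cost e <= 3 -> wp w S c' Q s0 ->
    time c' <= 5 -> 20 <= T -> runs w S (If e c c') s0 T Q.
  move=> e0 se ce hw tc hT; apply: (runs_if w_ge (T := 5)) => //.
  - by rewrite e0.
  - by move=> _; apply: (runs_block w_ge b0 tc hw).
  - by apply: leq_trans hT; move: ce; clear; lia.
(* For k = 0 and for n = 0 the product in the time bound vanishes, and its successor pays for the
   constant number of steps. *)
case: (posnP k) => [k0|k_gt0].
  exists (@Cycles n m [::]); split; first by split.
  apply: short => //.
  by apply: (@leq_trans 40) => //; apply: leq_trans C20 _; exact: leq_pmulr.
case: (posnP n) => [n0|n_gt0].
  exists (@FeedbackSet n m [::]); split.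
    split=> //; last by rewrite /at_most_klogk /=; have [h _] := klogk_bounds k; lra.
    by move=> [|[[v vF] e] c] //; have := ltn_ord v; rewrite {2}n0.
  apply: (runs_if w_ge (T := 20)) => //.
  - by move=> _; apply: short.
  - by rewrite dk eqn0Ngt k_gt0.
  - by apply: (@leq_trans 40) => //; apply: leq_trans C20 _; exact: leq_pmulr.
have room : roomy n m w S.
  split=> //; last by rewrite /S; lia.
  by apply: word_square => //; lia.
have wk : 200 * (k + 1) * (k + 1) < 2 ^ w by apply: word_square => //; lia.
have z0 a i : 2 < a -> s0.1 a i = 0 by case: a => [|[|[|a]]].
have [L [kL [Lk R]]] := main_runs room wk k_gt0 b0 bm0 z0.
have [t [s1 [x lt post]]] := R; rewrite /= in post.
have lt' : t <= C * (k ^ 4 * n).+1.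
  by apply: leq_trans lt _; apply: main_time_bound => //; exact: few_edges_leq hdn fe.
case: post => [[cs [sz cyc dis out]]|[st [ac st2 sz out]]].
  exists (@Cycles n m cs); split; last by exists t, s1.
  by split.
exists (@FeedbackSet n m [seq v <- enum 'I_n | st v == 2]); split; last by exists t, s1.
split; first by rewrite filter_uniq ?enum_uniq.
  apply: (forest_delete ac) => v; rewrite inE mem_filter mem_enum andbT.
  by have := st2 v; case: (st v) => [|[|[|]]].
apply: (blocked_size_klogk k_gt0 Lk); apply: leq_trans sz.
rewrite cardE; apply: uniq_leq_size; first by rewrite filter_uniq ?enum_uniq.
by move=> v; rewrite mem_filter => /andP[sv _]; rewrite mem_enum inE.
Qed.
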